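(* Let $K$ be an algebraically closed field of characteristic $0$ and let $C\subset\mathbb{P}^2$ be a smooth plane curve over $K$ of degree $d\ge 4$. Let $n:=n_1<n_2<\dots<n_r$ be positive integers which are all divisible by some integer $m\ge 2$. Then we have the following. (1) $\sum_{i=1}^{r}\delta[n_i]\,(n_i-1+d(n_i-2))\le 3d(d-2)$. (2) If $(n+1)(n-1+d(n-2))>3d(d-2)$, then $\sum_{i=1}^r\delta[n_i]\le 1$. (3) If $(n^2+n+1)(n-1+d(n-2))>3d(d-2)$, then $\sum_{i=1}^r\delta[n_i]\le d$.
   Context: For $P\in\mathbb{P}^2$, $\pi_P:C\dashrightarrow\mathbb{P}^1$ is the projection from $P$, and $G[P]=\{\tau\in\mathrm{Bir}(C)\mid \pi_P\circ\tau=\pi_P\}$. $P$ is called quasi-Galois if $|G[P]|\ge 2$. For an integer $n\ge 2$, $\delta[n]$ denotes the number of quasi-Galois points $P\in C$ with $|G[P]|=n$. *)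

(* Defs.v *)
From mathcomp Require Import all_boot all_order all_algebra.
From mathcomp Require Import finmap.
From mathcomp Require Import boolp classical_sets functions cardinality.
From mathcomp Require Import mpoly.

Set Implicit Arguments.
Unset Strict Implicit.
Unset Printing Implicit Defensive.

Import GRing.Theory.
Local Open Scope classical_set_scope.
Local Open Scope card_scope.
Local Open Scope ring_scope.

(* A point of the projective plane is a line through the origin of K^3. *)
Definition P2 (K : fieldType) : Type :=
  {U : {vspace 'rV[K]_3} | \dim U == 1%N}.

(* The curve is given by a ternary form f, its equation (unique up to a nonzero
   scalar). *)

(* Jacobian criterion. For d >= 1 it makes f irreducible, so the homogeneous
   coordinate ring of the curve is the domain K[x, y, z] / (f). *)
Definition smooth_plane_curve (K : fieldType) (d : nat) (f : {mpoly K[3]}) :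
    Prop :=
  [/\ f != 0, f \is d.-homog
    & forall v : 'rV[K]_3, v != 0 -> f.@[v 0] = 0 ->
        exists i : 'I_3, (f^`M(i)).@[v 0] != 0].

Definition on_curve (K : fieldType) (f : {mpoly K[3]}) (P : P2 K) : Prop :=
  forall v : 'rV[K]_3, v \in val P -> f.@[v 0] = 0.

(* p vanishes identically on the curve f = 0. *)
Definition zero_on (K : fieldType) (f p : {mpoly K[3]}) : Prop :=
  exists q : {mpoly K[3]}, p = f * q.

(* An m-tuple of forms F represents the rational map
   x |-> (F_0(x) : ... : F_(m-1)(x)) from the curve f = 0 to P^(m-1). *)
Definition rat_rep (K : fieldType) (f : {mpoly K[3]}) (m : nat)
    (F : m.-tuple {mpoly K[3]}) : Prop :=
  (exists e : nat, forall i : 'I_m, tnth F i \is e.-homog) /\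
  (exists i : 'I_m, ~ zero_on f (tnth F i)).

(* F and G represent the same rational map on the curve f = 0. *)
Definition rat_eq (K : fieldType) (f : {mpoly K[3]}) (m : nat)
    (F G : m.-tuple {mpoly K[3]}) : Prop :=
  [/\ rat_rep f F, rat_rep f G
    & forall i j : 'I_m,
        zero_on f (tnth F i * tnth G j - tnth F j * tnth G i)].

Definition rat_comp (K : fieldType) (m : nat) (F : m.-tuple {mpoly K[3]})
    (G : 3.-tuple {mpoly K[3]}) : m.-tuple {mpoly K[3]} :=
  [tuple tnth F i \mPo G | i < m].

Definition rat_id (K : fieldType) : 3.-tuple {mpoly K[3]} :=
  [tuple 'X_i | i < 3].

(* F represents a rational map from the curve f = 0 to itself. *)
Definition rat_self (K : fieldType) (f : {mpoly K[3]})
    (F : 3.-tuple {mpoly K[3]}) : Prop :=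
  rat_rep f F /\ zero_on f (f \mPo F).

Definition birational_self (K : fieldType) (f : {mpoly K[3]})
    (F : 3.-tuple {mpoly K[3]}) : Prop :=
  rat_self f F /\
  exists G : 3.-tuple {mpoly K[3]},
    [/\ rat_self f G, rat_eq f (rat_comp F G) (rat_id K)
      & rat_eq f (rat_comp G F) (rat_id K)].

(* Bir(C); a birational map is the set of all tuples of forms representing it. *)
Definition Bir (K : fieldType) (f : {mpoly K[3]}) :
    set (set (3.-tuple {mpoly K[3]})) :=
  [set [set G | rat_eq f F G] | F in [set F | birational_self f F]].

(* (L_0 : L_1) is the projection from P: two linear forms whose only common zero
   in the plane is P. It is unique up to automorphisms of P^1. *)
Definition projection_from (K : fieldType) (P : P2 K)
    (L : 2.-tuple {mpoly K[3]}) : Prop :=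
  (forall i : 'I_2, tnth L i \is 1.-homog) /\
  (forall v : 'rV[K]_3,
     v \in val P <-> forall i : 'I_2, (tnth L i).@[v 0] = 0).

(* G[P]; as projections from P differ by automorphisms of P^1, it does not depend
   on the choice of L (nor on that of the representative F of tau). *)
Definition gal (K : fieldType) (f : {mpoly K[3]}) (P : P2 K) :
    set (set (3.-tuple {mpoly K[3]})) :=
  [set tau | Bir f tau /\
     exists (F : 3.-tuple {mpoly K[3]}) (L : 2.-tuple {mpoly K[3]}),
       [/\ tau F, projection_from P L & rat_eq f (rat_comp L F) L]].

Definition quasi_galois (K : fieldType) (f : {mpoly K[3]}) (P : P2 K) : Prop :=
  `I_2 #<= gal f P.

Definition quasi_galois_points (K : fieldType) (f : {mpoly K[3]}) (n : nat) :
    set (P2 K) :=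
  [set P | [/\ on_curve f P, quasi_galois f P & gal f P #= `I_n]].

(* delta[n]. fset_set sends an infinite set to the empty one, so this is the
   number of points only where quasi_galois_points f n is finite. *)
Definition delta (K : fieldType) (f : {mpoly K[3]}) (n : nat) : nat :=
  #|` fset_set (quasi_galois_points f n)|.

(* Main.v *)
From HB Require Import structures.
Require Import Defs.
From mathcomp Require Import all_boot all_order all_algebra.
From mathcomp Require Import perm cyclic separable finmap.
From mathcomp Require Import boolp classical_sets functions cardinality.
From mathcomp Require Import mpoly.
From mathcomp Require Import ring zify.

(** Lift everything to the cone K^3.  By smoothness the form f is prime, and the homogeneous
    coordinate ring of the curve is normal (M. Noether); this forces every birational map commuting
    with the projection from a point P = <u> of the curve to be linear, of the shape
    v |-> v + l(v) u.  So G[P] is a finite group of homologies with centre P, hence cyclic,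
    generated by v |-> v + (z - 1) la(v) u for a primitive n-th root of unity z.
    In coordinates adapted to u and to the axis la = 0, invariance of f kills all its coefficients
    outside one residue class modulo n.  It follows that the tangent line at P meets the curve there
    with multiplicity at least n + 1, while the d points of the curve on the axis are distinct and
    each has a tangent line, through P, of multiplicity at least n.  The common divisor m keeps
    these 1 + d points apart for distinct centres, so the Hessian, of degree 3(d - 2), vanishes
    there to orders n - 1 and n - 2, and counting its zeros on the curve by a resultant gives (1).
    For (2) and (3), the homologies act freely on the other quasi-Galois points: a line through two
    of them contains at least n + 1, and three non-collinear ones produce n^2 + n + 1, whereas a
    line meets the curve in at most d points. *)

(** Two devices stand in for the theory of divisors and function fields. One is restriction to a
    line: every contact that matters is a contact with a line, so multiplicities are orders at 0 of
    one-variable polynomials [lev p A B], and a point weighs in the resultant at least the order to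
    which both forms vanish along one and the same line. The other is integrality: with P at (1:0:0)
    and tangent y = 0, f is y x^(d-1) plus lower powers of x, so modulo f the product y x is
    integral over the forms in the other two variables, and y^2 F_0 / F_1 is integral too for a map
    F over the projection. Normality makes this quotient a quadratic form Q, and comparing
    coefficients in one identity forces Q = y (z x + mu); this uses d >= 4. The Hessian loses two
    orders of contact along a line, which turns n + 1 and n into the weights n - 1 and n - 2. As
    [delta] counts an infinite set as empty, finiteness is proved as well, by the same weighted
    count on a finite set of too many points. *)

Section Lemmas.
Set Implicit Arguments.
Unset Strict Implicit.
Unset Printing Implicit Defensive.
Import GRing.Theory.
Local Open Scope ring_scope.
Local Notation o1 := (lift (ord0 : 'I_3) (ord0 : 'I_2) : 'I_3).
Local Notation o2 := (lift (ord0 : 'I_3) (lift (ord0 : 'I_2) (ord0 : 'I_1)) : 'I_3).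
(* [rat_eq] alone is the equality of rational numbers. *)
Local Notation rat_eq := Defs.rat_eq.

(** * Forms: derivatives, homogeneity, values and restriction to lines *)

Lemma mderiv_var (K : comNzRingType) (n : nat) (i j : 'I_n) :
  ('X_i : {mpoly K[n]})^`M(j) = (i == j)%:R.
Proof.
rewrite mderivX mnm1E; case: eqP => [->|_]; last by rewrite scale0r.
by rewrite scale1r -{1}(add0m U_(j)%MM) addmK mpolyX0.
Qed.

Lemma rmorph_mpoly_ext (K : comNzRingType) (n : nat) (T : comNzRingType)
    (phi psi : {rmorphism {mpoly K[n]} -> T}) :
  (forall c, phi c%:MP = psi c%:MP) -> (forall i, phi 'X_i = psi 'X_i) ->
  phi =1 psi.
Proof.
move=> hC hX p; rewrite (mpolyE p) !rmorph_sum /=; apply: eq_bigr => m _.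
rewrite -mul_mpolyC !rmorphM hC; congr (_ * _).
rewrite mpolyXE_id !rmorph_prod; apply: eq_bigr => i _.
by rewrite !rmorphXn /= hX.
Qed.

Section Taylor.
Variables (K T : comNzRingType) (n : nat) (phi : {rmorphism K -> T}).

(** Serves as the Newton step of Hensel's lemma and to compare a branch with its tangent line. The
    remainder is left unspecified, so no second derivatives enter. *)
Lemma mmap_taylor (h dl : 'I_n -> T) (e : T) (p : {mpoly K[n]}) :
  exists r, mmap phi (fun i => h i + e * dl i) p =
    mmap phi h p + e * (\sum_i dl i * mmap phi h p^`M(i)) + e ^+ 2 * r.
Proof.
elim/mpolyind: p => [|c m p _ _ [r IH]].
  exists 0; rewrite !raddf0 mulr0 addr0 big1 ?mulr0 ?addr0 // => i _.
  by rewrite linear0 raddf0 mulr0.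
suff [s Hs] : exists s, mmap phi (fun i => h i + e * dl i) 'X_[m] =
    mmap phi h 'X_[m] + e * (\sum_i dl i * mmap phi h ('X_[m])^`M(i)) + e ^+ 2 * s.
  exists (phi c * s + r); rewrite !raddfD /= !mmapZ IH Hs.
  have -> : \sum_i dl i * mmap phi h (c *: 'X_[m] + p)^`M(i) =
     phi c * (\sum_i dl i * mmap phi h ('X_[m])^`M(i))
     + \sum_i dl i * mmap phi h p^`M(i).
    rewrite mulr_sumr -big_split; apply: eq_bigr => i _ /=.
    by rewrite mderivD mderivZ raddfD /= mmapZ; ring.
  by ring.
(* Such expansions multiply, so a monomial reduces to its variables. *)
pose good q := exists s, mmap phi (fun i => h i + e * dl i) q =
    mmap phi h q + e * (\sum_i dl i * mmap phi h q^`M(i)) + e ^+ 2 * s.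
have goodM p1 p2 : good p1 -> good p2 -> good (p1 * p2).
  move=> [s1 H1] [s2 H2].
  have -> : good (p1 * p2) = exists s, mmap phi (fun i => h i + e * dl i) (p1 * p2) =
    mmap phi h (p1 * p2) + e * (\sum_i dl i * mmap phi h (p1 * p2)^`M(i)) + e ^+ 2 * s by [].
  pose a := \sum_i dl i * mmap phi h p1^`M(i).
  pose b := \sum_i dl i * mmap phi h p2^`M(i).
  have -> : \sum_i dl i * mmap phi h (p1 * p2)^`M(i) =
     mmap phi h p2 * a + mmap phi h p1 * b.
    rewrite !mulr_sumr -big_split; apply: eq_bigr => i _ /=.
    by rewrite mderivM raddfD /= !rmorphM /=; ring.
  rewrite !rmorphM /= H1 H2 -/a -/b.
  exists (a * b + mmap phi h p1 * s2 + mmap phi h p2 * s1 + e * a * s2 + e * b * s1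
          + e ^+ 2 * s1 * s2); ring.
have good1 : good 1.
  exists 0; rewrite !rmorph1 mulr0 addr0 big1 ?mulr0 ?addr0 // => i _.
  by rewrite -mpolyC1 mderivC raddf0 mulr0.
have goodX i : good 'X_i.
  exists 0; rewrite !mmapX !mmap1U (bigD1 i) //= big1 ?addr0 => [|j ji].
    by rewrite mderiv_var eqxx rmorph1; ring.
  by rewrite mderiv_var eq_sym (negPf ji) rmorph0 mulr0.
rewrite -/(good _) mpolyXE_id; elim/big_ind: _ => // i _.
by elim: (m i) => [|k IHk]; rewrite ?expr0 // exprS; apply: goodM.
Qed.

Lemma mmap_dhomog (h : 'I_n -> T) (c : T) (d : nat) (p : {mpoly K[n]}) :
  p \is d.-homog -> mmap phi (fun i => c * h i) p = c ^+ d * mmap phi h p.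
Proof.
move=> /dhomogP hp; rewrite /mmap mulr_sumr big_seq [RHS]big_seq.
apply: eq_bigr => m /hp; rewrite /= => <-.
rewrite mulrCA; congr (_ * _); rewrite /mmap1 mdegE.
by rewrite -prodrXr -big_split; apply: eq_bigr => i _; rewrite exprMn.
Qed.

End Taylor.

Lemma dhomog_mderiv (K : comNzRingType) (n d : nat) (p : {mpoly K[n]}) (i : 'I_n) :
  p \is d.-homog -> p^`M(i) \is d.-1.-homog.
Proof.
move=> hp; rewrite (mpolyE p) raddf_sum big_seq rpred_sum // => m hm.
rewrite /= mderivZ mderivX rpredZ //.
have [->|mi] := eqVneq (m i) 0%N; first by rewrite scale0r rpred0.
rewrite rpredZ // dhomogX.
move/dhomogP: hp => /(_ m hm) /= <-.
have le1 : (U_(i) <= m)%MM by rewrite lep1mP.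
by rewrite -{2}(submK le1) mdegD mdeg1 addn1.
Qed.

Lemma euler_dhomog (K : comNzRingType) (n d : nat) (p : {mpoly K[n]}) :
  p \is d.-homog -> \sum_i 'X_i * p^`M(i) = d%:R *: p.
Proof.
move=> hp; rewrite [in RHS](mpolyE p) scaler_sumr.
have dE i : p^`M(i) = \sum_(m <- msupp p) (p@_m *: 'X_[m])^`M(i).
  by rewrite {1}(mpolyE p) raddf_sum.
under eq_bigr => i _ do rewrite dE mulr_sumr.
rewrite exchange_big /= big_seq [RHS]big_seq; apply: eq_bigr => m hm.
move/dhomogP: hp => /(_ m hm) /= <-.
rewrite mdegE natr_sum scaler_suml; apply: eq_bigr => i _.
rewrite mderivZ mderivX -!scalerAr scalerA -scalerA !scalerA [_ * p@__]mulrC.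
have [->|mi] := eqVneq (m i) 0%N; first by rewrite !mulr0 !scale0r.
by rewrite -mpolyXD addmC submK // lep1mP.
Qed.

Lemma deriv_mmap (K : comNzRingType) (n : nat) (g : 'I_n -> {poly K})
    (p : {mpoly K[n]}) :
  (mmap polyC g p)^`() = \sum_i (g i)^`() * mmap polyC g p^`M(i).
Proof.
elim/mpolyind: p => [|c m p _ _ IH].
  rewrite !raddf0 big1 // => i _; by rewrite !raddf0 mulr0.
have HX : (mmap polyC g 'X_[m])^`() = \sum_i (g i)^`() * mmap polyC g ('X_[m])^`M(i).
  pose good q := (mmap polyC g q)^`() = \sum_i (g i)^`() * mmap polyC g q^`M(i).
  have goodM p1 p2 : good p1 -> good p2 -> good (p1 * p2).
    rewrite /good => H1 H2; rewrite rmorphM /= derivM H1 H2 mulr_suml mulr_sumr -big_split.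
    by apply: eq_bigr => i _; rewrite mderivM raddfD /= !rmorphM /=; ring.
  have good1 : good 1.
    rewrite /good rmorph1 derivC big1 // => i _.
    by rewrite -mpolyC1 mderivC raddf0 mulr0.
  have goodX i : good 'X_i.
    rewrite /good !mmapX !mmap1U (bigD1 i) //= big1 ?addr0 => [|j ji].
      by rewrite mderiv_var eqxx rmorph1 mulr1.
    by rewrite mderiv_var eq_sym (negPf ji) rmorph0 mulr0.
  rewrite -/(good _) mpolyXE_id; elim/big_ind: _ => // i _.
  by elim: (m i) => [|k IH']; rewrite ?expr0 // exprS; apply: goodM.
rewrite raddfD derivD IH /= mmapZ mul_polyC derivZ HX scaler_sumr -big_split.
apply: eq_bigr => i _; rewrite /= mderivD mderivZ raddfD /= mmapZ mul_polyC.
by rewrite mulrDr scalerAr.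
Qed.

Lemma pchar0_natr_neq0 (K : fieldType) (n : nat) :
  [pchar K] =i pred0 -> (0 < n)%N -> n%:R != 0 :> K.
Proof. by move=> /pcharf0P ->; rewrite -lt0n. Qed.

(** In characteristic 0 the integers below [size p] are distinct in [K], and they are one more than
    the roots [p] can have. *)
Lemma pchar0_poly_nonroot (K : fieldType) (p : {poly K}) :
  [pchar K] =i pred0 -> p != 0 -> exists c, p.[c] != 0.
Proof.
move=> ch p0.
pose s : seq K := [seq i%:R | i <- iota 0 (size p)].
have us : uniq s.
  rewrite map_inj_in_uniq ?iota_uniq // => i j _ _ /eqP.
  wlog le : i j / (i <= j)%N => [W|].
    by case: (leqP i j) => [|/ltnW] h /eqP e; [|apply/esym]; apply: W => //; apply/eqP.
  rewrite eq_sym -subr_eq0 -natrB // => /eqP e; apply/eqP; rewrite eqn_leq le /= -subn_eq0.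
  by apply: contraT; rewrite -lt0n => /(pchar0_natr_neq0 ch) /eqP.
have [h|/allPn[x _ h]] := boolP (all (root p) s); last by exists x.
by have := max_poly_roots p0 h us; rewrite size_map size_iota ltnn.
Qed.

(** Induction on the number of variables: [phi] isolates the last one and [psi] undoes it. Where the
    leading coefficient does not vanish, a nonzero polynomial in one variable remains. *)
Lemma mpoly_nonroot (K : fieldType) (n : nat) (p : {mpoly K[n]}) :
  [pchar K] =i pred0 -> p != 0 -> exists v : 'I_n -> K, p.@[v] != 0.
Proof.
move=> ch; elim: n p => [|n IH] p p0.
  exists (fun _ => 0); rewrite (nvar0_mpolyC p) mevalC.
  by apply: contra p0 => /eqP e; rewrite (nvar0_mpolyC p) e.
pose phi := mmap (@polyC _ \o @mpolyC n K)
   (fun i : 'I_n.+1 => if unlift ord_max i is Some j then ('X_j)%:P else 'X).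
pose psi := fun q : {poly {mpoly K[n]}} =>
  (map_poly (mmap (@mpolyC n.+1 K) (fun j => 'X_(lift ord_max j))) q).['X_ord_max].
have phiK : psi (phi p) = p.
  pose psi1 := horner_eval ('X_ord_max : {mpoly K[n.+1]})
    \o map_poly (mmap (@mpolyC n.+1 K) (fun j : 'I_n => 'X_(lift ord_max j))).
  apply: (rmorph_mpoly_ext (phi := psi1 \o phi) (psi := idfun)) => [c|i] /=.
    by rewrite /phi mmapC /= map_polyC /= mmapC horner_evalE hornerC.
  rewrite /phi mmapX mmap1U horner_evalE; case: unliftP => [j ->|->].
    by rewrite map_polyC hornerC /= mmapX mmap1U.
  by rewrite map_polyX hornerX.
have q0 : phi p != 0.
  by apply: contra p0 => /eqP e; rewrite -phiK e /psi rmorph0 horner0.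
have [v hv] := IH (lead_coef (phi p)) (etrans (congr1 negb (lead_coef_eq0 _)) q0).
have r0 : map_poly (meval v) (phi p) != 0.
  by apply: contra hv => /eqP e; rewrite lead_coefE -coef_map e coef0.
have [c hc] := pchar0_poly_nonroot ch r0.
exists (fun i => if unlift ord_max i is Some j then v j else c).
suff -> : p.@[fun i => if unlift ord_max i is Some j then v j else c]
  = (map_poly (meval v) (phi p)).[c] by [].
pose chi := horner_eval c \o map_poly (meval v) \o phi.
apply: (rmorph_mpoly_ext
  (phi := meval (fun i => if unlift ord_max i is Some j then v j else c))
  (psi := chi)) => [a|i] /=.
  by rewrite mevalC /chi /= /phi mmapC /= map_polyC /= mevalC horner_evalE hornerC.
rewrite mevalXU /chi /= /phi mmapX mmap1U horner_evalE; case: unliftP => [j _|_].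
  by rewrite map_polyC hornerC /= mevalXU.
by rewrite map_polyX hornerX.
Qed.

Lemma mpoly_eq_meval (K : fieldType) (n : nat) (p q : {mpoly K[n]}) :
  [pchar K] =i pred0 -> (forall v, p.@[v] = q.@[v]) -> p = q.
Proof.
move=> ch h; apply/eqP; rewrite -subr_eq0; apply: contraT => /(mpoly_nonroot ch)[v].
by rewrite rmorphB /= h subrr eqxx.
Qed.

Section Plane.
Variable K : closedFieldType.
Hypothesis charK : [pchar K] =i pred0.
Implicit Types (p q f g h : {mpoly K[3]}) (v w : 'rV[K]_3).

Lemma pihomogMl n d e (p q : {mpoly K[n]}) :
  p \is d.-homog -> pihomog mdeg (d + e) (p * q) = p * pihomog mdeg e q.
Proof.
move=> hp; elim/mpolyind: q => [|c m q _ _ IH]; first by rewrite !(mulr0, raddf0).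
rewrite mulrDr !raddfD /= IH mulrDr; congr (_ + _).
have hX : p * (c *: 'X_[m]) \is (d + mdeg m).-homog.
  by apply: dhomogM => //; rewrite rpredZ // dhomogX /=.
have -> : pihomog mdeg e (c *: 'X_[m] : {mpoly K[n]}) =
    if mdeg m == e then c *: 'X_[m] else 0.
  rewrite linearZ /= pihomogX; case: ifP => //; by rewrite scaler0.
case: eqP => [<-|/eqP ne]; first by rewrite pihomog_dE.
by rewrite mulr0 (pihomog_ne0 _ hX) // eqn_add2l.
Qed.

Lemma pihomogM_lt n d e (p q : {mpoly K[n]}) :
  p \is d.-homog -> (e < d)%N -> pihomog mdeg e (p * q) = 0.
Proof.
move=> hp led; elim/mpolyind: q => [|c m q _ _ IH]; first by rewrite mulr0 raddf0.
rewrite mulrDr raddfD /= IH addr0.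
have hX : p * (c *: 'X_[m]) \is (d + mdeg m).-homog.
  by apply: dhomogM => //; rewrite rpredZ // dhomogX /=.
by rewrite (pihomog_ne0 _ hX) // neq_ltn orbC ltn_addr.
Qed.

(** Homogeneous components are compared. If N < d the component of the product is 0, hence so is
    [q], and the truncated [N - d] is harmless. *)
Lemma dhomog_div n d N (p q : {mpoly K[n]}) :
  p != 0 -> p \is d.-homog -> p * q \is N.-homog -> q \is (N - d).-homog.
Proof.
move=> p0 hp hpq; have [led|ltd] := leqP d N.
  have := pihomog_dE hpq; rewrite -{1}(subnKC led) (pihomogMl _ _ hp) => /(mulfI p0) <-.
  exact: pihomogP.
have := pihomog_dE hpq; rewrite (pihomogM_lt _ hp ltd) => /esym/eqP.
by rewrite mulf_eq0 (negPf p0) /= => /eqP ->; apply: rpred0.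
Qed.

Lemma dhomog_comp (d e : nat) (m k : nat) (p : {mpoly K[m]}) (F : m.-tuple {mpoly K[k]}) :
  p \is d.-homog -> (forall i, tnth F i \is e.-homog) -> p \mPo F \is (d * e).-homog.
Proof.
move=> /dhomogP hp hF; rewrite comp_mpolyE big_seq rpred_sum // => mm /hp /= <-.
rewrite rpredZ // mdegE big_distrl /=.
elim/big_ind2: _ => [|a b a' b'|i _]; rewrite ?dhomog1 //; first exact: dhomogM.
by rewrite mulnC; apply: dhomogMn.
Qed.

Lemma comp_homog_scale (n : nat) p N (u : {mpoly K[n]})
    (F H : 3.-tuple {mpoly K[n]}) :
  p \is N.-homog -> (forall i, tnth H i = u * tnth F i) -> p \mPo H = u ^+ N * (p \mPo F).
Proof.
move=> hp hH; rewrite /comp_mpoly -(mmap_dhomog _ _ _ hp) /mmap.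
apply: eq_bigr => m _; congr (_ * _); apply: eq_bigr => i _; by rewrite hH.
Qed.

Lemma zero_on0 f : zero_on f 0. Proof. by exists 0; rewrite mulr0. Qed.

Lemma zero_onD f p q : zero_on f p -> zero_on f q -> zero_on f (p + q).
Proof. by move=> [a ->] [b ->]; exists (a + b); rewrite mulrDr. Qed.

Lemma zero_onN f p : zero_on f p -> zero_on f (- p).
Proof. by move=> [a ->]; exists (- a); rewrite mulrN. Qed.

Lemma zero_onB f p q : zero_on f p -> zero_on f q -> zero_on f (p - q).
Proof. by move=> hp hq; apply: zero_onD => //; apply: zero_onN. Qed.

Lemma zero_onMr f p q : zero_on f p -> zero_on f (p * q).
Proof. by move=> [a ->]; exists (a * q); rewrite mulrA. Qed.

Lemma zero_onMl f p q : zero_on f p -> zero_on f (q * p).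
Proof. by rewrite mulrC; apply: zero_onMr. Qed.

Lemma zero_onZ f p c : zero_on f p -> zero_on f (c *: p).
Proof. by rewrite -mul_mpolyC; apply: zero_onMl. Qed.

Lemma zero_on_sum f (I : Type) (r : seq I) (P : pred I) (F : I -> {mpoly K[3]}) :
  (forall i, P i -> zero_on f (F i)) -> zero_on f (\sum_(i <- r | P i) F i).
Proof. by move=> h; elim/big_rec: _ => [|i p Pi]; [exact: zero_on0|apply/zero_onD/h]. Qed.

Lemma zero_on_subr f p q : zero_on f (p - q) -> zero_on f p <-> zero_on f q.
Proof.
move=> h; split=> h'; last by rewrite -(subrK q p); apply: zero_onD.
by rewrite -(subKr p q); apply: zero_onB.
Qed.

Lemma zero_on_congM f p q p' q' :
  zero_on f (p - p') -> zero_on f (q - q') -> zero_on f (p * q - p' * q').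
Proof.
move=> [a ha] [b hb]; exists (a * q + p' * b).
by rewrite mulrDr mulrA -ha mulrCA -hb; ring.
Qed.

Lemma zero_on_congX f p p' k : zero_on f (p - p') -> zero_on f (p ^+ k - p' ^+ k).
Proof.
move=> h; elim: k => [|k IH]; first by rewrite subrr; apply: zero_on0.
by rewrite !exprS; apply: zero_on_congM.
Qed.

Lemma zero_on_comp f (m : nat) (p : {mpoly K[m]}) (F G : m.-tuple {mpoly K[3]}) :
  (forall i, zero_on f (tnth F i - tnth G i)) -> zero_on f ((p \mPo F) - (p \mPo G)).
Proof.
move=> h; rewrite !comp_mpolyE -sumrB; apply: zero_on_sum => mm _.
rewrite -scalerBr; apply: zero_onZ.
elim/big_rec2: _ => [|i p1 p2 _]; first by rewrite subrr; apply: zero_on0.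
by apply: zero_on_congM; apply: zero_on_congX.
Qed.

Lemma zero_on_homog f p d N : f \is d.-homog -> p \is N.-homog -> zero_on f p ->
  exists2 q, q \is (N - d).-homog & p = f * q.
Proof.
move=> hf hp [q pE]; have [f0|f0] := eqVneq f 0.
  by exists 0; rewrite ?rpred0 // pE f0 !mul0r.
by exists q => //; apply: (dhomog_div f0 hf); rewrite -pE.
Qed.

Lemma zero_on_lt f p d N : f \is d.-homog -> p \is N.-homog -> (N < d)%N ->
  zero_on f p -> p = 0.
Proof.
move=> hf hp lt [q pE]; rewrite -(pihomog_dE hp) pE; exact: pihomogM_lt hf lt.
Qed.

Lemma mpoly_eq_vec p q : (forall v, p.@[v 0] = q.@[v 0]) -> p = q.
Proof.
move=> h; apply: (mpoly_eq_meval charK) => v.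
have := h (\row_i v i); rewrite (meval_eq p (_ : _ =1 v)) => [|i]; last by rewrite mxE.
by rewrite (meval_eq q (_ : _ =1 v)) // => i; rewrite mxE.
Qed.

Lemma mpoly_nonroot_vec p : p != 0 -> exists v, p.@[v 0] != 0.
Proof.
move=> /(mpoly_nonroot charK)[v hv]; exists (\row_i v i).
by rewrite (meval_eq p (_ : _ =1 v)) // => i; rewrite mxE.
Qed.

Lemma meval_vecZ p d c v : p \is d.-homog -> p.@[(c *: v) 0] = c ^+ d * p.@[v 0].
Proof.
move=> hp; rewrite -[RHS](mmap_dhomog idfun (v 0) c hp).
by apply: meval_eq => i; rewrite mxE.
Qed.

Lemma meval_vec0 p d : p \is d.-homog -> (0 < d)%N -> p.@[(0 : 'rV[K]_3) 0] = 0.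
Proof. by move=> hp d0; rewrite -(scale0r 0) (meval_vecZ _ _ hp) expr0n eqn0Ngt d0 mul0r. Qed.

Definition line (A B : 'rV[K]_3) : 'I_3 -> {poly K} := fun i => (A 0 i)%:P + 'X * (B 0 i)%:P.

(* [locked] keeps unification from unfolding these morphisms. *)
Definition levr (A B : 'rV[K]_3) : {rmorphism {mpoly K[3]} -> {poly K}} :=
  locked (mmap polyC (line A B) : {rmorphism {mpoly K[3]} -> {poly K}}).

(** The restriction of [p] to the line through [A] and [B], with [A] at parameter 0 and [B] at
    infinity. Its order at 0 measures the contact at [A]. *)
Definition lev p (A B : 'rV[K]_3) : {poly K} := levr A B p.

Lemma levE p A B : lev p A B = mmap polyC (line A B) p.
Proof. by rewrite /lev /levr -lock. Qed.

Lemma levM p q A B : lev (p * q) A B = lev p A B * lev q A B.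
Proof. exact: rmorphM. Qed.

Lemma levD p q A B : lev (p + q) A B = lev p A B + lev q A B.
Proof. exact: rmorphD. Qed.

Lemma levB p q A B : lev (p - q) A B = lev p A B - lev q A B.
Proof. exact: rmorphB. Qed.

Lemma mmap_horner (g : 'I_3 -> {poly K}) p c :
  (mmap polyC g p).[c] = p.@[fun i => (g i).[c]].
Proof.
pose phi := horner_eval c \o mmap polyC g.
apply: (rmorph_mpoly_ext (phi := phi) (psi := meval (fun i => (g i).[c]))) => [a|i] /=.
  by rewrite /phi /= mmapC mevalC horner_evalE hornerC.
by rewrite /phi /= mmapX mmap1U mevalXU horner_evalE.
Qed.

Lemma lev_horner p A B c : (lev p A B).[c] = p.@[(A + c *: B) 0].
Proof.
rewrite levE mmap_horner; apply: meval_eq => i.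
by rewrite /line !mxE !hornerE.
Qed.

Lemma lev_coef0 p A B : (lev p A B)`_0 = p.@[A 0].
Proof. by rewrite -horner_coef0 lev_horner scale0r addr0. Qed.

Definition dder p (A B : 'rV[K]_3) : K := \sum_i B 0 i * p^`M(i).@[A 0].

Lemma lev_coef1 p A B : (lev p A B)`_1 = dder p A B.
Proof.
have := deriv_mmap (line A B) p; rewrite -levE.
move/(congr1 (fun q : {poly K} => q`_0)); rewrite coef_deriv mulr1n => ->.
rewrite coef_sum; apply: eq_bigr => i _.
rewrite -horner_coef0 hornerM mmap_horner /line derivD derivC derivM derivX derivC.
rewrite !hornerE; congr (_ * _); apply: meval_eq => j; rewrite !hornerE.
by [].
Qed.

Lemma dderD p A B B' : dder p A (B + B') = dder p A B + dder p A B'.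
Proof. by rewrite -big_split; apply: eq_bigr => i _; rewrite mxE mulrDl. Qed.

Lemma dderZ p A c B : dder p A (c *: B) = c * dder p A B.
Proof. by rewrite mulr_sumr; apply: eq_bigr => i _; rewrite mxE mulrA. Qed.

Lemma dder_self p d A : p \is d.-homog -> dder p A A = d%:R * p.@[A 0].
Proof.
move=> hp; rewrite -mevalZ -(euler_dhomog hp) rmorph_sum; apply: eq_bigr => i _.
by rewrite rmorphM /= mevalXU.
Qed.

Lemma size_coef_lev p N A B : p \is N.-homog ->
  (size (lev p A B) <= N.+1)%N /\ (lev p A B)`_N = p.@[B 0].
Proof.
pose good (q : {poly K}) n b := (size q <= n.+1)%N /\ q`_n = b.
have goodM (q1 q2 : {poly K}) n1 n2 b1 b2 : good q1 n1 b1 -> good q2 n2 b2 ->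
    good (q1 * q2) (n1 + n2)%N (b1 * b2).
  move=> [s1 c1] [s2 c2]; split.
    apply: (leq_trans (size_polyMleq _ _)).
    by apply: (@leq_trans (n1.+1 + n2.+1).-1); [lia|rewrite addnS].
  rewrite coefM (bigD1 (inord n1)) //= inordK ?ltnS ?leq_addr // addKn c1 c2.
  rewrite big1 ?addr0 // => j jn.
  have {}jn : (j : nat) != n1.
    by apply: contra jn => /eqP e; apply/eqP/val_inj; rewrite /= inordK ?ltnS ?leq_addr.
  have [lt|gt|e] := ltngtP j n1; last by rewrite e eqxx in jn.
    rewrite [q2`_ _]nth_default ?mulr0 //; apply: leq_trans s2 _; lia.
  by rewrite nth_default ?mul0r //; apply: leq_trans s1 _; lia.
move/dhomogP => hp; rewrite levE /mmap.
suff : good (\sum_(m <- msupp p) (p@_m)%:P * mmap1 (line A B) m) N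
   (\sum_(m <- msupp p) p@_m * \prod_i B 0 i ^+ m i) by rewrite -mevalE.
rewrite big_seq [X in good _ _ X]big_seq.
elim/big_ind2: _ => [|x1 x2 y1 y2 [s1 c1] [s2 c2]|m /hp /= <-].
- by split; rewrite ?size_poly0 ?coef0.
- split; last by rewrite coefD c1 c2.
  by apply: leq_trans (size_polyD _ _) _; rewrite geq_max s1 s2.
rewrite -[mdeg m]add0n; apply: (goodM); first by split; rewrite ?size_polyC ?coefC //; case: eqP.
rewrite mdegE /mmap1.
have good1 : good 1 0%N 1 by split; rewrite ?size_poly1 ?coefC.
have goodX i k : good (line A B i ^+ k) k (B 0 i ^+ k).
  elim: k => [|k IH]; rewrite ?expr0 // !exprS -add1n; apply: (goodM) => //; split.
    rewrite /line; apply: leq_trans (size_polyD _ _) _; rewrite geq_max.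
    apply/andP; split; first by rewrite size_polyC; case: eqP.
    apply: leq_trans (size_polyMleq _ _) _; rewrite size_polyX size_polyC; case: eqP => //.
  by rewrite /line coefD coefC coefXM coefC /= add0r.
by rewrite !big_ord_recl !big_ord0; do 3![apply: (goodM) => //].
Qed.

Definition lin (c : 'rV[K]_3) : {mpoly K[3]} := \sum_i c 0 i *: 'X_i.

Definition dotp (c v : 'rV[K]_3) : K := \sum_i c 0 i * v 0 i.

Lemma dotpDr c v w : dotp c (v + w) = dotp c v + dotp c w.
Proof. by rewrite -big_split; apply: eq_bigr => i _; rewrite mxE mulrDr. Qed.

Lemma dotpZr c a v : dotp c (a *: v) = a * dotp c v.
Proof. by rewrite mulr_sumr; apply: eq_bigr => i _; rewrite mxE mulrCA. Qed.

Lemma dotpNr c v : dotp c (- v) = - dotp c v.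
Proof. by rewrite -scaleN1r dotpZr mulN1r. Qed.

Lemma dotp_delta c i : dotp c (delta_mx 0 i) = c 0 i.
Proof.
rewrite /dotp (bigD1 i) //= big1 ?addr0 => [|j ji]; rewrite !mxE ?eqxx ?mulr1 //=.
by rewrite (negPf ji) mulr0.
Qed.

Lemma lin_eval c v : (lin c).@[v 0] = dotp c v.
Proof. by rewrite rmorph_sum; apply: eq_bigr => i _; rewrite /= mevalZ mevalXU. Qed.

Lemma dhomog_var n (i : 'I_n) : ('X_i : {mpoly K[n]}) \is 1.-homog.
Proof. by rewrite dhomogX /= mdeg1. Qed.

Lemma dhomog_lin c : lin c \is 1.-homog.
Proof. by apply: rpred_sum => i _; rewrite rpredZ // dhomog_var. Qed.

Lemma mcoeff_lin c i : (lin c)@_(U_(i)) = c 0 i.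
Proof.
rewrite raddf_sum (bigD1 i) //= mcoeffZ mcoeffXU eqxx mulr1 big1 ?addr0 // => j ji.
by rewrite mcoeffZ mcoeffXU (negPf ji) mulr0.
Qed.

Lemma lin_neq0 c : c != 0 -> lin c != 0.
Proof.
apply: contra => /eqP e; apply/eqP/rowP => i.
by rewrite mxE -mcoeff_lin e mcoeff0.
Qed.

Lemma lin_homog p : p \is 1.-homog -> exists c, p = lin c.
Proof.
move=> hp; exists (\row_i p@_(U_(i))); apply/mpolyP => m.
have [/mdeg1P[i /eqP ->]|m1] := boolP (mdeg m == 1)%N.
  by rewrite mcoeff_lin mxE.
by rewrite (dhomog_nemf_coeff hp m1) (dhomog_nemf_coeff (dhomog_lin _) m1).
Qed.

Lemma lev_lin c A B : lev (lin c) A B = (dotp c A)%:P + 'X * (dotp c B)%:P.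
Proof.
rewrite levE /lin rmorph_sum /dotp /= !rmorph_sum mulr_sumr -big_split.
apply: eq_bigr => i _; rewrite /= mmapZ mmapX mmap1U /line !rmorphM /=; ring.
Qed.

Lemma dotp_surj c : c != 0 -> exists w, dotp c w = 1.
Proof.
move=> /eqP c0; have [i ci] : exists i, c 0 i != 0.
  apply/existsP; rewrite -negb_forall; apply/negP => /forallP h.
  by apply: c0; apply/rowP => i; rewrite mxE; apply/eqP.
by exists ((c 0 i)^-1 *: delta_mx 0 i); rewrite dotpZr dotp_delta mulVf.
Qed.

(** When [dotp c w = 1] this is the projection onto the plane c = 0 along [w]. It is the identity
    modulo [lin c] and kills exactly the multiples of [lin c], whence divisibility by a linear form
    and its primality without a change of coordinates. *)
Definition projt (c w : 'rV[K]_3) : 3.-tuple {mpoly K[3]} :=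
  [tuple 'X_i - w 0 i *: lin c | i < 3].

Lemma comp_vec (m : nat) p (F : 3.-tuple {mpoly K[m]}) (x : 'I_m -> K) :
  (p \mPo F).@[x] = p.@[(\row_i (tnth F i).@[x]) 0].
Proof. by rewrite comp_mpoly_meval; apply: meval_eq => i; rewrite mxE. Qed.

Lemma projt_eval c w p v : (p \mPo projt c w).@[v 0] = p.@[(v - dotp c v *: w) 0].
Proof.
rewrite comp_vec; apply: meval_eq => i.
by rewrite !mxE tnth_mktuple rmorphB /= mevalZ mevalXU lin_eval mulrC.
Qed.

Lemma projt_congr c w p : zero_on (lin c) (p - (p \mPo projt c w)).
Proof.
rewrite -{1}(comp_mpoly_id p); apply: zero_on_comp => i; rewrite !tnth_mktuple.
by rewrite opprB addrC subrK; exists (w 0 i)%:MP; rewrite mulrC mul_mpolyC.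
Qed.

Lemma projt_lin c w p : dotp c w = 1 -> zero_on (lin c) p <-> p \mPo projt c w = 0.
Proof.
move=> cw; split=> [[q ->]|h]; last by rewrite -(subr0 p) -h; apply: projt_congr.
apply: mpoly_eq_vec => v; rewrite projt_eval mevalM lin_eval meval0.
by rewrite dotpDr dotpNr dotpZr cw mulr1 subrr mul0r.
Qed.

Lemma lin_dvdP c p : c != 0 ->
  zero_on (lin c) p <-> (forall v, dotp c v = 0 -> p.@[v 0] = 0).
Proof.
move=> c0; have [w cw] := dotp_surj c0; split=> [[q ->] v cv|h].
  by rewrite mevalM lin_eval cv mul0r.
apply/(projt_lin _ cw)/mpoly_eq_vec => v; rewrite projt_eval meval0 h //.
by rewrite dotpDr dotpNr dotpZr cw mulr1 subrr.
Qed.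

Lemma lin_prime c p q : c != 0 -> zero_on (lin c) (p * q) ->
  zero_on (lin c) p \/ zero_on (lin c) q.
Proof.
move=> c0; have [w cw] := dotp_surj c0.
rewrite !(projt_lin _ cw) rmorphM /= => /eqP; rewrite mulf_eq0.
by case/orP => /eqP; [left|right].
Qed.

Definition lint (A : 'M[K]_3) : 3.-tuple {mpoly K[3]} :=
  [tuple \sum_j A j i *: 'X_j | i < 3].

Definition lact (A : 'M[K]_3) : {rmorphism {mpoly K[3]} -> {mpoly K[3]}} :=
  locked (comp_mpoly (lint A) : {rmorphism {mpoly K[3]} -> {mpoly K[3]}}).

Lemma lact_comp A p : lact A p = p \mPo lint A.
Proof. by rewrite /lact -lock. Qed.

Lemma lactE A p v : (lact A p).@[v 0] = p.@[(v *m A) 0].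
Proof.
rewrite lact_comp comp_vec; apply: meval_eq => i.
rewrite !mxE tnth_mktuple rmorph_sum; apply: eq_bigr => j _.
by rewrite /= mevalZ mevalXU mulrC.
Qed.

Lemma lactZ A c p : lact A (c *: p) = c *: lact A p.
Proof. by rewrite !lact_comp linearZ. Qed.

Lemma lact_mul A B p : lact A (lact B p) = lact (A *m B) p.
Proof. by apply: mpoly_eq_vec => v; rewrite !lactE mulmxA. Qed.

Lemma lact1 p : lact 1%:M p = p.
Proof. by apply: mpoly_eq_vec => v; rewrite lactE mulmx1. Qed.

Lemma lactK A : A \in unitmx -> cancel (lact A) (lact (invmx A)).
Proof. by move=> u p; rewrite lact_mul mulVmx // lact1. Qed.

Lemma lactVK A : A \in unitmx -> cancel (lact (invmx A)) (lact A).
Proof. by move=> u p; rewrite lact_mul mulmxV // lact1. Qed.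

Lemma lact_eq0 A p : A \in unitmx -> (lact A p == 0) = (p == 0).
Proof.
move=> u; apply/eqP/eqP => [h|->]; last by rewrite rmorph0.
by rewrite -(lactK u p) h rmorph0.
Qed.

Lemma dhomog_lint A i : tnth (lint A) i \is 1.-homog.
Proof. by rewrite tnth_mktuple rpred_sum // => j _; rewrite rpredZ // dhomog_var. Qed.

Lemma dhomog_lact A p d : p \is d.-homog -> lact A p \is d.-homog.
Proof. by move=> hp; rewrite lact_comp -[d]muln1; apply: dhomog_comp => // i; apply: dhomog_lint. Qed.

Lemma zero_on_lact A f p : zero_on f p -> zero_on (lact A f) (lact A p).
Proof. by move=> [q ->]; exists (lact A q); rewrite rmorphM. Qed.

Lemma zero_on_lactE A f p : A \in unitmx ->
  zero_on (lact A f) (lact A p) <-> zero_on f p.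
Proof.
move=> u; split; last exact: zero_on_lact.
by move/(zero_on_lact (invmx A)); rewrite !lactK.
Qed.

Lemma poly_eq_horner (P Q : {poly K}) : (forall c, P.[c] = Q.[c]) -> P = Q.
Proof.
move=> h; apply/eqP; rewrite -subr_eq0; apply: contraT => /(pchar0_poly_nonroot charK)[c].
by rewrite hornerD hornerN h subrr eqxx.
Qed.

Lemma lev_lact M p A B : lev (lact M p) A B = lev p (A *m M) (B *m M).
Proof.
by apply: poly_eq_horner => c; rewrite !lev_horner lactE mulmxDl scalemxAl.
Qed.

End Plane.

(** * Elimination of the first variable and resultants of ternary forms *)

Section Elimination.
Variable K : closedFieldType.
Hypothesis charK : [pchar K] =i pred0.
Implicit Types (p q f h : {mpoly K[3]}) (v w : 'rV[K]_3).

Definition bvec i : 'rV[K]_3 := delta_mx 0 i.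

Definition e0 : 'rV[K]_3 := bvec ord0.

Lemma ord3_ind (P : 'I_3 -> Prop) : P ord0 -> P o1 -> P o2 -> forall i, P i.
Proof.
move=> P0 P1 P2 i; case: (unliftP ord0 i) => [j|] -> //.
case: (unliftP ord0 j) => [k|] -> //.
by rewrite (ord1 k).
Qed.

(* A ternary form as a polynomial in its first variable. *)
Definition toX : {rmorphism {mpoly K[3]} -> {poly {mpoly K[2]}}} := locked
  (mmap (polyC \o @mpolyC 2 K)
    (fun i => if unlift ord0 i is Some j then ('X_j)%:P else 'X)
    : {rmorphism {mpoly K[3]} -> {poly {mpoly K[2]}}}).

Definition iota : {rmorphism {mpoly K[2]} -> {mpoly K[3]}} := locked
  (mmap (@mpolyC 3 K) (fun j : 'I_2 => 'X_(lift ord0 j))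
    : {rmorphism {mpoly K[2]} -> {mpoly K[3]}}).

Definition fromX : {rmorphism {poly {mpoly K[2]}} -> {mpoly K[3]}} := locked
  (horner_eval 'X_ord0 \o map_poly iota
    : {rmorphism {poly {mpoly K[2]}} -> {mpoly K[3]}}).

Lemma toXC c : toX c%:MP = (c%:MP)%:P.
Proof. by rewrite /toX -lock /= mmapC. Qed.

Lemma toX_X0 : toX 'X_ord0 = 'X.
Proof. by rewrite /toX -lock /= mmapX mmap1U unlift_none. Qed.

Lemma toX_lift j : toX 'X_(lift ord0 j) = ('X_j)%:P.
Proof. by rewrite /toX -lock /= mmapX mmap1U liftK. Qed.

Lemma iotaC c : iota c%:MP = c%:MP. Proof. by rewrite /iota -lock /= mmapC. Qed.

Lemma iotaX j : iota 'X_j = 'X_(lift ord0 j).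
Proof. by rewrite /iota -lock /= mmapX mmap1U. Qed.

Lemma fromX_C a : fromX a%:P = iota a.
Proof. by rewrite /fromX -lock /= map_polyC horner_evalE hornerC. Qed.

Lemma fromX_X : fromX 'X = 'X_ord0.
Proof. by rewrite /fromX -lock /= map_polyX horner_evalE hornerX. Qed.

Lemma toX_iota a : toX (iota a) = a%:P.
Proof.
apply: (rmorph_mpoly_ext (phi := toX \o iota) (psi := polyC)) => [c|i] /=.
  by rewrite iotaC toXC.
by rewrite iotaX toX_lift.
Qed.

Lemma toXK : cancel toX fromX.
Proof.
apply: (rmorph_mpoly_ext (phi := fromX \o toX) (psi := idfun)) => [c|i] /=.
  by rewrite toXC fromX_C iotaC.
case: (unliftP ord0 i) => [j|] ->; first by rewrite toX_lift fromX_C iotaX.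
by rewrite toX_X0 fromX_X.
Qed.

Lemma fromXK : cancel fromX toX.
Proof.
elim/poly_ind=> [|P c IH]; first by rewrite !rmorph0.
by rewrite rmorphD rmorphM /= fromX_X fromX_C rmorphD rmorphM /= IH toX_X0 toX_iota.
Qed.

Lemma toX_eq0 p : (toX p == 0) = (p == 0).
Proof. by rewrite -(inj_eq (can_inj toXK)) rmorph0. Qed.

Lemma toX_eval p v :
  (map_poly (meval (fun j => v 0 (lift ord0 j))) (toX p)).[v 0 ord0] = p.@[v 0].
Proof.
pose chi := horner_eval (v 0 ord0) \o map_poly (meval (fun j => v 0 (lift ord0 j))) \o toX.
apply: (rmorph_mpoly_ext (phi := chi) (psi := meval (v 0))) => [a|i] /=; rewrite /chi /=.
  by rewrite toXC map_polyC /= mevalC mevalC horner_evalE hornerC.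
rewrite mevalXU horner_evalE; case: (unliftP ord0 i) => [j|] ->.
  by rewrite toX_lift map_polyC hornerC /= mevalXU.
by rewrite toX_X0 map_polyX hornerX.
Qed.

Lemma iota_eval a v : (iota a).@[v 0] = a.@[fun j => v 0 (lift ord0 j)].
Proof. by rewrite -toX_eval toX_iota map_polyC hornerC. Qed.

Lemma dhomog_iota a N : a \is N.-homog -> iota a \is N.-homog.
Proof.
move=> ha; rewrite /iota -lock /= /mmap; move/dhomogP: ha => ha.
rewrite big_seq rpred_sum // => m /ha /= <-; rewrite mul_mpolyC rpredZ //.
rewrite mdegE /mmap1; elim/big_ind2: _ => [|x y x' y'|i _]; rewrite ?dhomog1 //.
  exact: dhomogM.
by have := dhomogMn (m i) (dhomog_var K (lift ord0 i)); rewrite mul1n.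
Qed.

Lemma toX_homog p N : p \is N.-homog ->
  (size (toX p) <= N.+1)%N /\ forall k, (toX p)`_k \is (N - k).-homog.
Proof.
pose good (q : {poly {mpoly K[2]}}) n :=
  (size q <= n.+1)%N /\ forall k, q`_k \is (n - k).-homog.
have goodM (q1 q2 : {poly {mpoly K[2]}}) n1 n2 : good q1 n1 -> good q2 n2 ->
    good (q1 * q2) (n1 + n2)%N.
  move=> [s1 c1] [s2 c2]; split.
    apply: (leq_trans (size_polyMleq _ _)).
    by apply: (@leq_trans (n1.+1 + n2.+1).-1); [lia|rewrite addnS].
  move=> k; rewrite coefM rpred_sum // => j _.
  have [lt|le1] := ltnP n1 j.
    by rewrite nth_default ?mul0r ?rpred0 //; apply: leq_trans s1 _.
  have [lt|le2] := ltnP n2 (k - j).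
    by rewrite [q2`__]nth_default ?mulr0 ?rpred0 //; apply: leq_trans s2 _.
  have := dhomogM (c1 j) (c2 (k - j)%N).
  by have -> : (n1 - j + (n2 - (k - j)) = n1 + n2 - k)%N by have := ltn_ord j; lia.
have good1 : good 1 0%N.
  split=> [|k]; first by rewrite size_poly1.
  by rewrite coefC; case: eqP => _; rewrite ?dhomog1 ?rpred0.
have goodX i k : good (toX 'X_i ^+ k) k.
  elim: k => [|k IH]; rewrite ?expr0 // exprS -[k.+1]add1n; apply: (goodM) => //.
  case: (unliftP ord0 i) => [j|] ->.
    rewrite toX_lift; split=> [|l]; first by rewrite size_polyC; case: eqP.
    by rewrite coefC; case: l => [|l] /=; rewrite ?subn0 ?dhomog_var ?rpred0.
  rewrite toX_X0; split=> [|l]; first by rewrite size_polyX.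
  by rewrite coefX; case: l => [|[|l]] /=; rewrite ?dhomog1 ?rpred0.
move=> /dhomogP hp; rewrite (mpolyE p) rmorph_sum big_seq.
rewrite -/(good _ _); elim/big_ind: _ => [|q1 q2 [s1 c1] [s2 c2]|m /hp /= <-].
- by split=> [|k]; rewrite ?size_poly0 ?coef0 ?rpred0.
- split=> [|k]; last by rewrite coefD rpredD.
  by apply: leq_trans (size_polyD _ _) _; rewrite geq_max s1 s2.
rewrite -mul_mpolyC rmorphM /= toXC -[mdeg m]add0n; apply: (goodM).
  split=> [|k]; first by rewrite size_polyC; case: eqP.
  by rewrite coefC; case: k => [|k] /=; rewrite ?rpred0 // -[_%:MP]mulr1 mul_mpolyC rpredZ ?dhomog1.
rewrite mpolyXE_id rmorph_prod mdegE.
elim/big_ind2: _ => // [x y x' y'|i _]; last by rewrite rmorphXn; apply: goodX.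
exact: goodM.
Qed.

Lemma homog0_const n (a : {mpoly K[n]}) x : a \is 0.-homog -> a = (a.@[x])%:MP.
Proof.
move=> /dhomogP ha; have -> : a = (a@_0)%:MP.
  apply/mpolyP => m; rewrite mcoeffC; have [->|m0] := eqVneq m 0%MM; first by rewrite mulr1.
  rewrite mulr0; apply: memN_msupp_eq0; apply/negP => /ha /eqP.
  by rewrite /= mdeg_eq0 (negPf m0).
by rewrite mevalC.
Qed.

Lemma meval0_homog n (a : {mpoly K[n]}) N x : a \is N.-homog -> (0 < N)%N ->
  (forall i, x i = 0) -> a.@[x] = 0.
Proof.
move=> ha N0 hx; have := mmap_dhomog idfun x 0 ha; rewrite expr0n eqn0Ngt N0 mul0r => <-.
by apply: meval_eq => i; rewrite hx mul0r.
Qed.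

(** If [p] does not vanish at [e0], then [toX p] is monic up to a nonzero constant. Moving a general
    point to [e0] is how the resultants below keep their degrees. *)
Lemma toX_lead p N : p \is N.-homog -> (toX p)`_N = (p.@[e0 0])%:MP.
Proof.
move=> hp; have [sp cp] := toX_homog hp.
have := cp N; rewrite subnn => /(homog0_const (fun _ => 0)) ->; congr (_%:MP).
have e00 : e0 0 ord0 = 1 by rewrite /e0 /bvec mxE !eqxx.
rewrite -toX_eval e00.
have -> : map_poly (meval (fun j => e0 0 (lift ord0 j))) (toX p)
    = (((toX p)`_N).@[fun _ => 0])%:P * 'X^N.
  apply/polyP => k; rewrite coef_map coefCM coefXn.
  have [->|kN] := eqVneq k N.
    by rewrite mulr1; apply: meval_eq => j; rewrite /e0 /bvec mxE /=.
  rewrite mulr0; have [lt|le] := ltnP N k.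
    have -> : (toX p)`_k = 0 by apply: nth_default; apply: leq_trans sp lt.
    exact: meval0.
  rewrite /=; apply: (meval0_homog (cp k)); first by rewrite subn_gt0 ltn_neqAle kN.
  by move=> j; rewrite /e0 /bvec mxE.
by rewrite !hornerE expr1n mulr1.
Qed.

Lemma size_toX p N : p \is N.-homog -> p.@[e0 0] != 0 -> size (toX p) = N.+1.
Proof.
move=> hp pe; apply/eqP; rewrite eqn_leq; have [-> _] := toX_homog hp.
rewrite ltnNge; apply: contra pe => /leq_sizeP /(_ N (leqnn N)).
by rewrite (toX_lead hp) => /eqP; rewrite mpolyC_eq0.
Qed.

Lemma lead_toX p N : p \is N.-homog -> p.@[e0 0] != 0 ->
  lead_coef (toX p) = (p.@[e0 0])%:MP.
Proof. by move=> hp pe; rewrite lead_coefE (size_toX hp pe) (toX_lead hp). Qed.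

(** Constancy along [e0]: a binary form in the other two coordinates, seen among the ternary
    ones. *)
Definition xfree p := forall v, p.@[v 0] = p.@[(v - v 0 ord0 *: e0) 0].

Lemma xfree_iota a : xfree (iota a).
Proof.
move=> v; rewrite !iota_eval; apply: meval_eq => j.
by rewrite /e0 /bvec !mxE eqxx /= mulr0 subr0.
Qed.

Lemma line_root p N (A B : 'rV[K]_3) : p \is N.-homog -> (0 < N)%N ->
  p.@[B 0] = 0 \/ exists c, p.@[(A + c *: B) 0] = 0.
Proof.
move=> hp N0; have [sp cp] := size_coef_lev A B hp.
have [B0|B0] := eqVneq (p.@[B 0]) 0; [by left|right].
have /closed_rootP[c /rootP hc] : size (lev p A B) != 1%N.
  suff -> : size (lev p A B) = N.+1 by rewrite eqSS -lt0n.
  apply/eqP; rewrite eqn_leq sp ltnNge; apply: contra B0 => /leq_sizeP/(_ N (leqnn N)).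
  by rewrite cp => ->.
by exists c; rewrite -lev_horner.
Qed.

(** [K] being algebraically closed, [p] has a zero [u] with first coordinate 0. The linear form
    vanishing at [u] and [e0] divides [p], since [p] is constant along [e0], and the quotient is
    again constant along [e0]. *)
Lemma xfree_split p N : p \is N.-homog -> p != 0 -> xfree p ->
  exists (a : K) (s : seq 'rV[K]_3), [/\ a != 0, size s = N,
    forall c : 'rV[K]_3, c \in s -> c != 0 /\ c 0 ord0 = 0 & p = a *: \prod_(c <- s) lin c].
Proof.
elim: N p => [|N IH] p hp p0 xp.
  have pE := homog0_const (fun _ => 0) hp.
  exists p.@[fun _ => 0], [::]; rewrite big_nil; split=> //.
    by apply: contra p0; rewrite {2}pE => /eqP ->; rewrite mpolyC0.
  by rewrite {1}pE -mul_mpolyC mulr1.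
have [u [u0 u1 pu]] : exists u : 'rV[K]_3, [/\ u 0 ord0 = 0, u != 0 & p.@[u 0] = 0].
  case: (line_root (bvec o1) (bvec o2) hp isT) => [h|[c hc]].
    exists (bvec o2); split; rewrite // ?mxE //.
    by apply/eqP => /rowP/(_ o2)/eqP; rewrite !mxE !eqxx oner_eq0.
  exists (bvec o1 + c *: bvec o2); split; rewrite // ?mxE //=.
    by rewrite mulr0 addr0.
  apply/eqP => /rowP/(_ o1)/eqP; rewrite !mxE !eqxx /= mulr0 addr0.
  by rewrite oner_eq0.
pose c : 'rV[K]_3 := u 0 o2 *: bvec o1 - u 0 o1 *: bvec o2.
have cE : [/\ c 0 ord0 = 0, c 0 o1 = u 0 o2 & c 0 o2 = - u 0 o1].
  by split; rewrite !mxE /= ?mulr1 ?mulr0 ?subr0 ?sub0r.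
have c0 : c != 0.
  apply: contra u1 => /eqP ce; case: cE; rewrite ce !mxE => _ e1 e2.
  apply/eqP/rowP; apply: ord3_ind; rewrite mxE //; apply/eqP.
  by rewrite -oppr_eq0 -e2.
have [q pE] : zero_on (lin c) p.
  apply/(lin_dvdP charK _ c0) => v; rewrite /dotp !big_ord_recl big_ord0 addr0.
  case: cE => -> -> ->; rewrite mul0r add0r mulNr => /eqP; rewrite subr_eq0 => /eqP e.
  have [[k kE]|] : (exists k, v - v 0 ord0 *: e0 = k *: u) \/ False.
  - left; have [h1|h1] := eqVneq (u 0 o1) 0.
      have h2 : u 0 o2 != 0.
        apply: contra u1 => /eqP h2; apply/eqP/rowP; apply: ord3_ind; by rewrite mxE.
      exists (v 0 o2 / u 0 o2); apply/rowP; apply: ord3_ind; rewrite /e0 /bvec !mxE /=.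
      + by rewrite u0 mulr1 subrr mulr0.
      + rewrite h1 !mulr0 subr0; move/eqP: e; rewrite h1 mul0r mulf_eq0 (negPf h2).
        by move/eqP.
      + by rewrite mulr0 subr0 divfK.
    exists (v 0 o1 / u 0 o1); apply/rowP; apply: ord3_ind; rewrite /e0 /bvec !mxE /=.
    + by rewrite u0 mulr1 subrr mulr0.
    + by rewrite mulr0 subr0 divfK.
    + by rewrite mulr0 subr0 mulrAC; apply: (mulIf h1); rewrite divfK // mulrC -e mulrC.
  - by rewrite xp kE (meval_vecZ _ _ hp) pu mulr0.
  - by [].
have l0 : lin c != 0 by apply: lin_neq0.
have q0 : q != 0 by apply: contra p0 => /eqP qe; rewrite pE qe mulr0.
have hq : q \is N.-homog.
  by have := hp; rewrite pE => /(dhomog_div l0 (dhomog_lin c)); rewrite subn1.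
have xq : xfree q.
  (* [m] projects along [e0], so [xfree] means being fixed by the ring morphism [lact m]; this
     passes to the quotient. *)
  pose m : 'M[K]_3 := 1%:M - delta_mx ord0 ord0.
  have mE v : v *m m = v - v 0 ord0 *: e0.
    rewrite mulmxBr mulmx1; congr (_ - _); apply/rowP => i.
    rewrite !mxE (bigD1 ord0) //= big1 ?addr0 ?mxE ?eqxx // => j /negPf jn.
    by rewrite mxE jn mulr0.
  have lm p' : lact m p' = p' <-> xfree p'.
    split=> [<- v|xp']; last by apply: mpoly_eq_vec => // v; rewrite lactE mE -xp'.
    rewrite !lactE -!mE -mulmxA; congr (_.@[(_ *m _) 0]).
    rewrite /m mulmxBl mul1mx mulmxBr mulmx1 mul_delta_mx; by rewrite subrr subr0.
  apply/lm/(mulfI l0); rewrite -pE -(proj2 (lm p) xp) pE rmorphM /=.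
  congr (_ * _); apply/esym/lm => v; rewrite !lin_eval dotpDr dotpNr dotpZr.
  by rewrite /e0 dotp_delta (let: And3 h _ _ := cE in h) mulr0 subr0.
have [a [s [a0 ss cs qE]]] := IH q hq q0 xq.
exists a, (c :: s); split=> //=; first by rewrite ss.
  move=> c'; rewrite inE => /orP[/eqP ->|/cs //]; split=> //.
  by case: cE.
by rewrite big_cons pE qE -scalerAr.
Qed.

(** In the Leibniz expansion the degree of the term of a permutation s is the sum of [al i - s i],
    which does not depend on s. The bound [j <= al i] makes these subtractions genuine. *)
Lemma det_homog n (S : 'M[{mpoly K[2]}]_n) (al : 'I_n -> nat) :
  (forall i j, S i j != 0 -> (j <= al i)%N /\ S i j \is (al i - j).-homog) ->
  \det S \is (\sum_i al i - \sum_(i < n) i).-homog.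
Proof.
move=> hS; rewrite /determinant rpred_sum // => s _.
suff : \prod_i S i (s i) \is (\sum_i al i - \sum_(i < n) i).-homog.
  by rewrite mulr_sign; case: (odd_perm s) => hp; rewrite ?rpredN.
have [/existsP[i /eqP Si]|/existsPn h] := boolP [exists i, S i (s i) == 0].
  by rewrite (bigD1 i) //= Si mul0r rpred0.
have -> : (\sum_i al i - \sum_(i < n) i = \sum_i (al i - s i))%N.
  rewrite sumnB => [|i _]; last by case: (hS i (s i) (h i)).
  by congr (_ - _)%N; rewrite (reindex_inj (@perm_inj _ s)).
elim/big_ind2: _ => [|x y x' y'|i _]; rewrite ?dhomog1 //; first exact: dhomogM.
by case: (hS i (s i) (h i)).
Qed.

(** Row k of a block of the Sylvester matrix holds the coefficients of X^k f (or X^k h); its entry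
    in column j has degree d + k - j (or e + k - j). These are the row weights for [det_homog]. *)
Definition sylvester_weight (a b : nat) (i : 'I_(a + b)) : nat :=
  match fintype.split i with inl k => b + k | inr k => a + k end.

Lemma sum_sylvester_weight a b :
  (\sum_i @sylvester_weight a b i - \sum_(i < a + b) i = b * a)%N.
Proof.
rewrite !big_split_ord /=.
rewrite (eq_bigr (fun k : 'I_a => b + k)%N) => [|k _]; last first.
  by rewrite /sylvester_weight -[lshift _ k]/(unsplit (inl k)) unsplitK.
rewrite [X in (_ + X - _)%N](eq_bigr (fun k : 'I_b => a + k)%N) => [|k _]; last first.
  by rewrite /sylvester_weight -[rshift _ k]/(unsplit (inr k)) unsplitK.
rewrite [X in (X + _ - _)%N]big_split /= sum_nat_const card_ord.
by rewrite -addnA addnK mulnC.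
Qed.

Lemma resultant_homog f h d e : f \is d.-homog -> h \is e.-homog ->
  f.@[e0 0] != 0 -> h.@[e0 0] != 0 -> resultant (toX f) (toX h) \is (d * e).-homog.
Proof.
move=> hf hh f0 h0; rewrite /resultant.
have sf := size_toX hf f0; have sh := size_toX hh h0.
have := @det_homog _ (Sylvester_mx (toX f) (toX h)) (@sylvester_weight _ _).
have -> : (\sum_i @sylvester_weight (size (toX h)).-1 (size (toX f)).-1 i -
    \sum_(i < (size (toX h)).-1 + (size (toX f)).-1) i = d * e)%N.
  by rewrite sum_sylvester_weight; congr (_ * _)%N; [rewrite sf|rewrite sh].
apply=> i j.
have entry p N n m : p \is N.-homog -> size (toX p) = N.+1 ->
    (toX p)`_(n - m) *+ (m <= n) != 0 ->
    (n <= (size (toX p)).-1 + m)%N /\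
    (toX p)`_(n - m) *+ (m <= n) \is ((size (toX p)).-1 + m - n).-homog.
  move=> hp sp; rewrite sp /=.
  have [le|] := leqP m n; rewrite ?mulr0n ?eqxx // mulr1n => nz.
  have lt : (n - m <= N)%N.
    by rewrite leqNgt; apply: contra nz => lt; apply/eqP/nth_default; rewrite sp.
  split; first by rewrite addnC -leq_subLR.
  have -> : (N + m - n = N - (n - m))%N by lia.
  by case: (toX_homog hp).
rewrite Sylvester_mxE /sylvester_weight.
case: (fintype.split i) => k.
  exact: (entry _ _ _ _ hf sf).
exact: (entry _ _ _ _ hh sh).
Qed.

Lemma map_resultant_rmorph (aR rR : nzRingType) (phi : {rmorphism aR -> rR})
    (P Q : {poly aR}) :
  phi (lead_coef P) != 0 -> phi (lead_coef Q) != 0 ->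
  phi (resultant P Q) = resultant (map_poly phi P) (map_poly phi Q).
Proof.
move=> nP nQ; rewrite /resultant /Sylvester_mx !size_map_poly_id0 //.
rewrite -det_map_mx /= map_col_mx; congr (\det (col_mx _ _));
  by apply: map_lin1_mx => u; rewrite map_poly_rV rmorphM /= map_rVpoly.
Qed.

Lemma resultant_ideal f h d e : f \is d.-homog -> h \is e.-homog ->
  (0 < d)%N -> (0 < e)%N -> f.@[e0 0] != 0 -> h.@[e0 0] != 0 ->
  exists a b, iota (resultant (toX f) (toX h)) = a * f + b * h.
Proof.
move=> hf hh d0 e1 f0 h0.
have sf : (1 < size (toX f))%N by rewrite (size_toX hf f0).
have sh : (1 < size (toX h))%N by rewrite (size_toX hh h0).
have [[u v] _ uv] := resultant_in_ideal sf sh.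
exists (fromX u), (fromX v).
by rewrite -fromX_C uv rmorphD !rmorphM /= !toXK.
Qed.

(** The resultant is a binary form of positive degree and has a zero [u]. Over [u] both polynomials
    in the first variable keep their degrees, so they share a root. *)
Lemma common_zero_e0 f h d e : f \is d.-homog -> h \is e.-homog ->
  (0 < d)%N -> (0 < e)%N -> f.@[e0 0] != 0 -> h.@[e0 0] != 0 ->
  exists2 v : 'rV[K]_3, v != 0 & f.@[v 0] = 0 /\ h.@[v 0] = 0.
Proof.
move=> hf hh d0 e1 f0 h0.
pose r := resultant (toX f) (toX h).
have hr : r \is (d * e).-homog by apply: resultant_homog.
have [u u1 ru] : exists2 u : 'rV[K]_3,
    (exists j : 'I_2, u 0 (lift ord0 j) != 0) & (iota r).@[u 0] = 0.
  have hir := dhomog_iota hr.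
  have de : (0 < d * e)%N by rewrite muln_gt0 d0.
  case: (line_root (bvec o1) (bvec o2) hir de) => [h'|[c hc]].
    by exists (bvec o2) => //; exists (lift ord0 ord0); rewrite /bvec mxE !eqxx oner_eq0.
  exists (bvec o1 + c *: bvec o2) => //; exists ord0.
  by rewrite /bvec !mxE !eqxx /= mulr0 addr0 oner_eq0.
pose ev : {mpoly K[2]} -> K := meval (fun j => u 0 (lift ord0 j)).
have lf : ev (lead_coef (toX f)) != 0 by rewrite (lead_toX hf f0) /ev mevalC.
have lh : ev (lead_coef (toX h)) != 0 by rewrite (lead_toX hh h0) /ev mevalC.
have : resultant (map_poly ev (toX f)) (map_poly ev (toX h)) == 0.
  by rewrite -map_resultant_rmorph // -/r -ru iota_eval.
rewrite resultant_eq0 => sg.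
have /closed_rootP[x] : size (gcdp (map_poly ev (toX f)) (map_poly ev (toX h))) != 1%N.
  by rewrite neq_ltn sg orbT.
rewrite root_gcd => /andP[/rootP r1 /rootP r2].
pose v : 'rV[K]_3 := u + (x - u 0 ord0) *: e0.
have v0 : v 0 ord0 = x by rewrite /v /e0 /bvec !mxE !eqxx mulr1 addrC subrK.
have vl j : v 0 (lift ord0 j) = u 0 (lift ord0 j).
  by rewrite /v /e0 /bvec !mxE /= mulr0 addr0.
have vE p : (map_poly ev (toX p)).[x] = p.@[v 0].
  rewrite -toX_eval v0; congr (_.[_]); apply: eq_map_poly => a.
  by apply: meval_eq => j; rewrite vl.
exists v; last by rewrite -!vE r1 r2.
have [j uj] := u1; apply: contra uj => /eqP v00; by rewrite -vl v00 mxE.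
Qed.

End Elimination.

Arguments e0 {K}.
Arguments toX {K}.
Arguments iota {K}.
Arguments fromX {K}.

(** * A smooth form is irreducible, hence prime *)

Section Prime.
Variable K : closedFieldType.
Hypothesis charK : [pchar K] =i pred0.
Implicit Types (p q f g h a b : {mpoly K[3]}) (v w : 'rV[K]_3).

Lemma size_sub_lt (R : nzRingType) (P Q : {poly R}) n :
  (size P <= n.+1)%N -> (size Q <= n.+1)%N -> P`_n = Q`_n -> (size (P - Q)%R <= n)%N.
Proof.
move=> sP sQ e; apply/leq_sizeP => j; rewrite leq_eqVlt coefB => /orP[/eqP <-|lt].
  by rewrite e subrr.
by rewrite !nth_default ?subrr //; apply: leq_trans lt.
Qed.

Lemma pseudo_division_step (T : comNzRingType) (l lk lx p v q r : T) :
  lk * (l * p - lx * v) = v * q + r -> lk * l * p = v * (q + lk * lx) + r.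
Proof.
move=> E; have -> : lk * l * p = lk * (l * p - lx * v) + lk * lx * v by ring.
by rewrite E; ring.
Qed.

(** Pseudo-division in the first variable, recording that the remainder of two forms is again a
    form. *)
Lemma pseudo_division (v p : {mpoly K[3]}) e N : v != 0 -> v \is e.-homog ->
  p \is N.-homog -> exists k q r M, [/\
    iota (lead_coef (toX v)) ^+ k * p = v * q + r, r \is M.-homog
    & (size (toX r) < size (toX v))%N].
Proof.
move=> v0 hv.
have V0 : toX v != 0 by rewrite toX_eq0.
have sv0 : (0 < size (toX v))%N by rewrite size_poly_gt0.
have [n] := ubnP (size (toX p)); elim: n => // n IH in p N *; rewrite ltnS => sn hp.
have [lt|le] := ltnP (size (toX p)) (size (toX v)).
  by exists 0%N, 0, p, N; rewrite expr0 mul1r mulr0 add0r.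
have [svN cv] := toX_homog hv; have [spN cp] := toX_homog hp.
pose lv := lead_coef (toX v); pose lp := lead_coef (toX p).
pose k := (size (toX p) - size (toX v))%N.
pose p' := iota lv * p - iota lp * 'X_ord0 ^+ k * v.
have hp' : p' \is (e - (size (toX v)).-1 + N).-homog.
  apply: rpredB; first by apply: dhomogM => //; apply: dhomog_iota; apply: cv.
  have -> : (e - (size (toX v)).-1 + N = N - (size (toX p)).-1 + 1 * k + e)%N by rewrite /k; lia.
  apply: dhomogM => //; apply: dhomogM; first by apply: dhomog_iota; apply: cp.
  by apply: dhomogMn; apply: dhomog_var.
have sp' : (size (toX p') < n)%N.
  apply: leq_trans sn; rewrite /p' rmorphB /= !rmorphM rmorphXn /= !toX_iota toX_X0.
  have sp0 : (0 < size (toX p))%N by apply: leq_trans le.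
  rewrite -[X in (_ < X)%N]prednK // ltnS; apply: size_sub_lt; rewrite ?prednK //.
  - by rewrite mul_polyC; apply: leq_trans (size_scale_leq _ _) _.
  - rewrite -mulrA mul_polyC; apply: leq_trans (size_scale_leq _ _) _.
    by rewrite mulrC size_mulXn // /k subnK.
  - rewrite -mulrA !coefCM coefXnM.
    have -> : ((size (toX p)).-1 < k)%N = false.
      by apply/negbTE; rewrite -leqNgt /k -subn1 leq_sub2l.
    have -> : ((size (toX p)).-1 - k = (size (toX v)).-1)%N.
      by rewrite /k -subn1 subnAC subKn // subn1.
    by rewrite /lv /lp !lead_coefE mulrC.
have [k' [q [r [M [E hr sr]]]]] := IH p' _ sp' hp'.
exists k'.+1, (q + iota lv ^+ k' * (iota lp * 'X_ord0 ^+ k)), r, M; split=> //.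
by rewrite exprSr; apply: pseudo_division_step.
Qed.

(** Takes the place of Gauss's lemma: the denominators are products of linear forms, and each of
    these, being prime, goes into [v] or into [q]. *)
Lemma strip_lin (s : seq 'rV[K]_3) (c0 : K) f (v q : {mpoly K[3]}) :
  c0 != 0 -> (forall c : 'rV[K]_3, c \in s -> c != 0) ->
  c0 *: (\prod_(c <- s) lin c) * f = v * q ->
  exists (s1 : seq 'rV[K]_3) (v' q' : {mpoly K[3]}), [/\ {subset s1 <= s}, v = \prod_(c <- s1) lin c * v'
    & f = v' * q'].
Proof.
move=> c00; elim: s v q => [|c s IH] v q hs.
  rewrite big_nil -scalerAl mul1r => E; exists [::], v, (c0^-1 *: q).
  by rewrite big_nil mul1r -scalerAr -E scalerA mulVf // scale1r.
rewrite big_cons => E.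
have cn0 : c != 0 by apply: hs; rewrite mem_head.
have hs' (c' : 'rV_3) : c' \in s -> c' != 0 by move=> h; apply: hs; rewrite inE h orbT.
have lc0 := lin_neq0 cn0.
have [[v1 vE]|[q1 qE]] : zero_on (lin c) v \/ zero_on (lin c) q.
- apply: (lin_prime charK cn0); rewrite -E; exists (c0 *: (\prod_(c <- s) lin c) * f).
  by rewrite [RHS]mulrA -scalerAr.
- have [s1 [v' [q' [sub v1E fE]]]] : exists (s1 : seq 'rV[K]_3) (v' q' : {mpoly K[3]}), [/\ {subset s1 <= s},
     v1 = \prod_(c <- s1) lin c * v' & f = v' * q'].
    apply: (IH _ q) => //; apply: (mulfI lc0); by rewrite [RHS]mulrA -vE -E mulrA -scalerAr.
  exists (c :: s1), v', q'; split=> //; last by rewrite big_cons vE v1E mulrA.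
  by move=> x; rewrite !inE => /orP[->//|/sub ->]; rewrite orbT.
- have [s1 [v' [q' [sub v1E fE]]]] : exists (s1 : seq 'rV[K]_3) (v' q' : {mpoly K[3]}), [/\ {subset s1 <= s},
     v = \prod_(c <- s1) lin c * v' & f = v' * q'].
    apply: (IH _ q1) => //; apply: (mulfI lc0); by rewrite [RHS]mulrCA -qE -E mulrA -scalerAr.
  by exists s1, v', q'; split=> // x /sub; rewrite inE => ->; rewrite orbT.
Qed.

Definition form_irreducible f := forall g h dg dh,
  g \is dg.-homog -> h \is dh.-homog -> f = g * h -> dg = 0%N \/ dh = 0%N.

Lemma zero_on_cancel_lin f (c : 'rV[K]_3) a : f.@[e0 0] != 0 -> c != 0 -> c 0 ord0 = 0 ->
  zero_on f (lin c * a) -> zero_on f a.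
Proof.
move=> fe cn0 cx [g gE].
have [|[f1 fE]|[g1 g1E]] := @lin_prime _ charK c f g cn0.
- by exists a; rewrite gE.
- by case/negP: fe; rewrite fE mevalM lin_eval /e0 dotp_delta cx mul0r.
- exists g1; apply: (mulfI (lin_neq0 cn0)); by rewrite gE g1E mulrCA.
Qed.

(** Among the nonzero forms v with f | v a, take one of least degree in the first variable.
    Pseudo-dividing [f] by v leaves no remainder, so v is a product of linear forms times a divisor
    v' of [f]. If v' is constant, the linear forms cancel and f | a. Otherwise no smaller form
    multiplies [a] into (f), and pseudo-dividing [b] by [f] gives f | b. *)
Lemma prime_e0 f d a b N M : f \is d.-homog -> f.@[e0 0] != 0 ->
  form_irreducible f -> a \is N.-homog -> b \is M.-homog ->
  zero_on f (a * b) -> zero_on f a \/ zero_on f b.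
Proof.
move=> hf fe irr ha hb fab.
have f0 : f != 0 by apply: contra fe => /eqP ->; rewrite meval0.
pose G n := exists (v : {mpoly K[3]}) e, [/\ v != 0, v \is e.-homog, size (toX v) = n & zero_on f (v * a)].
have exG : exists n, `[< G n >].
  by exists (size (toX f)); apply/asboolP; exists f, d; split=> //; exists a.
case: (ex_minnP exG) => n /asboolP[v [e [v0 hv sv fva]]] nmin.
have small r k : r \is k.-homog -> zero_on f (r * a) -> (size (toX r) < n)%N -> r = 0.
  move=> hr fr lt; apply: contraTeq lt => r0; rewrite -leqNgt; apply: nmin; apply/asboolP.
  by exists r, k.
have [k [q [r [m [E hr sr]]]]] := pseudo_division v0 hv hf.
have r0 : r = 0.
  apply: (small r m) => //; last by rewrite -sv.
  have -> : r = iota (lead_coef (toX v)) ^+ k * f - v * q by rewrite E addrC addKr.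
  rewrite mulrBl; apply: zero_onB.
    by exists (iota (lead_coef (toX v)) ^+ k * a); rewrite [RHS]mulrCA mulrA.
  by rewrite mulrAC; apply: zero_onMr.
rewrite r0 addr0 in E.
have [svN cv] := toX_homog hv.
have lv0 : lead_coef (toX v) != 0 by rewrite lead_coef_eq0 toX_eq0.
pose D := lead_coef (toX v) ^+ k.
have hD : D \is ((e - (size (toX v)).-1) * k).-homog by apply: dhomogMn; apply: cv.
have iD0 : iota D != 0.
  by rewrite -toX_eq0 toX_iota polyC_eq0 expf_neq0.
have [c0 [s [c00 _ hs DE]]] := xfree_split charK (dhomog_iota hD) iD0 (xfree_iota D).
have [s1 [v' [q' [sub vE fE]]]] : exists (s1 : seq 'rV[K]_3) (v' q' : {mpoly K[3]}), [/\ {subset s1 <= s},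
     v = \prod_(c <- s1) lin c * v' & f = v' * q'].
  apply: (@strip_lin s c0 f v q) => //; first by move=> c /hs[].
  by rewrite -DE -E /D rmorphXn.
have pr0 : \prod_(c <- s1) lin c != 0 :> {mpoly K[3]}.
  by apply: contra v0 => /eqP e'; rewrite vE e' mul0r.
have hpr : \prod_(c <- s1) lin c \is (size s1).-homog.
  elim: (s1) => [|c s2 IH]; first by rewrite big_nil dhomog1.
  by rewrite big_cons -[size _]add1n; apply: dhomogM => //; apply: dhomog_lin.
have hv' : v' \is (e - size s1).-homog by apply: (dhomog_div pr0 hpr); rewrite -vE.
have v'0 : v' != 0 by apply: contra v0 => /eqP e'; rewrite vE e' mulr0.
have hq' : q' \is (d - (e - size s1)).-homog by apply: (dhomog_div v'0 hv'); rewrite -fE.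
have cst g dg : g \is dg.-homog -> dg = 0%N -> exists c, g = c%:MP.
  by move=> hg dg0; exists g.@[fun _ => 0]; apply: homog0_const; move: hg; rewrite dg0.
case: (irr v' q' _ _ hv' hq' fE) => [/(cst _ _ hv')[c cE]|/(cst _ _ hq')[c cE]].
  left; move: fva; rewrite vE cE -mulrA mul_mpolyC.
  have cn0 : c != 0 by apply: contra v'0 => /eqP c0'; rewrite cE c0' mpolyC0.
  elim: (s1) sub => [|c1 s2 IH] sub.
    rewrite big_nil mul1r => /(zero_onZ c^-1); by rewrite scalerA mulVf // scale1r.
  rewrite big_cons -mulrA => /zero_on_cancel_lin h.
  have [c1n c1x] := hs c1 (sub _ (mem_head _ _)).
  by apply: IH; [move=> x xs; apply: sub; rewrite inE xs orbT|apply: h].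
right.
(* Here [q'] is constant, so [v'] is [f] up to a scalar and the least degree is at least that of
   [f]. *)
have nd : (size (toX f) <= n)%N.
  rewrite -sv vE rmorphM /= size_mul ?toX_eq0 //.
  have -> : size (toX f) = size (toX v').
    rewrite fE cE rmorphM /= toXC mulrC mul_polyC size_scale //.
    rewrite mpolyC_eq0; apply: contra f0 => /eqP c0'.
    by rewrite fE cE c0' mpolyC0 mulr0.
  have := pr0; rewrite -toX_eq0 -size_poly_gt0.
  by case: (size _) => // l _; rewrite addSn leq_addl.
have [k' [q1 [r' [m' [E' hr' sr']]]]] := pseudo_division f0 hf hb.
have r'0 : r' = 0.
  apply: (small r' m') => //; last by apply: leq_trans nd.
  have -> : r' = iota (lead_coef (toX f)) ^+ k' * b - f * q1 by rewrite E' addrC addKr.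
  rewrite mulrBl -mulrA; apply: zero_onB; last by exists (q1 * a); rewrite mulrA.
  by apply: zero_onMl; rewrite mulrC.
move: E'; rewrite r'0 addr0 (lead_toX hf fe) iotaC -rmorphXn /= mul_mpolyC => E'.
exists (f.@[e0 0] ^- k' *: q1); rewrite -scalerAr -E' scalerA mulVf ?scale1r //.
by rewrite expf_neq0.
Qed.

Lemma zero_on_pihomog f d a N : f \is d.-homog -> a \is N.-homog ->
  forall V k, zero_on f (a * V) -> zero_on f (a * pihomog mdeg k V).
Proof.
move=> hf ha V k [U UE]; rewrite -(pihomogMl _ _ ha) UE.
have [le|lt] := leqP d (N + k); last by rewrite (pihomogM_lt _ hf lt); apply: zero_on0.
by rewrite -{1}(subnKC le) (pihomogMl _ _ hf); exists (pihomog mdeg (N + k - d) U).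
Qed.

(** Only the factor to be cancelled has to be homogeneous; the cofactor is arbitrary, as in
    [zero_on]. *)
Definition form_prime f := forall a N V, a \is N.-homog ->
  zero_on f (a * V) -> zero_on f a \/ zero_on f V.

Lemma form_prime_exp f a V N k : form_prime f -> a \is N.-homog -> ~ zero_on f a ->
  zero_on f (a ^+ k * V) -> zero_on f V.
Proof.
move=> pr ha na; elim: k => [|k IH]; first by rewrite mul1r.
by rewrite exprS -mulrA => /(pr _ _ _ ha)[|/IH].
Qed.

Lemma form_prime_e0 f d : f \is d.-homog -> f.@[e0 0] != 0 ->
  form_irreducible f -> form_prime f.
Proof.
move=> hf fe irr a N V ha faV.
have [fa|nfa] := pselect (zero_on f a); [by left|right].
rewrite (pihomog_partitionE (leqnn (msize V))); apply: zero_on_sum => k _.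
have fk := zero_on_pihomog hf ha k faV.
by case: (prime_e0 hf fe irr ha (pihomogP _ _ _) fk).
Qed.

Lemma form_prime_lact (A : 'M[K]_3) f :
  A \in unitmx -> form_prime (lact A f) -> form_prime f.
Proof.
move=> u pr a N V ha /(zero_on_lact A); rewrite rmorphM /=.
case/(pr _ N _ (dhomog_lact A ha)); rewrite (zero_on_lactE charK _ _ u); by [left|right].
Qed.

Lemma unitmx_row (O : 'rV[K]_3) : O != 0 ->
  exists2 A, A \in unitmx & e0 *m A = O.
Proof.
move=> O0; have rk : \rank O = 1%N.
  by apply/eqP; rewrite eqn_leq rank_leq_row lt0n mxrank_eq0.
pose c := col_ebase O 0 0.
have cE : col_ebase O = c%:M by rewrite [LHS]mx11_scalar.
have c0 : c != 0.
  have := col_ebase_unit O; rewrite cE unitmxE det_scalar1 unitfE; exact.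
exists (c *: row_ebase O); first by rewrite unitmxZ ?unitfE // row_ebase_unit.
rewrite -[RHS]mulmx_ebase rk cE -mulmxA mul_scalar_mx -scalemxAr; congr (_ *: (_ *m _)).
apply/rowP => i; rewrite /e0 /bvec !mxE /=.
by case: (unliftP ord0 i) => [j|] ->.
Qed.

Lemma dder_lact A f v w : dder (lact A f) v w = dder f (v *m A) (w *m A).
Proof. by rewrite -!lev_coef1 lev_lact. Qed.

Lemma dder_delta f v i : dder f v (delta_mx 0 i) = f^`M(i).@[v 0].
Proof.
rewrite /dder (bigD1 i) //= big1 ?addr0 => [|j ji]; rewrite !mxE ?eqxx ?mul1r //=.
by rewrite (negPf ji) mul0r.
Qed.

Lemma smooth_dder d f v : smooth_plane_curve d f -> v != 0 -> f.@[v 0] = 0 ->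
  exists w, dder f v w != 0.
Proof.
move=> [_ _ sm] v0 /(sm v v0)[i hi]; exists (delta_mx 0 i).
by rewrite dder_delta.
Qed.

Lemma smooth_lact A d f : A \in unitmx -> smooth_plane_curve d f ->
  smooth_plane_curve d (lact A f).
Proof.
move=> u sm; have [f0 hf _] := sm.
split; [by rewrite lact_eq0|exact: dhomog_lact|move=> v v0; rewrite lactE => fv].
have vA0 : v *m A != 0.
  by apply: contra v0 => /eqP e; rewrite -(mulmxK u v) e mul0mx.
have [w hw] := smooth_dder sm vA0 fv.
have {}hw : dder (lact A f) v (w *m invmx A) != 0 by rewrite dder_lact mulmxKV.
apply/existsP; rewrite -negb_forall; apply: contra hw => /forallP h.
by rewrite /dder big1 // => i _; rewrite (eqP (h i)) mulr0.
Qed.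

(** Two factors of positive degree would have a common zero, and by the product rule [f] is singular
    there. *)
Lemma smooth_irreducible_e0 d f : f.@[e0 0] != 0 -> smooth_plane_curve d f ->
  form_irreducible f.
Proof.
move=> fe sm g h dg dh hg hh fE.
have [->|dg0] := posnP dg; [by left|]; have [->|dh0] := posnP dh; [by right|].
move: fe; rewrite fE mevalM mulf_eq0 negb_or => /andP[ge he].
have [v v0 [gv hv]] := common_zero_e0 hg hh dg0 dh0 ge he.
have [|w] := smooth_dder sm v0; first by rewrite fE mevalM gv mul0r.
rewrite -lev_coef1 fE levM coefM big_ord_recl big_ord1 /= !lev_coef0 gv hv.
by rewrite mul0r mulr0 addr0 eqxx.
Qed.

Lemma delta_neq0 i : delta_mx 0 i != 0 :> 'rV[K]_3.
Proof. by apply/eqP => /rowP/(_ i)/eqP; rewrite !mxE !eqxx oner_eq0. Qed.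

Lemma lin_delta i : lin (delta_mx 0 i) = 'X_i :> {mpoly K[3]}.
Proof.
rewrite /lin (bigD1 i) //= big1 ?addr0 => [|j ji]; rewrite !mxE ?eqxx ?scale1r //=.
by rewrite (negPf ji) scale0r.
Qed.

Lemma unitmx_nonroot p : p != 0 -> exists2 A, A \in unitmx & (lact A p).@[e0 0] != 0.
Proof.
move=> p0; have [v] : exists v, (p * 'X_ord0).@[v 0] != 0.
  by apply: mpoly_nonroot_vec => //; rewrite mulf_neq0 // -(lin_delta ord0) lin_neq0 // delta_neq0.
rewrite mevalM mevalXU mulf_eq0 negb_or => /andP[hv v0].
have {}v0 : v != 0 by apply: contra v0 => /eqP ->; rewrite mxE.
have [A u AE] := unitmx_row v0; exists A => //; by rewrite lactE AE.
Qed.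

Lemma form_prime_smooth d f : smooth_plane_curve d f -> form_prime f.
Proof.
move=> sm; have [f0 hf _] := sm; have [A u fA] := unitmx_nonroot f0.
apply: (form_prime_lact u); have sA := smooth_lact u sm; have [_ hA _] := sA.
exact: (form_prime_e0 hA fA (smooth_irreducible_e0 fA sA)).
Qed.

End Prime.

(** * Resultants on the curve and a weighted form of Bezout's theorem *)

Section Bezout.
Variable K : closedFieldType.
Hypothesis charK : [pchar K] =i pred0.
Implicit Types (f g h a b : {mpoly K[3]}).

Lemma size_contra (n1 n2 n3 n4 : nat) : n1 = (n2 + n3).-1 -> n2 = (n1 + n4).-1 ->
  (0 < n3 -> 0 < n2 -> 0 < n1 -> 1 < n4 -> False)%N.
Proof. lia. Qed.

(** If g is a nonconstant common divisor, with f = q g up to a scalar, then f | h q. Primality would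
    give f | q, and q has smaller degree than f. *)
Lemma resultant_neq0 f h d e : form_prime f -> f \is d.-homog -> h \is e.-homog ->
  f.@[e0 0] != 0 -> h.@[e0 0] != 0 -> ~ zero_on f h ->
  resultant (toX f) (toX h) != 0.
Proof.
move=> pr hf hh fe he nfh; apply/negP; rewrite resultant_eq0 => sg.
set g := gcdp (toX f) (toX h) in sg.
have f0 : toX f != 0.
  by rewrite toX_eq0; apply: contra fe => /eqP ->; rewrite meval0.
have /Pdiv.Idomain.dvdpP[[c q] /= c0 fE] : g %| toX f by apply: dvdp_gcdl.
have /Pdiv.Idomain.dvdpP[[c' q'] /= c'0 hE] : g %| toX h by apply: dvdp_gcdr.
have q0 : q != 0.
  apply: contraNneq f0 => q0; move/eqP: fE; rewrite q0 mul0r scale_poly_eq0 (negPf c0).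
  by [].
have : zero_on f (h * fromX (c' *: q)).
  exists (fromX (c *: q')); apply: (can_inj (toXK (K := K))).
  rewrite !rmorphM /= !fromXK -[LHS]scalerAr -[RHS]scalerAr !scalerAl fE hE.
  by rewrite mulrAC [RHS]mulrAC [q' * q]mulrC.
case/(pr h e _ hh) => // -[u uE].
have V0 : c' *: q != 0 by rewrite scale_poly_eq0 negb_or c'0.
have : c' *: q = toX f * toX u by rewrite -rmorphM /= -uE fromXK.
move=> E; have u0 : toX u != 0 by apply: contra V0 => /eqP e'; rewrite E e' mulr0.
have := size_mul f0 u0; rewrite -E size_scale // => sq.
have g0 : g != 0 by apply: contraTneq sg => ->; rewrite size_poly0.
have := size_mul q0 g0; rewrite -fE size_scale // => sf.
have su : (0 < size (toX u))%N by rewrite size_poly_gt0.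
have sf0 : (0 < size (toX f))%N by rewrite size_poly_gt0.
have sq0 : (0 < size q)%N by rewrite size_poly_gt0.
exact: (size_contra sq sf su sf0 sq0 sg).
Qed.

Lemma lact_lin A (c : 'rV[K]_3) : lact A (lin c) = lin (c *m A^T).
Proof.
apply: (mpoly_eq_vec charK) => v; rewrite lactE !lin_eval.
suff dE (x y : 'rV[K]_3) : dotp x y = (y *m x^T) 0 0.
  by rewrite !dE trmx_mul trmxK mulmxA.
by rewrite mxE; apply: eq_bigr => i _; rewrite mxE mulrC.
Qed.

Lemma lact_prod_lin A (s : seq 'rV[K]_3) :
  lact A (\prod_(c <- s) lin c) = \prod_(c <- [seq c *m A^T | c <- s]) lin c.
Proof.
by rewrite rmorph_prod big_map; apply: eq_bigr => c _; apply: lact_lin.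
Qed.

(** The multiple is the resultant: it lies in the ideal (f, h) and, as a binary form, splits.
    Denominators [h] are thereby reduced to products of lines in the proof of normality. *)
Lemma split_multiple d f h e : smooth_plane_curve d f -> (0 < d)%N ->
  h \is e.-homog -> ~ zero_on f h ->
  exists (b : {mpoly K[3]}) (s : seq 'rV[K]_3), (forall c, c \in s -> c != 0) /\
    zero_on f (b * h - \prod_(c <- s) lin c).
Proof.
move=> sm d0 hh nfh; have [f0 hf _] := sm.
have h0 : h != 0 by apply: contra_not_neq nfh => ->; apply: zero_on0.
have [e_0|e_gt0] := posnP e.
  have hC : h = (h.@[fun _ => 0])%:MP by apply: homog0_const; move: hh; rewrite e_0.
  exists (h.@[fun _ => 0]^-1)%:MP, [::]; split=> //; rewrite big_nil {2}hC -mpolyCM mulVf.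
    by rewrite mpolyC1 subrr; apply: zero_on0.
  by apply: contra h0 => /eqP e'; rewrite hC e' mpolyC0.
have fh0 : f * h != 0 by rewrite mulf_neq0.
have [A u] := unitmx_nonroot charK fh0; rewrite rmorphM mevalM mulf_eq0 negb_or.
case/andP=> fe he; have smA := smooth_lact charK u sm.
have hfA := dhomog_lact A hf; have hhA := dhomog_lact A hh.
have pr := form_prime_smooth charK smA.
have nfhA : ~ zero_on (lact A f) (lact A h) by rewrite zero_on_lactE.
have r0 := resultant_neq0 pr hfA hhA fe he nfhA.
have hr := resultant_homog hfA hhA fe he.
have [x [y rE]] := resultant_ideal hfA hhA d0 e_gt0 fe he.
have ir0 : iota (resultant (toX (lact A f)) (toX (lact A h))) != 0.
  by rewrite -toX_eq0 toX_iota polyC_eq0.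
have [c0 [s [c00 _ hs sE]]] := xfree_split charK (dhomog_iota hr) ir0 (xfree_iota _).
exists (lact (invmx A) (c0^-1 *: y)), [seq c *m (invmx A)^T | c <- s]; split.
  move=> c' /mapP[c /hs[cn0 _] ->]; apply: contra cn0 => /eqP e'.
  have uT : (invmx A)^T \in unitmx by rewrite unitmx_tr unitmx_inv.
  by rewrite -(mulmxK uT c) e' mul0mx.
rewrite -lact_prod_lin -(zero_on_lactE charK _ _ u) rmorphB /= (rmorphM (lact A)) /=.
rewrite !(lactVK charK u).
exists (- (c0^-1 *: x)); move: rE; rewrite sE => /(congr1 (fun t => c0^-1 *: t)).
rewrite scalerA mulVf // scale1r => ->.
by rewrite scalerDr !scalerAl opprD addrCA subrr addr0 mulrN [in RHS]mulrC.
Qed.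

(** The cross product: the coefficients of the line joining [P] and [Q], zero when they represent
    the same point. *)
Definition cross (P Q : 'rV[K]_3) : 'rV[K]_3 :=
  let o := fun k : nat => inord k : 'I_3 in
  \row_i (P 0 (o ((i + 1) %% 3)%N) * Q 0 (o ((i + 2) %% 3)%N)
          - P 0 (o ((i + 2) %% 3)%N) * Q 0 (o ((i + 1) %% 3)%N)).

Lemma crossE (P Q : 'rV[K]_3) :
  [/\ cross P Q 0 ord0 = P 0 o1 * Q 0 o2 - P 0 o2 * Q 0 o1,
      cross P Q 0 o1 = P 0 o2 * Q 0 ord0 - P 0 ord0 * Q 0 o2
    & cross P Q 0 o2 = P 0 ord0 * Q 0 o1 - P 0 o1 * Q 0 ord0].
Proof.
have i0 : inord 0 = ord0 :> 'I_3 by apply/val_inj; rewrite /= inordK.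
have i1 : inord 1 = o1 :> 'I_3 by apply/val_inj; rewrite /= inordK.
have i2 : inord 2 = o2 :> 'I_3 by apply/val_inj; rewrite /= inordK.
by split; rewrite !mxE /= ?i0 ?i1 ?i2.
Qed.

Lemma dotp3 (c v : 'rV[K]_3) :
  dotp c v = c 0 ord0 * v 0 ord0 + c 0 o1 * v 0 o1 + c 0 o2 * v 0 o2.
Proof. by rewrite /dotp !big_ord_recl big_ord0 addr0 addrA. Qed.

Lemma dotp_crossl (P Q : 'rV[K]_3) : dotp (cross P Q) P = 0.
Proof. by rewrite dotp3; case: (crossE P Q) => -> -> ->; ring. Qed.

Lemma dotp_crossr (P Q : 'rV[K]_3) : dotp (cross P Q) Q = 0.
Proof. by rewrite dotp3; case: (crossE P Q) => -> -> ->; ring. Qed.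

Lemma dotp_crossC (P Q R : 'rV[K]_3) : dotp (cross P R) Q = - dotp (cross P Q) R.
Proof.
by rewrite !dotp3; case: (crossE P Q) => -> -> ->; case: (crossE P R) => -> -> ->; ring.
Qed.

(** Cramer's rule for the four vectors P, Q, v, w of a three-dimensional space. *)
Lemma cross_span (P Q v : 'rV[K]_3) : cross P Q != 0 -> dotp (cross P Q) v = 0 ->
  exists x y : K, v = x *: P + y *: Q.
Proof.
move=> /dotp_surj[w cw] cv; exists (dotp (cross v Q) w), (dotp (cross P v) w).
apply/rowP => i; rewrite !mxE.
have -> : v 0 i = dotp (cross P Q) w * v 0 i - dotp (cross P Q) v * w 0 i.
  by rewrite cw cv mul1r mul0r subr0.
rewrite !dotp3; case: (crossE P Q) => -> -> ->; case: (crossE v Q) => -> -> ->.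
by case: (crossE P v) => -> -> ->; move: i; apply: ord3_ind; ring.
Qed.

Lemma lev_lin_root (c P Q : 'rV[K]_3) : dotp c P = 0 ->
  lev (lin c) P Q = 'X * (dotp c Q)%:P.
Proof. by move=> cP; rewrite lev_lin cP add0r. Qed.

Lemma projt_comp_mulI (mu O c : 'rV[K]_3) a : c != 0 -> dotp c O = 0 ->
  (lin c * a) \mPo projt mu O = lin c * a -> a \mPo projt mu O = a.
Proof.
move=> c0 cO; rewrite rmorphM /=.
have -> : lin c \mPo projt mu O = lin c.
  apply: (mpoly_eq_vec charK) => v; rewrite projt_eval !lin_eval.
  by rewrite dotpDr dotpNr dotpZr cO mulr0 subr0.
exact/mulfI/lin_neq0.
Qed.

(** [D] is a cone with vertex [O], so vanishing at [Q i] it contains the line joining [Q i] to [O].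
    That line meets the line from [Q i] to [R i] simply and misses the other [Q j], so dividing it
    out lowers [w i] by one and no other weight. *)
Lemma cone_count (I : finType) (Q R : I -> 'rV[K]_3) (mu O : 'rV[K]_3) :
  dotp mu O = 1 ->
  (forall i, dotp (cross (Q i) (R i)) O != 0) ->
  (forall i j, i != j -> dotp (cross (Q i) (Q j)) O != 0) ->
  forall N D (w : I -> nat), D != 0 -> D \is N.-homog -> D \mPo projt mu O = D ->
  (forall i, 'X^(w i) %| lev D (Q i) (R i)) -> (\sum_i w i <= N)%N.
Proof.
move=> muO QR QQ N; elim: N => [|N IH] D w D0 hD DO wD.
  rewrite big1 // => i _; apply/eqP; rewrite -leqn0 leqNgt; apply: contra D0 => wi.
  have := dvdp_trans (dvdp_exp2l 'X wi) (wD i); rewrite expr1 -['X]subr0 dvdp_XsubCl.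
  rewrite /root lev_horner scale0r addr0 => /eqP.
  by rewrite (homog0_const (fun _ => 0) hD) mevalC => ->; rewrite mpolyC0.
have [/existsP[i wi]|/existsPn h] := boolP [exists i, (0 < w i)%N]; last first.
  by rewrite big1 // => i _; apply/eqP; rewrite -leqn0 leqNgt.
have Di : D.@[(Q i) 0] = 0.
  have := dvdp_trans (dvdp_exp2l 'X wi) (wD i); rewrite expr1 -['X]subr0 dvdp_XsubCl.
  by rewrite /root lev_horner scale0r addr0 => /eqP.
pose c := cross (Q i) O.
have cR : dotp c (R i) != 0 by rewrite dotp_crossC oppr_eq0.
have c0 : c != 0.
  by apply: contra cR => /eqP ->; rewrite /dotp big1 // => k _; rewrite mxE mul0r.
have [D' DE] : zero_on (lin c) D.
  apply/(lin_dvdP charK _ c0) => v /(cross_span c0)[x [y vE]].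
  rewrite -DO projt_eval.
  have -> : v - dotp mu v *: O = x *: (Q i - dotp mu (Q i) *: O).
    rewrite vE dotpDr !dotpZr muO mulr1 scalerDl scalerBr scalerA opprD addrACA.
    by rewrite subrr addr0.
  by rewrite (meval_vecZ _ _ hD) -projt_eval DO Di mulr0.
have D'0 : D' != 0 by apply: contra D0 => /eqP e; rewrite DE e mulr0.
have hD' : D' \is N.-homog.
  have := hD; rewrite DE => /(dhomog_div (lin_neq0 c0) (dhomog_lin c)).
  by rewrite subn1.
have D'O : D' \mPo projt mu O = D'.
  by apply: (projt_comp_mulI c0); rewrite ?dotp_crossr // -DE.
have := IH D' (fun j => w j - (j == i))%N D'0 hD' D'O.
rewrite (bigD1 i) //= eqxx => h.
rewrite (bigD1 i) //= -(prednK wi) addSn ltnS -subn1.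
have -> : (\sum_(j | j != i) w j = \sum_(j | j != i) (w j - (j == i)))%N.
  by apply: eq_bigr => j /negPf ->; rewrite subn0.
apply: h => j; have := wD j; rewrite DE levM.
have [->|ji] := eqVneq j i.
  rewrite (lev_lin_root _ (dotp_crossl _ _)) -{1}(prednK wi) subn1 exprS -!mulrA.
  rewrite dvdp_mul2l ?polyX_eq0 // mul_polyC dvdpZr //.
rewrite subn0 Gauss_dvdpr //; apply: coprimep_expl.
rewrite coprimep_sym -['X]subr0 coprimep_XsubC /root lev_horner scale0r addr0 lin_eval.
by rewrite dotp_crossC oppr_eq0; apply: QQ; rewrite eq_sym.
Qed.

(* In the resultant of f and h with respect to projection from a point in general position, each
   point accounts for a linear factor of multiplicity at least its weight. *)
Lemma bezout_count d f h e (I : finType) (Q R : I -> 'rV[K]_3) (w : I -> nat) :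
  smooth_plane_curve d f -> (0 < d)%N -> h \is e.-homog -> (0 < e)%N -> ~ zero_on f h ->
  (forall i, cross (Q i) (R i) != 0) ->
  (forall i j, i != j -> cross (Q i) (Q j) != 0) ->
  (forall i, 'X^(w i) %| lev f (Q i) (R i)) ->
  (forall i, 'X^(w i) %| lev h (Q i) (R i)) -> (\sum_i w i <= d * e)%N.
Proof.
move=> sm d0 hh e_gt0 nfh QR QQ wf wh; have [f0 hf _] := sm.
have h0 : h != 0 by apply: contra_not_neq nfh => ->; apply: zero_on0.
(* Where [P] is nonzero the centre of projection is general: off both curves, off the lines
   [Q i R i] and off the lines joining two of the [Q i]. *)
pose P := f * h * (\prod_i lin (cross (Q i) (R i))
   * \prod_i \prod_(j | i != j) lin (cross (Q i) (Q j))).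
have P0 : P != 0.
  rewrite !mulf_neq0 //; apply/prodf_neq0 => i _; first exact: lin_neq0.
  by apply/prodf_neq0 => j ij; apply/lin_neq0/QQ.
have [A u] := unitmx_nonroot charK P0.
rewrite lactE; set O := e0 *m A.
rewrite !mevalM !mulf_eq0 !negb_or => /andP[/andP[fO hO] /andP[QRO QQO]].
have {}QRO i : dotp (cross (Q i) (R i)) O != 0.
  rewrite -lin_eval; move: QRO; rewrite rmorph_prod /= => /prodf_neq0; exact.
have {}QQO i j : i != j -> dotp (cross (Q i) (Q j)) O != 0.
  rewrite -lin_eval; move: QQO; rewrite rmorph_prod /= => /prodf_neq0 /(_ i isT).
  rewrite rmorph_prod /= => /prodf_neq0; exact.
have fe : (lact A f).@[e0 0] != 0 by rewrite lactE.
have he : (lact A h).@[e0 0] != 0 by rewrite lactE.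
have smA := smooth_lact charK u sm.
have hfA := dhomog_lact A hf; have hhA := dhomog_lact A hh.
have pr := form_prime_smooth charK smA.
have nfhA : ~ zero_on (lact A f) (lact A h) by rewrite zero_on_lactE.
have r0 := resultant_neq0 pr hfA hhA fe he nfhA.
have hr := resultant_homog hfA hhA fe he.
have [x [y rE]] := resultant_ideal hfA hhA d0 e_gt0 fe he.
set r := resultant _ _ in r0 hr rE.
pose D := lact (invmx A) (iota r).
pose mu : 'rV[K]_3 := (col ord0 (invmx A))^T.
have muE v : dotp mu v = (v *m invmx A) 0 ord0.
  by rewrite mxE; apply: eq_bigr => k _; rewrite !mxE mulrC.
apply: (@cone_count I Q R mu O _ QRO QQO (d * e)%N D).
- by rewrite muE /O mulmxK // /e0 /bvec mxE !eqxx.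
- by rewrite lact_eq0 ?unitmx_inv // -toX_eq0 toX_iota polyC_eq0.
- by apply: dhomog_lact; apply: dhomog_iota.
- apply: (mpoly_eq_vec charK) => v; rewrite projt_eval !lactE mulmxBl -scalemxAl.
  by rewrite /O mulmxK // muE -(xfree_iota r (v *m invmx A)).
move=> i; rewrite /D (lev_lact charK) rE levD !levM !(lev_lact charK) !(mulmxKV u).
by apply: dvdp_add; apply: dvdp_mull.
Qed.

End Bezout.

(* [monic_rel k s x a = 0] makes a / x integral: it is a root of T^(k+1) + sum_i s_i T^(k-i). *)
Definition monic_rel (T : comNzRingType) (k : nat) (s : nat -> T) (x a : T) : T :=
  a ^+ k.+1 + \sum_(i < k.+1) s i * x ^+ i.+1 * a ^+ (k - i).

Lemma monic_rel_scale (T : comNzRingType) k (s : nat -> T) (b x a : T) :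
  monic_rel k s (b * x) (b * a) = b ^+ k.+1 * monic_rel k s x a.
Proof.
rewrite /monic_rel mulrDr exprMn mulr_sumr; congr (_ + _); apply: eq_bigr => i _.
rewrite !exprMn; have -> : b ^+ k.+1 = b ^+ i.+1 * b ^+ (k - i).
  by rewrite -exprD addSn subnKC // -ltnS.
ring.
Qed.

Lemma monic_rel_morph (T T' : comNzRingType) (phi : {rmorphism T -> T'}) k s x a :
  phi (monic_rel k s x a) = monic_rel k (phi \o s) (phi x) (phi a).
Proof.
rewrite /monic_rel rmorphD rmorphXn rmorph_sum; congr (_ + _); apply: eq_bigr => i _.
by rewrite !rmorphM !rmorphXn.
Qed.

Lemma monic_rel_mulx (T : comNzRingType) k (s : nat -> T) (x y a : T) :
  monic_rel k s (x * y) a = monic_rel k (fun i => s i * y ^+ i.+1) x a.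
Proof.
rewrite /monic_rel; congr (_ + _); apply: eq_bigr => i _.
by rewrite exprMn; ring.
Qed.

(** * Orders of vanishing in one variable *)

Section PolyOrder.
Variable K : closedFieldType.
Implicit Types (p q a x : {poly K}).

Lemma dvdX_coef0 p : ('X %| p) = (p`_0 == 0).
Proof. by rewrite -['X]subr0 dvdp_XsubCl /root horner_coef0. Qed.

Lemma coprime_Xn p n : p`_0 != 0 -> coprimep 'X^n p.
Proof.
move=> p0; apply: coprimep_expl; rewrite coprimep_sym -['X]subr0 coprimep_XsubC.
by rewrite /root horner_coef0.
Qed.

(** If [a] had order al < e, the leading term of the relation would have order al (k + 1), strictly
    less than all the other terms. The relation is needed only up to order e (k + 1), as branches of
    the curve are known only up to finite order. *)
Lemma monic_rel_order k (s : nat -> {poly K}) x a e :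
  'X^e %| x -> 'X^(e * k.+1) %| monic_rel k s x a -> 'X^e %| a.
Proof.
move=> ex er; suff H al : (al <= e)%N -> 'X^al %| a by apply: H.
elim: al => [|al IH] le; first by rewrite expr0 dvd1p.
have /dvdpP[b aE] := IH (ltnW le).
suff Xb : 'X %| b by rewrite aE exprS dvdp_mul2r ?expf_neq0 ?polyX_eq0.
pose S := \sum_(i < k.+1) s i * x ^+ i.+1 * a ^+ (k - i).
have hS : 'X^((al * k.+1).+1) %| S.
  rewrite /S; elim/big_ind: _ => [|u v|i _]; [exact: dvdp0|exact: dvdp_add|].
  rewrite -mulrA dvdp_mull //.
  have h1 : 'X^(e * i.+1) %| x ^+ i.+1 by rewrite exprM dvdp_exp2r.
  have h2 : 'X^(al * (k - i)) %| a ^+ (k - i) by rewrite exprM dvdp_exp2r // IH // ltnW.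
  apply: dvdp_trans (dvdp_mul h1 h2); rewrite -exprD; apply: dvdp_exp2l.
  have ik : (i <= k)%N by rewrite -ltnS.
  have -> : (al * k.+1 = al * i.+1 + al * (k - i))%N by rewrite -mulnDr addSn subnKC.
  rewrite -addSn leq_add2r; apply: (@leq_trans (al * i.+1 + i.+1)).
    by rewrite -addn1 leq_add2l.
  by rewrite -mulSnr leq_mul2r le orbT.
have : 'X^((al * k.+1).+1) %| a ^+ k.+1.
  rewrite -(dvdp_addl _ hS); apply: dvdp_trans er; apply: dvdp_exp2l.
  by rewrite ltn_pmul2r.
rewrite aE exprMn -exprM exprS mulrC [_ * 'X^_]mulrC dvdp_mul2l ?expf_neq0 ?polyX_eq0 //.
rewrite !dvdX_coef0 -!horner_coef0 horner_exp; apply: contraLR => b0.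
by rewrite expf_neq0.
Qed.

Lemma dvdp_by_roots p q : p != 0 ->
  (forall t e, ('X - t%:P) ^+ e %| p -> ('X - t%:P) ^+ e %| q) -> p %| q.
Proof.
move=> p0; have [s pE] := closed_field_poly_normal p.
have c0 : lead_coef p != 0 by rewrite lead_coef_eq0.
rewrite pE; move: c0 {pE}; move: (lead_coef p) => c c0.
elim: s q => [|r s IH] q h; first by rewrite big_nil dvdpZl ?dvd1p.
have [q' qE] : exists q', q = ('X - r%:P) * q'.
  have : ('X - r%:P) ^+ 1 %| q.
    by apply: h; rewrite expr1 big_cons dvdpZr // dvdp_mulr.
  by rewrite expr1 => /dvdpP[q' ->]; exists q'; rewrite mulrC.
rewrite big_cons qE scalerAr dvdp_mul2l ?polyXsubC_eq0 //; apply: IH => t e te.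
have [tr|tr] := eqVneq t r.
  have := h r e.+1; rewrite big_cons qE scalerAr !exprS.
  by rewrite !dvdp_mul2l ?polyXsubC_eq0 // -tr; apply.
have := h t e; rewrite big_cons qE scalerAr => h'.
have cop : coprimep (('X - t%:P) ^+ e) ('X - r%:P).
  by apply: coprimep_expl; rewrite coprimep_XsubC /root !hornerE subr_eq0 eq_sym.
by move: h'; rewrite !Gauss_dvdpr //; apply.
Qed.

End PolyOrder.

(** * Normality of the homogeneous coordinate ring *)

Section Normality.
Variable K : closedFieldType.
Hypothesis charK : [pchar K] =i pred0.
Implicit Types (f g h a b : {mpoly K[3]}).

(** A branch to finite precision: the line through [A] and [B] corrected in the direction [N] by a
    polynomial [xi]. *)
Definition curve (A B N : 'rV[K]_3) (xi : {poly K}) : 'I_3 -> {poly K} :=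
  fun i => line A B i + xi * (N 0 i)%:P.

Lemma hensel f (A B N : 'rV[K]_3) M : f.@[A 0] = 0 -> dder f A N != 0 ->
  exists2 xi : {poly K}, 'X %| xi & 'X^(M.+1) %| mmap polyC (curve A B N xi) f.
Proof.
move=> fA fN; elim: M => [|M [xi Xxi /dvdpP[s sE]]].
  exists 0; first exact: dvdp0.
  rewrite expr1 dvdX_coef0 -horner_coef0 mmap_horner.
  rewrite (meval_eq f (_ : _ =1 A 0)) ?fA // => i.
  by rewrite /curve /line !hornerE.
(* The Newton correction: to first order it changes [f] by [e] times the derivative along [N], which
   cancels the lowest coefficient of the error. *)
pose e := 'X^(M.+1) * (- (s`_0 / dder f A N))%:P : {poly K}.
exists (xi + e).
  rewrite dvdp_add // /e exprS -mulrA dvdp_mulr //.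
have -> : mmap polyC (curve A B N (xi + e)) f =
   mmap polyC (fun i => curve A B N xi i + e * (N 0 i)%:P) f.
  rewrite /mmap; apply: eq_bigr => m _; congr (_ * _); apply: eq_bigr => i _.
  by rewrite /curve mulrDl addrA.
have [r ->] := mmap_taylor polyC (curve A B N xi) (fun i => (N 0 i)%:P) e f.
set G := \sum_i _; have G0 : G`_0 = dder f A N.
  rewrite coef_sum; apply: eq_bigr => i _; rewrite -horner_coef0 hornerM hornerC.
  rewrite mmap_horner; congr (_ * _); apply: meval_eq => j.
  rewrite /curve /line !hornerE horner_coef0.
  by move: Xxi; rewrite dvdX_coef0 => /eqP ->; rewrite mul0r addr0.
rewrite sE; have -> : s * 'X^(M.+1) + e * G + e ^+ 2 * r = 'X^(M.+1) *
    (s + (- (s`_0 / dder f A N))%:P * G + (- (s`_0 / dder f A N))%:P * e * r).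
  by rewrite /e; ring.
rewrite [in X in X %| _]exprSr dvdp_mul2l ?expf_neq0 ?polyX_eq0 // dvdX_coef0.
rewrite !coefD -mulrA !coefCM G0 /e -!mulrA exprS -!mulrA coefXM eqxx mulr0 addr0.
by rewrite mulNr divfK // subrr.
Qed.

Lemma zero_on_lin_false d f (c : 'rV[K]_3) : (1 < d)%N -> f \is d.-homog -> c != 0 ->
  ~ zero_on f (lin c).
Proof.
move=> d1 hf c0 /(zero_on_lt hf (dhomog_lin c) d1)/eqP.
by rewrite (negPf (lin_neq0 c0)).
Qed.

Lemma zero_on_prod_lin d f (s : seq 'rV[K]_3) : (1 < d)%N -> f \is d.-homog ->
  form_prime f -> (forall c, c \in s -> c != 0) -> ~ zero_on f (\prod_(c <- s) lin c).
Proof.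
move=> d1 hf pr; elim: s => [|c s IH] hs.
  rewrite big_nil => /(zero_on_lt hf (dhomog1 _ _) (ltnW d1))/eqP.
  by rewrite oner_eq0.
rewrite big_cons => /(pr _ _ _ (dhomog_lin c))[].
  by apply: (zero_on_lin_false d1 hf); apply: hs; rewrite mem_head.
by apply: IH => x xs; apply: hs; rewrite inE xs orbT.
Qed.

Lemma line_nonroot d f (c : 'rV[K]_3) : (1 < d)%N -> smooth_plane_curve d f -> c != 0 ->
  exists2 B, dotp c B = 0 & f.@[B 0] != 0.
Proof.
move=> d1 sm c0; apply: contrapT => h; have [f0 hf _] := sm.
have [g fE] : zero_on (lin c) f.
  apply/(lin_dvdP charK _ c0) => v cv; apply: contrapT => /eqP fv; apply: h.
  by exists v.
have g0 : g != 0 by apply: contra f0 => /eqP e; rewrite fE e mulr0.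
have hg : g \is (d - 1).-homog.
  by have := hf; rewrite {1}fE => /(dhomog_div (lin_neq0 c0) (dhomog_lin c)).
have fcg : zero_on f (lin c * g) by exists 1; rewrite mulr1 -fE.
have pr := form_prime_smooth charK sm.
case: (pr _ _ _ (dhomog_lin c) fcg); first exact: (zero_on_lin_false d1 hf).
move/(zero_on_lt hf hg); rewrite ltn_subrL (ltnW d1) /= => /(_ isT) /eqP.
by rewrite (negPf g0).
Qed.

Lemma dotpC (x y : 'rV[K]_3) : dotp x y = dotp y x.
Proof. by apply: eq_bigr => i _; rewrite mulrC. Qed.

Lemma dotp0 (x : 'rV[K]_3) : dotp x 0 = 0.
Proof. by rewrite /dotp big1 // => i _; rewrite mxE mulr0. Qed.

(** With w . B = 1 the witness is w x c, and (w x c) x B = (w . B) c - (c . B) w = c. *)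
Lemma kernel_vector (c B : 'rV[K]_3) : dotp c B = 0 -> B != 0 ->
  exists2 A, dotp c A = 0 & cross A B = c.
Proof.
move=> cB /dotp_surj[w]; rewrite dotpC => wB; exists (cross w c).
  by rewrite dotpC dotp_crossr.
apply/rowP => i.
have -> : c 0 i = dotp w B * c 0 i - dotp c B * w 0 i by rewrite wB cB mul1r mul0r subr0.
rewrite !dotp3; case: (crossE (cross w c) B) => h0 h1 h2.
by move: i; apply: ord3_ind; rewrite ?(h0, h1, h2); case: (crossE w c) => k0 k1 k2; rewrite ?(k0, k1, k2); ring.
Qed.

Lemma lev_shift p (A B : 'rV[K]_3) t :
  lev p (A + t *: B) B = lev p A B \Po ('X + t%:P).
Proof.
apply: (poly_eq_horner charK) => x; rewrite horner_comp !lev_horner !hornerE.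
by rewrite -addrA -scalerDl [t + x]addrC.
Qed.

Lemma dvdp_shift (p : {poly K}) t e :
  (('X - t%:P) ^+ e %| p) = ('X^e %| p \Po ('X + t%:P)).
Proof.
have E q : ('X - t%:P) ^+ e * q \Po ('X + t%:P) = 'X^e * (q \Po ('X + t%:P)).
  by rewrite comp_polyM rmorphXn /= comp_polyB comp_polyX comp_polyC addrK.
have K1 q : (q \Po ('X + t%:P)) \Po ('X - t%:P) = q.
  by rewrite -comp_polyA comp_polyD comp_polyX comp_polyC subrK comp_polyXr.
apply/dvdpP/dvdpP => [[q ->]|[q qE]].
  by exists (q \Po ('X + t%:P)); rewrite mulrC E mulrC.
exists (q \Po ('X - t%:P)).
by rewrite -(K1 p) qE comp_polyM rmorphXn /= comp_polyX.
Qed.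

(* On a branch of the curve parametrized by Hensel's lemma, integrality compares orders of
   vanishing. *)
Lemma normality_point d f (c A B : 'rV[K]_3) a k s t e :
  smooth_plane_curve d f -> cross A B = c -> c != 0 -> dotp c A = 0 -> dotp c B = 0 ->
  zero_on f (monic_rel k s (lin c) a) ->
  'X^e %| lev f (A + t *: B) B -> 'X^e %| lev a (A + t *: B) B.
Proof.
move=> sm AB c0 cA cB [U UE]; set q := A + t *: B => fe; have [_ hf _] := sm.
have [->|e_gt0] := posnP e; first by rewrite expr0 dvd1p.
have cq : dotp c q = 0 by rewrite dotpDr dotpZr cA cB mulr0 addr0.
have fq : f.@[q 0] = 0.
  have := dvdp_trans (dvdp_exp2l 'X e_gt0) fe; rewrite expr1 dvdX_coef0 lev_coef0.
  by move/eqP.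
have aq : a.@[q 0] = 0.
  have := congr1 (meval (q 0)) UE; rewrite rmorphM /= fq mul0r monic_rel_morph /=.
  rewrite lin_eval cq /monic_rel big1 ?addr0 => [/eqP|i _]; last by rewrite exprS mul0r mulr0 mul0r.
  by rewrite expf_eq0 /= => /eqP.
have [e1|e2] := leqP e 1.
  have -> : e = 1%N by apply/eqP; rewrite eqn_leq e1.
  by rewrite expr1 dvdX_coef0 lev_coef0 aq.
have qB : cross q B = c.
  rewrite -AB; apply/rowP => i; case: (crossE q B) (crossE A B) => e3 e4 e5 [e6 e7 e8].
  move: i; apply: ord3_ind; rewrite ?(e3, e4, e5, e6, e7, e8) !mxE; ring.
have q0 : q != 0.
  apply: contra c0 => /eqP q0; rewrite -qB q0; apply/eqP/rowP => i; rewrite !mxE.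
  by rewrite !mul0r subr0.
have fB : dder f q B = 0.
  have := dvdp_trans (dvdp_exp2l 'X e2) fe => /dvdpP[u uE].
  by rewrite -lev_coef1 uE expr2 mulrA !coefMX.
have [N cN] := dotp_surj c0.
(* From contact 2 on, the line is the tangent at [q], so by smoothness a direction leaving the line
   is transversal to the curve. *)
have fN : dder f q N != 0.
  have [w fw] := smooth_dder sm q0 fq.
  have [x [y wE]] : exists x y : K, w - dotp c w *: N = x *: q + y *: B.
    by apply: cross_span; rewrite qB // dotpDr dotpNr dotpZr cN mulr1 subrr.
  apply: contra fw => /eqP fN; rewrite -(subrK (dotp c w *: N) w) wE !dderD !dderZ.
  by rewrite fN fB (dder_self _ hf) fq !mulr0 !addr0.
(* This precision covers both order e, used to compare with the line, and order e (k + 1), used in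
   the integral relation. *)
have [xi Xxi fxi] := hensel B (e * k.+1 + e) fq fN.
have g_taylor p : exists r, mmap polyC (curve q B N xi) p =
    lev p q B + xi * (\sum_i (N 0 i)%:P * lev p^`M(i) q B + xi * r).
  have [r ->] := mmap_taylor polyC (line q B) (fun i => (N 0 i)%:P) xi p.
  exists r; rewrite levE mulrDr -addrA expr2 -mulrA; congr (_ + (_ * _ + _)).
  by apply: eq_bigr => i _; rewrite levE.
(* Since [f] vanishes to order e along the line, the branch agrees with the line to that order. *)
have exi : 'X^e %| xi.
  have [r rE] := g_taylor f; move: fxi; rewrite rE => fxi.
  have : 'X^e %| xi * (\sum_i (N 0 i)%:P * lev f^`M(i) q B + xi * r).
    rewrite -(dvdp_addr _ fe); apply: dvdp_trans fxi; apply: dvdp_exp2l.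
    by rewrite leqW // leq_addl.
  rewrite Gauss_dvdpl //; apply: coprime_Xn; rewrite coefD coefM big_ord1 subnn.
  have -> : xi`_0 = 0 by apply/eqP; rewrite -dvdX_coef0.
  rewrite mul0r addr0 coef_sum; apply: contra fN => /eqP E; apply/eqP.
  by rewrite -E /dder; apply: eq_bigr => i _; rewrite coefCM lev_coef0.
(* Along the branch the form [lin c] is [xi] itself, so the relation bounds the order of [a] from
   below. *)
have linE : mmap polyC (curve q B N xi) (lin c) = xi.
  rewrite /lin rmorph_sum /=.
  have -> : \sum_i mmap polyC (curve q B N xi) (c 0 i *: 'X_i) =
     (dotp c q)%:P + 'X * (dotp c B)%:P + xi * (dotp c N)%:P.
    rewrite /dotp !rmorph_sum !mulr_sumr -!big_split; apply: eq_bigr => i _.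
    by rewrite /= mmapZ mmapX mmap1U /curve /line !rmorphM /=; ring.
  by rewrite cq cB cN mulr0 !add0r mulr1.
have ega : 'X^e %| mmap polyC (curve q B N xi) a.
  apply: (monic_rel_order (k := k) (s := mmap polyC (curve q B N xi) \o s) exi).
  rewrite -{2}linE -monic_rel_morph UE rmorphM /= dvdp_mulr //.
  by apply: dvdp_trans fxi; apply: dvdp_exp2l; rewrite leqW // leq_addr.
have [r rE] := g_taylor a; move: ega; rewrite rE dvdp_addl //.
exact: dvdp_mulr.
Qed.

End Normality.

Section NormalityGlobal.
Variable K : closedFieldType.
Hypothesis charK : [pchar K] =i pred0.
Implicit Types (f g h a b : {mpoly K[3]}).

Lemma size_lev p N (A B : 'rV[K]_3) : p \is N.-homog -> p.@[B 0] != 0 ->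
  size (lev p A B) = N.+1.
Proof.
move=> hp pB; have [sp cp] := size_coef_lev A B hp.
apply/eqP; rewrite eqn_leq sp ltnNge; apply: contra pB => /leq_sizeP/(_ N (leqnn N)).
by rewrite cp => ->.
Qed.

Lemma lev_eq0_dvd p N (A B : 'rV[K]_3) : p \is N.-homog -> cross A B != 0 ->
  lev p A B = 0 -> zero_on (lin (cross A B)) p.
Proof.
move=> hp AB p0; apply/(lin_dvdP charK _ AB) => v /(cross_span AB)[x [y ->]].
have [->|x0] := eqVneq x 0.
  rewrite scale0r add0r (meval_vecZ _ _ hp).
  by have [_ <-] := size_coef_lev A B hp; rewrite p0 coef0 mulr0.
have -> : x *: A + y *: B = x *: (A + (y / x) *: B).
  by rewrite scalerDr scalerA mulrC divfK.
by rewrite (meval_vecZ _ _ hp) -lev_horner p0 horner0 mulr0.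
Qed.

(** In the basis dual to [A], [B] of the line, the forms [la] and [lb] restrict to 1 and X, so any
    polynomial of degree at most n is the restriction of a form of degree n. *)
Lemma lev_surj n (A B : 'rV[K]_3) (P : {poly K}) : cross A B != 0 ->
  (size P <= n.+1)%N -> exists2 b, b \is n.-homog & lev b A B = P.
Proof.
move=> /dotp_surj[N AN] sP.
pose la := lin (cross B N); pose lb := lin (cross N A).
exists (\sum_(i < n.+1) P`_i *: (la ^+ (n - i) * lb ^+ i)).
  apply: rpred_sum => i _; rewrite rpredZ //.
  have := dhomogM (dhomogMn (n - i) (dhomog_lin (cross B N)))
    (dhomogMn i (dhomog_lin (cross N A))).
  by rewrite !mul1n subnK // -ltnS.
have laE : lev la A B = 1.
  rewrite lev_lin dotp_crossl mulr0 addr0; suff -> : dotp (cross B N) A = 1 by [].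
  rewrite -AN !dotp3; case: (crossE B N) => -> -> ->; case: (crossE A B) => -> -> ->.
  by ring.
have lbE : lev lb A B = 'X.
  rewrite lev_lin dotp_crossr add0r; suff -> : dotp (cross N A) B = 1 by rewrite mulr1.
  rewrite -AN !dotp3; case: (crossE N A) => -> -> ->; case: (crossE A B) => -> -> ->.
  by ring.
rewrite /lev rmorph_sum -[RHS](coefK P) poly_def.
rewrite (big_ord_widen n.+1 (fun i => P`_i *: 'X^i) sP) [RHS]big_mkcond /=.
apply: eq_bigr => i _; rewrite -mul_mpolyC !rmorphM !rmorphXn -![levr _ _ _]/(lev _ _ _) laE lbE.
rewrite expr1n mul1r levE mmapC mul_polyC; case: ifP => // /negbT; rewrite -leqNgt.
by move/leq_sizeP/(_ i (leqnn i)) => ->; rewrite scale0r.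
Qed.

(** On the line c = 0 the restriction of [f] divides that of [a], by comparing orders at each root.
    Subtracting a suitable multiple of [f] from [a] makes it vanish on the line, hence divisible by
    [lin c]. *)
Lemma normality_line d f (c : 'rV[K]_3) a N k s : (1 < d)%N -> smooth_plane_curve d f ->
  c != 0 -> a \is N.-homog -> zero_on f (monic_rel k s (lin c) a) ->
  exists2 a', a' \is (N - 1).-homog & zero_on f (a - lin c * a').
Proof.
move=> d1 sm c0 ha rel; have [f0 hf _] := sm.
have [B cB fB] := line_nonroot charK d1 sm c0.
have B0 : B != 0.
  by apply: contra fB => /eqP ->; rewrite (meval_vec0 hf) // ltnW.
have [A cA AB] := kernel_vector cB B0.
have sf := size_lev A hf fB.
have fl0 : lev f A B != 0 by rewrite -size_poly_eq0 sf.
have /dvdpP[P PE] : lev f A B %| lev a A B.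
  apply: dvdp_by_roots => // t e; rewrite !dvdp_shift -!(lev_shift charK).
  exact: (normality_point sm AB c0 cA cB rel).
have AB0 : cross A B != 0 by rewrite AB.
suff [b hb ab] : exists2 b, f * b \is N.-homog & lev (a - f * b) A B = 0.
  have hab : a - f * b \is N.-homog by apply: rpredB.
  have [a' aE] := lev_eq0_dvd hab AB0 ab; rewrite AB in aE.
  exists a'; first by apply: (dhomog_div (lin_neq0 c0) (dhomog_lin c)); rewrite -aE.
  by exists b; rewrite -aE opprB addrCA subrr addr0.
have [P0|P0] := eqVneq P 0.
  by exists 0; rewrite mulr0 ?rpred0 // subr0 PE P0 mul0r.
have sa := size_mul P0 fl0; rewrite -PE sf in sa.
have sP : (size P <= (N - d).+1)%N /\ (d <= N)%N.
  have [sN _] := size_coef_lev A B ha; rewrite sa in sN.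
  have : (0 < size P)%N by rewrite size_poly_gt0.
  by move: sN; move: (size P) => m; clear; lia.
have [b hb bE] := lev_surj AB0 (proj1 sP).
exists b; first by rewrite -(subnKC (proj2 sP)); apply: dhomogM.
by rewrite levB levM bE PE mulrC subrr.
Qed.

Lemma zero_on_refl f a : zero_on f (a - a).
Proof. by rewrite subrr; apply: zero_on0. Qed.

Lemma zero_on_monic_rel f k s x x' a a' :
  zero_on f (x - x') -> zero_on f (a - a') ->
  zero_on f (monic_rel k s x a - monic_rel k s x' a').
Proof.
move=> hx ha; rewrite /monic_rel opprD addrACA; apply: zero_onD.
  exact: zero_on_congX.
rewrite -sumrB; apply: zero_on_sum => i _.
apply: zero_on_congM; last exact: zero_on_congX.
by apply: zero_on_congM; [rewrite subrr; apply: zero_on0|apply: zero_on_congX].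
Qed.

(** Once a line is divided out, [monic_rel_scale] leaves [lin c ^+ k.+1] times the relation for the
    remaining product, and primality of [f] removes that power. *)
Lemma normality_lines d f (ls : seq 'rV[K]_3) k s : (1 < d)%N -> smooth_plane_curve d f ->
  (forall c, c \in ls -> c != 0) -> forall a N, a \is N.-homog ->
  zero_on f (monic_rel k s (\prod_(c <- ls) lin c) a) ->
  exists Q, zero_on f (a - \prod_(c <- ls) lin c * Q).
Proof.
move=> d1 sm; have [_ hf _] := sm; have pr := form_prime_smooth charK sm.
elim: ls s => [|c ls IH] s hs a N ha.
  by move=> _; exists a; rewrite big_nil mul1r subrr; apply: zero_on0.
have c0 : c != 0 by apply: hs; rewrite mem_head.
rewrite big_cons; set P := \prod_(j <- ls) lin j => rel.
have relE : monic_rel k s (lin c * P) a = monic_rel k (fun i => s i * P ^+ i.+1) (lin c) a.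
  exact: monic_rel_mulx.
have [a' ha' aa'] : exists2 a', a' \is (N - 1).-homog & zero_on f (a - lin c * a').
  by apply: (normality_line d1 sm c0 ha (k := k) (s := fun i => s i * P ^+ i.+1)); rewrite -relE.
have rel' : zero_on f (lin c ^+ k.+1 * monic_rel k s P a').
  have cong := zero_on_monic_rel k s (zero_on_refl f (lin c * P)) aa'.
  by rewrite -monic_rel_scale; apply: (proj1 (zero_on_subr cong) rel).
have hck : lin c ^+ k.+1 \is (1 * k.+1).-homog by apply: dhomogMn; apply: dhomog_lin.
have ncX j : ~ zero_on f (lin c ^+ j).
  have := zero_on_prod_lin d1 hf pr (s := nseq j c).
  rewrite big_nseq -Monoid.iteropE => h; apply: h => x /nseqP[-> _]; exact: c0.
have hs' (x : 'rV[K]_3) : x \in ls -> x != 0.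
  by move=> xs; apply: hs; rewrite inE xs orbT.
have [fc|rel2] := pr _ _ _ hck rel'; first by case: (ncX _ fc).
have [Q a'Q] := IH s hs' a' _ ha' rel2.
exists Q; have -> : a - lin c * P * Q = (a - lin c * a') + lin c * (a' - P * Q).
  by rewrite mulrBr addrA subrK mulrA.
exact: zero_onD aa' (zero_onMl _ a'Q).
Qed.

(** A quotient W / h integral on the curve is a form. Some multiple [b * h] is a product of lines
    modulo [f], that product divides [b * W] modulo [f], and [b] cancels by primality. *)
Lemma normality d f h e W t k s : (1 < d)%N -> smooth_plane_curve d f ->
  h \is e.-homog -> ~ zero_on f h -> W \is (e + t).-homog ->
  zero_on f (monic_rel k s h W) ->
  exists2 Q, Q \is t.-homog & zero_on f (W - h * Q).
Proof.
move=> d1 sm hh nfh hW rel; have [_ hf _] := sm; have pr := form_prime_smooth charK sm.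
have [b0 [ls [hls hb0]]] := split_multiple charK sm (ltnW d1) hh nfh.
have [b [n [hb bE]]] : exists b n, b \is n.-homog /\
    zero_on f (b * h - \prod_(c <- ls) lin c).
  have hpr : \prod_(c <- ls) lin c \is (size ls).-homog.
    elim: (ls) => [|c s2 IH]; first by rewrite big_nil dhomog1.
    by rewrite big_cons -[size _]add1n; apply: dhomogM => //; apply: dhomog_lin.
  have := hb0 => -[U /(congr1 (pihomog mdeg (size ls)))].
  rewrite raddfB /= (pihomog_dE hpr).
  have fU : zero_on f (pihomog mdeg (size ls) (f * U)).
    have [le|lt] := leqP d (size ls); last by rewrite (pihomogM_lt _ hf lt); apply: zero_on0.
    by rewrite -(subnKC le) (pihomogMl _ _ hf); eexists.
  have [le|lt] := leqP e (size ls).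
    rewrite -{1}(subnKC le) mulrC (pihomogMl _ _ hh) mulrC => E.
    exists (pihomog mdeg (size ls - e) b0), (size ls - e)%N; split; first exact: pihomogP.
    by rewrite E.
  rewrite mulrC (pihomogM_lt _ hh lt) => E; exists 0, 0%N; rewrite rpred0 mul0r E; split=> //.
set P := \prod_(c <- ls) lin c in bE.
have relb : zero_on f (monic_rel k s P (b * W)).
  have : zero_on f (monic_rel k s (b * h) (b * W)).
    rewrite monic_rel_scale; exact: zero_onMl rel.
  have cong := zero_on_monic_rel k s bE (zero_on_refl f (b * W)).
  exact: (proj1 (zero_on_subr cong)).
have [Q bQ] := normality_lines d1 sm hls (dhomogM hb hW) relb.
have nfb : ~ zero_on f b.
  move=> fb; apply: (zero_on_prod_lin d1 hf pr hls).
  by apply/(zero_on_subr bE); apply: zero_onMr.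
have : zero_on f (b * (W - h * Q)).
  rewrite mulrBr mulrA.
  have -> : b * W - b * h * Q = (b * W - P * Q) - (b * h - P) * Q by rewrite mulrBl opprB addrA subrK.
  exact: zero_onB bQ (zero_onMr _ bE).
move=> fbW; have [fb|[U UE]] := pr _ _ _ hb fbW; first by case: (nfb fb).
exists (pihomog mdeg t Q); first exact: pihomogP.
have -> : W - h * pihomog mdeg t Q = pihomog mdeg (e + t) (W - h * Q).
  by rewrite raddfB /= (pihomog_dE hW) (pihomogMl _ _ hh).
rewrite UE; have [le|lt] := leqP d (e + t); last by rewrite (pihomogM_lt _ hf lt); apply: zero_on0.
by rewrite -(subnKC le) (pihomogMl _ _ hf); eexists.
Qed.

End NormalityGlobal.

(** * Rational self-maps over the projection from a point of the curve *)

Lemma chart_rel_top (T : comNzRingType) (Y u w : T) k :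
  Y ^+ k * (u * Y * w ^+ k.+1) = u * (Y * w) ^+ k.+1.
Proof. by rewrite exprMn [Y ^+ k.+1]exprS; ring. Qed.

Lemma chart_rel_term (T : comNzRingType) (Y u w g : T) i j :
  Y ^+ i * Y ^+ j * (u ^+ i.+2 * g * w ^+ j) =
  u * (g * Y ^+ i * u ^+ i.+1 * (Y * w) ^+ j).
Proof. by rewrite exprMn [u ^+ i.+2]exprS; ring. Qed.

Lemma conic_rel_r (T : idomainType) (Z y b r : T) k : y != 0 -> b = Z * y ->
  y * r = b ^+ k.+1 -> r = Z ^+ k.+1 * y ^+ k.
Proof.
move=> y0 bE E; apply: (mulfI y0); rewrite E bE exprMn [y ^+ k.+1]exprS; ring.
Qed.

Lemma conic_rel_k (T : idomainType) (Z y b c g r : T) k : Z != 0 -> y != 0 -> b = Z * y ->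
  y * r = b ^+ k.+1 -> b ^+ k * c *+ k.+1 + g * b ^+ k = g * r -> c *+ k.+1 + g = Z * g.
Proof.
move=> Z0 y0 bE yr E; have b0 : b != 0 by rewrite bE mulf_neq0.
apply: (mulfI (expf_neq0 k b0)); apply: (mulfI y0).
have -> : b ^+ k * (c *+ k.+1 + g) = b ^+ k * c *+ k.+1 + g * b ^+ k.
  by rewrite mulrDr mulrnAr [g * _]mulrC.
by rewrite E mulrCA yr exprS bE; ring.
Qed.

Lemma conic_rel_k1 (T : idomainType) (Z y b c g g1 r : T) k n m :
  Z != 0 -> y != 0 -> b = Z * y -> y * r = b ^+ k.+2 ->
  b ^+ k * c ^+ 2 *+ n + (g * (b ^+ k * c *+ m) + g1 * y * b ^+ k) = g1 * r ->
  c ^+ 2 *+ n + g * (c *+ m) + g1 * y = Z ^+ 2 * (y * g1).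
Proof.
move=> Z0 y0 bE yr E; have b0 : b != 0 by rewrite bE mulf_neq0.
apply: (mulfI (expf_neq0 k b0)); apply: (mulfI y0).
have -> : b ^+ k * (c ^+ 2 *+ n + g * (c *+ m) + g1 * y) =
   b ^+ k * c ^+ 2 *+ n + (g * (b ^+ k * c *+ m) + g1 * y * b ^+ k).
  by rewrite !mulrDr mulrnAr [b ^+ k * (g * _)]mulrCA [b ^+ k * (c *+ m)]mulrnAr
     [b ^+ k * (g1 * y)]mulrC addrA.
by rewrite E mulrCA yr !exprS bE; ring.
Qed.

Lemma conic_double (F : comNzRingType) (x : F) n m :
  x ^+ 2 *+ n + - x * (x *+ m) = 0 -> x * (x * (n * 2)%:R - x * (2 * m)%:R) = 0.
Proof.
move=> E; rewrite -(mulr0 (2%:R : F)) -E -[_ *+ n]mulr_natr -[x *+ m]mulr_natr !natrM.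
by move: (n%:R : F) (m%:R : F) => a b; ring.
Qed.

Lemma conic_sum_k (T : comNzRingType) k (s : nat -> T) (b c : T) :
  \sum_(j < k.+1) s j * (b ^+ k * c ^+ (k - j - k) *+ 'C(k - j, k)) = s 0 * b ^+ k.
Proof.
rewrite big_ord_recl big1 => [|j _]; last first.
  by rewrite bin_small ?mulr0n ?mulr0 //= /bump /=; have := ltn_ord j; lia.
by rewrite /= subn0 subnn expr0 mulr1 binn mulr1n addr0.
Qed.

Lemma conic_sum_k1 (T : comNzRingType) k (s : nat -> T) (b c : T) :
  \sum_(j < k.+2) s j * (b ^+ k * c ^+ (k.+1 - j - k) *+ 'C(k.+1 - j, k)) =
  s 0 * (b ^+ k * c *+ k.+1) + s 1 * b ^+ k.
Proof.
rewrite !big_ord_recl big1 => [|j _]; last first.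
  by rewrite bin_small ?mulr0n ?mulr0 //= /bump /=; have := ltn_ord j; lia.
rewrite /= /bump /= addr0 subn0 subSnn expr1 binSn add1n subn1 /= subnn expr0 mulr1 binn.
by rewrite mulr1n.
Qed.

Section CenterChart.
Variable K : closedFieldType.
Hypothesis charK : [pchar K] =i pred0.
Implicit Types (f g h : {mpoly K[3]}).

Local Notation i1 := (lift (ord0 : 'I_2) (ord0 : 'I_1) : 'I_2).

Lemma poly_size3 (R : nzRingType) (p : {poly R}) :
  (size p <= 3)%N -> p`_2 = 0 -> p = (p`_1)%:P * 'X + (p`_0)%:P.
Proof.
move=> sp p2; apply/polyP => i; rewrite coefD coefMX !coefC.
case: i => [|[|[|i]]] /=; rewrite ?add0r ?addr0 //.
by apply: nth_default; apply: leq_trans sp _.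
Qed.

Lemma leq_pred_add a b m n : (a <= m.+1 -> b <= n.+1 -> (a + b).-1 <= (m + n).+1)%N.
Proof. lia. Qed.

Lemma iota_comp (m : nat) a (H : 3.-tuple {mpoly K[m]}) :
  (iota a) \mPo H = mmap (@mpolyC m K) (fun j => tnth H (lift ord0 j)) a.
Proof.
apply: (rmorph_mpoly_ext (phi := comp_mpoly H \o iota)
  (psi := mmap (@mpolyC m K) (fun j => tnth H (lift ord0 j)))) => [c|j] /=.
  by rewrite iotaC comp_mpolyC mmapC.
by rewrite iotaX mmapX mmap1U comp_mpolyXU (tnth_nth 0).
Qed.

Lemma iota_scaled a N (H : 3.-tuple {mpoly K[3]}) u : a \is N.-homog ->
  (forall j : 'I_2, tnth H (lift ord0 j) = u * 'X_(lift ord0 j)) ->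
  (iota a) \mPo H = u ^+ N * iota a.
Proof.
move=> ha hH; rewrite iota_comp -[iota a]comp_mpoly_id iota_comp.
rewrite -(mmap_dhomog _ _ _ ha) /mmap; apply: eq_bigr => m _; congr (_ * _).
by apply: eq_bigr => j _; rewrite hH tnth_mktuple.
Qed.

Lemma fromX_sum (P : {poly {mpoly K[2]}}) n : (size P <= n)%N ->
  fromX P = \sum_(i < n) iota P`_i * 'X_ord0 ^+ i.
Proof.
move=> sP; rewrite -{1}[P]coefK poly_def (big_ord_widen n (fun i => P`_i *: 'X^i) sP).
rewrite big_mkcond rmorph_sum; apply: eq_bigr => i _; case: ifP => [_|/negbT].
  by rewrite -mul_polyC rmorphM rmorphXn /= fromX_C fromX_X.
by rewrite -leqNgt => /leq_sizeP/(_ i (leqnn i)) ->; rewrite !rmorph0 mul0r.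
Qed.

Lemma comp_scaled f d n (H : 3.-tuple {mpoly K[3]}) u : f \is d.-homog ->
  (size (toX f) <= n)%N ->
  (forall j : 'I_2, tnth H (lift ord0 j) = u * 'X_(lift ord0 j)) ->
  f \mPo H = \sum_(i < n) u ^+ (d - i) * iota (toX f)`_i * tnth H ord0 ^+ i.
Proof.
move=> hf sf hH; rewrite -{1}[f]toXK (fromX_sum sf) rmorph_sum; apply: eq_bigr => i _.
rewrite rmorphM rmorphXn /= comp_mpolyXU -(tnth_nth 0).
by rewrite (iota_scaled (proj2 (toX_homog hf) i) hH).
Qed.

Local Notation y := ('X_ord0 : {mpoly K[2]}).
Local Notation pi2 := (meval (fun j : 'I_2 => (j != ord0)%:R) : {mpoly K[2]} -> K).

Lemma homog2_factor (c : {mpoly K[2]}) N : c \is N.-homog -> pi2 c = 0 ->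
  exists mu, c = y * mu.
Proof.
move=> hc c0; pose cv : 'rV[K]_3 := delta_mx 0 o1.
have [q qE] : zero_on (lin cv) (iota c).
  apply/(lin_dvdP charK); first exact: delta_neq0.
  move=> v; rewrite dotpC dotp_delta => v1; rewrite iota_eval.
  have := mmap_dhomog idfun (fun j : 'I_2 => (j != ord0)%:R : K) (v 0 o2) hc.
  rewrite [mmap _ _ _ in RHS]c0 mulr0 => <-; apply: meval_eq => j.
  case: (unliftP ord0 j) => [k|] ->; last by rewrite v1 eqxx mulr0.
  by rewrite ord1 mulr1.
pose H : 3.-tuple {mpoly K[2]} := [tuple if unlift ord0 i is Some j then 'X_j else 0 | i < 3].
have iK a : (iota a) \mPo H = a.
  apply: (rmorph_mpoly_ext (phi := comp_mpoly H \o iota) (psi := idfun)) => [x|j] /=.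
    by rewrite iotaC comp_mpolyC.
  by rewrite iotaX comp_mpolyXU -(tnth_nth 0) tnth_mktuple liftK.
exists (q \mPo H); rewrite -[c]iK qE lin_delta rmorphM /= comp_mpolyXU -(tnth_nth 0).
by rewrite tnth_mktuple liftK.
Qed.

Lemma coef_lin_exp (R : comNzRingType) (b c : R) n m :
  ((b%:P * 'X + c%:P) ^+ n)`_m = (b ^+ m * c ^+ (n - m)) *+ 'C(n, m).
Proof.
rewrite addrC exprDn coef_sum.
have [le|lt] := leqP m n; last first.
  rewrite bin_small // mulr0n big1 // => i _; rewrite coefMn exprMn -!rmorphXn /= mulrA.
  rewrite -polyCM coefMXn coefC; case: ifP => _; first by rewrite mul0rn.
  by case: eqP => // e; [have := ltn_ord i; lia|rewrite mul0rn].
rewrite (bigD1 (inord m)) //= inordK ?ltnS // big1 ?addr0 => [|i im].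
  rewrite coefMn exprMn -!rmorphXn /= mulrA -polyCM coefMXn ltnn subnn coefC eqxx.
  by rewrite mulrC.
rewrite coefMn exprMn -!rmorphXn /= mulrA -polyCM coefMXn coefC.
case: ltnP => [_|h]; first by rewrite mul0rn.
case: eqP => [e|_]; last by rewrite mul0rn.
case/negP: im; apply/eqP/val_inj; rewrite /= inordK ?ltnS //; lia.
Qed.

(* The point is [e0] and its tangent line is y = 0, so f has degree d - 1 in the first variable, with
   leading coefficient y. *)
Section Chart.
Variables (d : nat) (f : {mpoly K[3]}).
Hypotheses (d4 : (3 < d)%N) (sm : smooth_plane_curve d f).
Hypotheses (sizef : (size (toX f) <= d)%N) (leadf : (toX f)`_d.-1 = y).

Let G i := (toX f)`_i.
Let k := d.-2.
Let dk : d = k.+2. Proof. by rewrite /k; case: (d) d4 => [|[|n]]. Qed.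
Let k2 : (1 < k)%N. Proof. by rewrite /k; move: d4; lia. Qed.
Let hf : f \is d.-homog. Proof. by case: sm. Qed.
Let Gh i : G i \is (d - i).-homog. Proof. by case: (toX_homog hf). Qed.
Let Gtop : G k.+1 = y. Proof. by rewrite /G -leadf dk. Qed.
Let pr : form_prime f. Proof. exact: form_prime_smooth sm. Qed.

(** The product y^k f is monic of degree k + 1 in y X_0, and these are its lower coefficients, with
    k = d - 2. *)
Let sG (i : nat) : {mpoly K[2]} := G (k - i) * y ^+ i.

(** Shows that y w / u is integral as soon as the map (w : u X_1 : u X_2), which commutes with the
    projection from [e0], lands in the curve. *)
Lemma chart_rel (u w : {mpoly K[3]}) (H : 3.-tuple {mpoly K[3]}) :
  (forall j : 'I_2, tnth H (lift ord0 j) = u * 'X_(lift ord0 j)) ->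
  tnth H ord0 = w ->
  'X_o1 ^+ k * (f \mPo H) = u * monic_rel k (iota \o sG) u ('X_o1 * w).
Proof.
move=> hH h0; have s2 : (size (toX f) <= k.+2)%N by rewrite -dk.
rewrite (comp_scaled hf s2 hH) h0.
rewrite big_ord_recr /= -/(G _) Gtop iotaX.
have -> : (d - k.+1 = 1)%N by rewrite dk; lia.
rewrite /monic_rel !mulrDr addrC expr1; congr (_ + _).
  exact: chart_rel_top.
rewrite mulr_sumr mulr_sumr (reindex_inj rev_ord_inj); apply: eq_bigr => i _ /=.
rewrite subSS -/(G _) /sG rmorphM rmorphXn /= iotaX.
have ik : (i <= k)%N by rewrite -ltnS.
have -> : (d - (k - i) = i.+2)%N by rewrite dk; lia.
have -> : 'X_o1 ^+ k = 'X_o1 ^+ i * 'X_o1 ^+ (k - i) :> {mpoly K[3]}.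
  by rewrite -exprD subnKC.
exact: chart_rel_term.
Qed.

Lemma monic_rel_one_coef (b c : {mpoly K[2]}) m :
  (monic_rel k (fun j => (sG j)%:P) 1 (b%:P * 'X + c%:P))`_m =
  b ^+ m * c ^+ (k.+1 - m) *+ 'C(k.+1, m) +
  \sum_(j < k.+1) sG j * (b ^+ m * c ^+ (k - j - m) *+ 'C(k - j, m)).
Proof.
rewrite /monic_rel coefD coef_lin_exp coef_sum; congr (_ + _); apply: eq_bigr => j _.
by rewrite expr1n mulr1 coefCM coef_lin_exp.
Qed.

Let y0 : y != 0. Proof. by rewrite -msize_poly_eq0 msizeX. Qed.

Let nat0 n : (0 < n)%N -> n%:R != 0 :> K. Proof. exact: pchar0_natr_neq0. Qed.

Let mulCn (R : nzRingType) (p : {mpoly R[2]}) n : p *+ n = n%:R *: p.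
Proof. by rewrite scaler_nat. Qed.

Lemma pi2_y : pi2 y = 0. Proof. by rewrite mevalXU eqxx. Qed.

(* For a rational self-map F over the projection, X_1^2 F_0 / F_1 satisfies this monic relation, so by
   normality it is a quadratic form Q modulo f. *)
Section Conic.
Variable Q : {mpoly K[3]}.
Hypotheses (hQ : Q \is 2.-homog).
Hypothesis fQ : zero_on f (monic_rel k (iota \o sG) 1 Q).

Lemma conic_cofactor : exists h', [/\ h' \is k.-homog &
  monic_rel k (fun j => (sG j)%:P) 1 (toX Q) = toX f * toX h'].
Proof.
have hsG j : (j <= k)%N -> iota (sG j) \is (j.+2 + j).-homog.
  move=> le; apply: dhomog_iota; apply: dhomogM.
    by have := Gh (k - j); have -> : (d - (k - j) = j.+2)%N by rewrite dk; lia.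
  by have := dhomogMn j (dhomog_var K (ord0 : 'I_2)); rewrite mul1n.
have hE : monic_rel k (iota \o sG) 1 Q \is (2 * k.+1).-homog.
  apply: rpredD; first exact: dhomogMn.
  apply: rpred_sum => j _; rewrite expr1n mulr1.
  have jk : (j <= k)%N by rewrite -ltnS.
  have := dhomogM (hsG j jk) (dhomogMn (k - j) hQ).
  by have -> : (j.+2 + j + 2 * (k - j) = 2 * k.+1)%N by lia.
have [h' hh' E] := zero_on_homog hf hE fQ.
exists h'; split; first by move: hh'; have -> : (2 * k.+1 - d = k)%N by rewrite dk; lia.
have := congr1 toX E; rewrite rmorphM monic_rel_morph rmorph1 => <-.
rewrite /monic_rel; congr (_ + _); apply: eq_bigr => j _.
by rewrite /= toX_iota.
Qed.

Let a2 := (toX Q)`_2.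
Let b := (toX Q)`_1.
Let c := (toX Q)`_0.

Let pi2s j : pi2 (sG j) = pi2 (G k) *+ (j == 0)%N.
Proof.
rewrite /sG rmorphM rmorphXn /= pi2_y expr0n; case: j => [|j]; last by rewrite mulr0.
by rewrite subn0 mulr1 mulr1n.
Qed.

Lemma conic_pi2 : exists hp : {poly K}, (size hp <= k.+1)%N /\
  map_poly pi2 (toX Q) ^+ k * (map_poly pi2 (toX Q) + (pi2 (G k))%:P) =
  map_poly pi2 (toX f) * hp.
Proof.
have [h' [hh' E]] := conic_cofactor; exists (map_poly pi2 (toX h')); split.
  by apply: leq_trans (size_poly _ _) _; case: (toX_homog hh').
rewrite -rmorphM -E monic_rel_morph rmorph1 /monic_rel big_ord_recl big1 => [|j _].
  by rewrite /= map_polyC /= pi2s eqxx expr1n mulr1 subn0 addr0 exprSr mulrDr [_%:P * _]mulrC.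
by rewrite /= map_polyC /= pi2s mulr0n !mul0r.
Qed.

(** For y = 0 the identity equates a polynomial of degree 2 (k + 1), if [a2] were nonzero, with a
    product of degree at most 2 k: [f] drops to degree k in X_0, because its top coefficient is
    y. *)
Lemma conic_a0 : a2 = 0.
Proof.
have [sQ cQ] := toX_homog hQ; have ha : a2 \is 0.-homog := cQ 2.
rewrite (homog0_const (fun j : 'I_2 => (j != ord0)%:R) ha).
have [->|al0] := eqVneq (pi2 a2) 0; first by rewrite mpolyC0.
have [hp [shp E]] := conic_pi2.
set q := map_poly pi2 (toX Q) in E.
have sq : size q = 3.
  apply/eqP; rewrite eqn_leq (leq_trans (size_poly _ _) sQ) ltnNge.
  by apply: contra al0 => /leq_sizeP/(_ 2 (leqnn _)); rewrite coef_map => ->.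
have sf : (size (map_poly pi2 (toX f)) <= k.+1)%N.
  apply/leq_sizeP => j; rewrite leq_eqVlt coef_map => /orP[/eqP <-|lt].
    by rewrite -/(G _) Gtop /= pi2_y.
  have -> : (toX f)`_j = 0 by apply: nth_default; apply: leq_trans lt; rewrite -dk.
  exact: meval0.
have q0 : q != 0 by rewrite -size_poly_eq0 sq.
have sq1 : size (q + (pi2 (G k))%:P) = 3.
  by rewrite size_polyDl sq // size_polyC; case: (_ != 0).
have q10 : q + (pi2 (G k))%:P != 0 by rewrite -size_poly_eq0 sq1.
have qk0 : q ^+ k != 0 by rewrite expf_neq0.
have sqk : (size (q ^+ k)).-1 = (2 * k)%N by rewrite size_exp sq.
have := size_mul qk0 q10; rewrite E sq1 => sE.
have := leq_trans (size_polyMleq _ _) (leq_pred_add sf shp).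
by rewrite sE; move: sqk; clear; case: (size (q ^+ k)) => [|n] /=; lia.
Qed.

Lemma conic_linear : toX Q = b%:P * 'X + c%:P.
Proof.
by have [sQ _] := toX_homog hQ; apply: poly_size3 sQ conic_a0.
Qed.

(** Now [Q] is linear in X_0, so the relation has degree at most k + 1 in X_0. That is the degree of
    [f], so the cofactor is a binary form and the identity can be read coefficient by
    coefficient. *)
Lemma conic_coefs : exists r : {mpoly K[2]}, forall m,
  b ^+ m * c ^+ (k.+1 - m) *+ 'C(k.+1, m) +
  \sum_(j < k.+1) sG j * (b ^+ m * c ^+ (k - j - m) *+ 'C(k - j, m)) = G m * r.
Proof.
have [h' [_ E]] := conic_cofactor; exists (toX h')`_0 => m.
rewrite -monic_rel_one_coef -conic_linear E.
suff {1}-> : toX h' = ((toX h')`_0)%:P by rewrite coefMC.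
apply: size1_polyC; have [->|h'0] := eqVneq (toX h') 0; first by rewrite size_poly0.
have sf : size (toX f) = k.+2.
  apply/eqP; rewrite eqn_leq -{1}dk sizef ltnNge; apply: contra y0.
  by move/leq_sizeP/(_ _ (leqnn _)); rewrite -/(G _) Gtop => ->.
have f0 : toX f != 0 by rewrite -size_poly_eq0 sf.
have := size_mul f0 h'0; rewrite sf -E => sE.
have : (size (toX h') <= 1)%N = (k.+2 + size (toX h') <= k.+3)%N.
  by rewrite -[k.+3]addn1 leq_add2l.
move=> ->; have h'p : (0 < size (toX h'))%N by rewrite size_poly_gt0.
suff : (size (monic_rel k (fun j => (sG j)%:P) 1 (toX Q)) <= k.+2)%N.
  by rewrite sE; move: h'p; case: (size (toX h')) => // n _; rewrite addnS.
apply/leq_sizeP => j kj; rewrite conic_linear monic_rel_one_coef.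
rewrite bin_small // mulr0n add0r big1 // => i _; rewrite bin_small ?mulr0n ?mulr0 //.
by apply: leq_ltn_trans (leq_subr _ _) _; apply: leq_trans kj.
Qed.

Lemma conic_b : exists z, b = z *: y.
Proof.
have [r rE] := conic_coefs; have := rE k.+1.
rewrite subnn expr0 mulr1 binn mulr1n big1 ?addr0 => [|j _]; last first.
  by rewrite bin_small ?mulr0n ?mulr0 // ltnS leq_subr.
rewrite Gtop => bE; have hb : b \is 1.-homog by have [_ /(_ 1%N)] := toX_homog hQ.
have [mu muE] : exists mu, b = y * mu.
  apply: (homog2_factor hb); have := congr1 pi2 bE.
  by rewrite rmorphXn rmorphM /= pi2_y mul0r => /eqP; rewrite expf_eq0 => /andP[_ /eqP].
have hmu : mu \is 0.-homog.
  by have := hb; rewrite muE => /(dhomog_div y0 (dhomog_var K (ord0 : 'I_2))).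
exists (pi2 mu); rewrite muE {1}(homog0_const (fun j : 'I_2 => (j != ord0)%:R) hmu).
by rewrite mulrC mul_mpolyC.
Qed.

(** Coefficients of degrees k + 1, 0, k and k - 1. The last two require z to be nonzero, since a
    power of b = z y is cancelled. *)
Lemma conic_relations z : b = z *: y -> exists r, [/\ r = z%:MP ^+ k.+1 * y ^+ k,
  c ^+ k.+1 + \sum_(j < k.+1) sG j * c ^+ (k - j) = G 0 * r,
  z != 0 -> c *+ k.+1 + G k = z%:MP * G k
  & z != 0 -> c ^+ 2 *+ 'C(k.+1, 2) + G k * (c *+ k) + G k.-1 * y = z%:MP ^+ 2 * (y * G k.-1)].
Proof.
move=> bz; have [r rE] := conic_coefs; have {}bz : b = z%:MP * y by rewrite mul_mpolyC.
have yr : y * r = b ^+ k.+1.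
  have := rE k.+1; rewrite Gtop => <-; rewrite subnn expr0 mulr1 binn mulr1n.
  by rewrite big1 ?addr0 // => j _; rewrite bin_small ?mulr0n ?mulr0 // ltnS leq_subr.
have rz : r = z%:MP ^+ k.+1 * y ^+ k by apply: (conic_rel_r y0 bz yr).
exists r; split=> //.
- have := rE 0%N; rewrite bin0 mulr1n expr0 mul1r subn0 => <-; congr (_ + _).
  by apply: eq_bigr => j _; rewrite bin0 subn0 mul1r mulr1n.
- move=> z0; have := rE k; rewrite conic_sum_k subSnn expr1 binSn /sG subn0 expr0 mulr1.
  by apply: (conic_rel_k _ y0 bz yr); rewrite mpolyC_eq0.
move=> z0; have kp : k.-1.+1 = k by rewrite prednK // ltnW.
have S1 := conic_sum_k1 k.-1 sG b c; rewrite kp in S1.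
have km : (k.+1 - k.-1 = 2)%N by rewrite -kp /=; lia.
have Cm : 'C(k.+1, k.-1) = 'C(k.+1, 2) by rewrite -(bin_sub (ltnW k2 : 2 <= k.+1)%N) -km subKn // -ltnS kp ltnW.
have := rE k.-1; rewrite S1 km Cm /sG subn0 expr0 mulr1 expr1 subn1.
have zC : z%:MP_[2] != 0 by rewrite mpolyC_eq0.
apply: (conic_rel_k1 zC y0 bz); rewrite kp; exact: yr.
Qed.

(** For z = 0 the binary form [c] satisfies the relation identically, so [f] vanishes on y X_0 =
    [c], that is, p = y X_0 - c divides y^d f. As f is prime of degree above 2, p would divide y^d,
    which fails at a zero of p with y = 1. *)
Lemma conic_z_neq0 z : b = z *: y -> z != 0.
Proof.
move=> bz; have [r [rz E0 _ _]] := conic_relations bz.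
apply: contraL (oner_neq0 K) => /eqP z0; apply/negPn/eqP.
have {}E0 : c ^+ k.+1 + \sum_(j < k.+1) sG j * c ^+ (k - j) = 0.
  by rewrite E0 rz z0 mpolyC0 expr0n mul0r mulr0.
pose H (w : {mpoly K[3]}) : 3.-tuple {mpoly K[3]} := [tuple of [:: w; 'X_o1 * 'X_o1; 'X_o1 * 'X_o2]].
have H1 w (j : 'I_2) : tnth (H w) (lift ord0 j) = 'X_o1 * 'X_(lift ord0 j).
  case: (unliftP ord0 j) => [l|] ->; by rewrite ?(ord1 l) (tnth_nth 0).
have H0 w : tnth (H w) ord0 = w by rewrite (tnth_nth 0).
have X0 i : 'X_i != 0 :> {mpoly K[3]} by rewrite -lin_delta lin_neq0 // delta_neq0.
have fc : f \mPo H (iota c) = 0.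
  have := chart_rel (H1 (iota c)) (H0 _).
  rewrite -[X in monic_rel _ _ X _]mulr1 monic_rel_scale.
  have -> : monic_rel k (iota \o sG) 1 (iota c) = iota (monic_rel k sG 1 c).
    by rewrite monic_rel_morph rmorph1.
  have -> : monic_rel k sG 1 c = 0.
    rewrite -E0 /monic_rel; congr (_ + _); apply: eq_bigr => j _.
    by rewrite expr1n mulr1.
  rewrite rmorph0 !mulr0 => /eqP; rewrite mulf_eq0 expf_eq0 (negPf (X0 _)) andbF /=.
  by move/eqP.
pose p : {mpoly K[3]} := 'X_o1 * 'X_ord0 - iota c.
have hc : c \is 2.-homog by have [_ /(_ 0%N)] := toX_homog hQ.
have hp : p \is 2.-homog.
  apply: rpredB; last exact: dhomog_iota.
  exact: dhomogM (dhomog_var K o1) (dhomog_var K ord0).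
have fY : f \mPo H ('X_o1 * 'X_ord0) = 'X_o1 ^+ d * f.
  rewrite -{2}[f]comp_mpoly_id /comp_mpoly -(mmap_dhomog _ _ _ hf).
  rewrite /mmap; apply: eq_bigr => mm _; congr (_ * _); apply: eq_bigr => i _.
  rewrite tnth_mktuple; congr (_ ^+ _); case: (unliftP ord0 i) => [j|] ->; first exact: H1.
  exact: H0.
have [q qE] : zero_on p ('X_o1 ^+ d * f).
  rewrite -fY -[X in zero_on _ X]subr0 -fc; apply: zero_on_comp => i.
  case: (unliftP ord0 i) => [j|] ->; first by rewrite !H1 subrr; apply: zero_on0.
  by rewrite !H0 -/p; exists 1; rewrite mulr1.
pose pt (x : K) : 'rV[K]_3 := x *: delta_mx 0 ord0 + delta_mx 0 o1.
have pt0 x : pt x 0 ord0 = x by rewrite !mxE !eqxx mulr1 addr0.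
have pt1 x : pt x 0 o1 = 1 by rewrite !mxE !eqxx /= mulr0 add0r.
pose x0 := (iota c).@[(pt 0) 0].
have ptE x : p.@[(pt x) 0] = x - x0.
  rewrite rmorphB rmorphM /= !mevalXU pt0 pt1 mul1r; congr (_ - _).
  rewrite /x0 !iota_eval; apply: meval_eq => j.
  by rewrite !mxE /= !mulr0.
have p0 : p != 0.
  apply/eqP => pE; have := ptE (x0 + 1); rewrite pE meval0 addrAC subrr add0r => /eqP.
  by rewrite eq_sym oner_eq0.
have : zero_on f (p * q) by exists ('X_o1 ^+ d); rewrite -qE mulrC.
case/(pr hp) => [/(zero_on_lt hf hp)|[q' qE']].
  by rewrite (ltn_trans _ d4) // => /(_ isT) /eqP; rewrite (negPf p0).
have f0 : f != 0 by case: sm.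
have : 'X_o1 ^+ d = p * q'.
  by apply: (mulIf f0); rewrite qE qE' mulrA mulrAC.
move/(congr1 (meval ((pt x0) 0))); rewrite rmorphXn rmorphM /= ptE subrr mul0r.
by rewrite mevalXU pt1 expr1n.
Qed.

(** Suppose [c] is nonzero at y = 0. The constant coefficient gives c = - G_k there, and the
    coefficient of degree k - 1 becomes c^2 k (k - 1) / 2 = 0, impossible because k = d - 2 > 1 and
    the characteristic is 0. *)
Lemma conic_c : exists mu, c = y * mu.
Proof.
have hc : c \is 2.-homog by have [_ /(_ 0%N)] := toX_homog hQ.
apply: (homog2_factor hc); have [z bz] := conic_b.
have [r [rz E0 _ E2]] := conic_relations bz.
have kp : (0 < k)%N by rewrite ltnW.
have e0' : pi2 c ^+ k * (pi2 c + pi2 (G k)) = 0.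
  have := congr1 pi2 E0; rewrite rmorphD rmorphXn rmorph_sum rmorphM /= rz rmorphM !rmorphXn /=.
  rewrite pi2_y [0 ^+ k]expr0n eqn0Ngt kp !mulr0 big_ord_recl big1 => [|j _].
    by rewrite /= rmorphM rmorphXn /= pi2s eqxx mulr1n subn0 addr0 exprSr mulrDr [pi2 (G k) * _]mulrC.
  by rewrite rmorphM /= pi2s mulr0n mul0r.
have [->//|c0] := eqVneq (pi2 c) 0.
move: e0' => /eqP; rewrite mulf_eq0 expf_eq0 (negPf c0) andbF /= addr_eq0 => /eqP cG.
have := congr1 pi2 (E2 (conic_z_neq0 bz)).
rewrite !rmorphD !rmorphM !rmorphMn rmorphXn /= pi2_y mulr0 mul0r mulr0 addr0 => E.
have G2 : pi2 (G k) = - pi2 c by rewrite cG opprK.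
have : pi2 c * (pi2 c * (k.+1 * k)%:R - (pi2 c) * (2 * k)%:R) = 0.
  have b2 : (k.+1 * k)%:R = ('C(k.+1, 2) * 2)%:R :> K.
    by have := bin_ffact k.+1 2; rewrite !ffactnS ffactn0 muln1 => <-.
  by rewrite b2; apply: conic_double; rewrite -G2.
rewrite -mulrBr -natrB; last by rewrite leq_mul2r ltnS (ltnW k2) orbT.
move=> /eqP; rewrite !mulf_eq0 (negPf c0) /= -mulnBl natrM mulf_eq0.
by rewrite !(negPf (nat0 _)) ?subn_gt0 ?ltnS // ltnW.
Qed.

Lemma conic_shape : exists z mu, [/\ z != 0, mu \is 1.-homog,
  Q = 'X_o1 * (z *: 'X_ord0 + iota mu) & (y * mu) *+ k.+1 = (z - 1) *: G k].
Proof.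
have [z bz] := conic_b; have [mu cmu] := conic_c; exists z, mu.
have z0 := conic_z_neq0 bz; have [r [_ _ E1 _]] := conic_relations bz.
split=> //.
- have hc : c \is 2.-homog by have [_ /(_ 0%N)] := toX_homog hQ.
  by have := hc; rewrite cmu => /(dhomog_div y0 (dhomog_var K (ord0 : 'I_2))).
- rewrite -[Q]toXK conic_linear bz cmu rmorphD rmorphM /= fromX_X !fromX_C.
  rewrite rmorphM iotaX -mul_mpolyC rmorphM iotaC iotaX mulrDr -mul_mpolyC.
  by congr (_ + _); rewrite mulrAC mulrC [_ * 'X_ord0]mulrC.
rewrite -cmu scalerBl scale1r -mul_mpolyC -(E1 z0).
by rewrite addrK.
Qed.

End Conic.

Lemma not_zero_on_var i : ~ zero_on f 'X_i.
Proof.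
rewrite -lin_delta; apply: (zero_on_lin_false (leq_trans _ d4) hf) => //.
exact: delta_neq0.
Qed.

(** One form [m] serves all maps: G_k / ((k + 1) y) if y divides G_k; otherwise z = 1 and mu = 0 are
    forced, and 0 will do. This is why the whole group has a single axis. *)
Lemma chart_gal_mu : exists2 m : {mpoly K[2]}, m \is 1.-homog &
  forall z (mu : {mpoly K[2]}), (y * mu) *+ k.+1 = (z - 1) *: G k -> mu = (z - 1) *: m.
Proof.
have k0 : k.+1%:R != 0 :> K by apply: nat0.
have mulnI (a b : {mpoly K[2]}) : a *+ k.+1 = b *+ k.+1 -> a = b.
  rewrite -!scaler_nat => /(congr1 (fun t => k.+1%:R^-1 *: t)).
  by rewrite !scalerA mulVf // !scale1r.
have [[m0 m0E]|ndiv] := pselect (exists m0, G k = y * m0).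
  exists (k.+1%:R^-1 *: m0).
    rewrite rpredZ //; have := Gh k; rewrite m0E => /(dhomog_div y0 (dhomog_var K (ord0 : 'I_2))).
    by have -> : (d - k - 1 = 1)%N by rewrite dk; lia.
  move=> z mu; rewrite m0E -mulrnAr scalerAr => /(mulfI y0) E; apply: mulnI.
  by rewrite E -[RHS]scaler_nat !scalerA mulrAC mulfV // mul1r.
exists 0; first exact: rpred0.
move=> z mu E; rewrite scaler0; have [z1|z1] := eqVneq z 1.
  move: E; rewrite z1 subrr scale0r => E; apply: (mulfI y0); apply: mulnI.
  by rewrite E mulr0 mul0rn.
case: ndiv; exists ((z - 1)^-1 *: (mu *+ k.+1)).
rewrite -scalerAr mulrnAr E scalerA mulVf ?scale1r //.
by rewrite subr_eq0.
Qed.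

Lemma chart_gal : exists2 m : {mpoly K[2]}, m \is 1.-homog &
  forall e (F : 3.-tuple {mpoly K[3]}), (forall i, tnth F i \is e.-homog) ->
  zero_on f (f \mPo F) -> zero_on f (tnth F o1 * 'X_o2 - tnth F o2 * 'X_o1) ->
  ~ zero_on f (tnth F o1) ->
  exists2 z, z != 0 &
    zero_on f (tnth F ord0 * 'X_o1 - tnth F o1 * (z *: 'X_ord0 + (z - 1) *: iota m)).
Proof.
have [m hm mE] := chart_gal_mu; exists m => // e F hF fF fF12 nF1.
have d1 : (1 < d)%N by apply: leq_trans d4.
(* Modulo [f] this is X_1 F, rewritten in the shape that [chart_rel] requires. *)
pose H : 3.-tuple {mpoly K[3]} :=
  [tuple of [:: tnth F ord0 * 'X_o1; tnth F o1 * 'X_o1; tnth F o1 * 'X_o2]].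
pose H' : 3.-tuple {mpoly K[3]} := [tuple 'X_o1 * tnth F i | i < 3].
have HH' i : zero_on f (tnth H i - tnth H' i).
  rewrite tnth_mktuple; move: i; apply: ord3_ind; rewrite (tnth_nth 0) /=.
  - by rewrite mulrC subrr; apply: zero_on0.
  - by rewrite mulrC subrr; apply: zero_on0.
  - by rewrite ['X_o1 * _]mulrC.
have fH : zero_on f (f \mPo H).
  apply: (proj2 (zero_on_subr (zero_on_comp f HH'))).
  rewrite (@comp_homog_scale _ _ f d 'X_o1 F) //; first exact: zero_onMl.
  by move=> i; rewrite tnth_mktuple.
have H1 (j : 'I_2) : tnth H (lift ord0 j) = tnth F o1 * 'X_(lift ord0 j).
  case: (unliftP ord0 j) => [l|] ->; by rewrite ?(ord1 l) (tnth_nth 0).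
have H0 : tnth H ord0 = tnth F ord0 * 'X_o1 by rewrite (tnth_nth 0).
pose W := 'X_o1 * (tnth F ord0 * 'X_o1).
have rel : zero_on f (monic_rel k (iota \o sG) (tnth F o1) W).
  have frel : zero_on f (tnth F o1 * monic_rel k (iota \o sG) (tnth F o1) W).
    by rewrite -(chart_rel H1 H0); apply: zero_onMl.
  by case: (pr (hF o1) frel) => // /nF1.
have hW : W \is (e + 2).-homog.
  have := dhomogM (dhomog_var K o1) (dhomogM (hF ord0) (dhomog_var K o1)).
  by have -> : (1 + (e + 1) = e + 2)%N by lia.
have [Q hQ WQ] := normality charK d1 sm (hF o1) nF1 hW rel.
have fQ : zero_on f (monic_rel k (iota \o sG) 1 Q).
  apply: (form_prime_exp (k := k.+1) pr (hF o1) nF1); rewrite -monic_rel_scale mulr1.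
  have cong := zero_on_monic_rel k (iota \o sG) (zero_on_refl f (tnth F o1)) WQ.
  exact: (proj1 (zero_on_subr cong) rel).
have [z [mu [z0 hmu QE muE]]] := conic_shape hQ fQ.
exists z => //; have muz := mE z mu muE.
have fY : zero_on f ('X_o1 * (tnth F ord0 * 'X_o1 - tnth F o1 * (z *: 'X_ord0 + (z - 1) *: iota m))).
  suff <- : W - tnth F o1 * Q = 'X_o1 *
    (tnth F ord0 * 'X_o1 - tnth F o1 * (z *: 'X_ord0 + (z - 1) *: iota m)) by [].
  rewrite QE muz /W mulrBr mulrCA [tnth F o1 * (_ * _)]mulrCA.
  by rewrite -[in iota _]mul_mpolyC rmorphM /= iotaC mul_mpolyC.
by case: (pr (dhomog_var K o1) fY) => // /not_zero_on_var.
Qed.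

End Chart.
End CenterChart.

(** * Maps over the projection are homologies with a common axis *)

Lemma minor_identity (T : comNzRingType) (F0 F1 F2 G0 G1 G2 : T) :
  G1 * (F0 * G2 - F2 * G0) = G2 * (F0 * G1 - F1 * G0) + G0 * (F1 * G2 - F2 * G1).
Proof. ring. Qed.

Lemma alt_expand (T : comNzRingType) (x0 x1 x2 y0 y1 y2 F0 F1 F2 G0 G1 G2 : T) :
  (x0 * F0 + x1 * F1 + x2 * F2) * (y0 * G0 + y1 * G1 + y2 * G2) -
  (y0 * F0 + y1 * F1 + y2 * F2) * (x0 * G0 + x1 * G1 + x2 * G2) =
  (x0 * y1 - x1 * y0) * (F0 * G1 - F1 * G0) + (x0 * y2 - x2 * y0) * (F0 * G2 - F2 * G0)
  + (x1 * y2 - x2 * y1) * (F1 * G2 - F2 * G1).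
Proof. ring. Qed.

Section GaloisLinear.
Variable K : closedFieldType.
Hypothesis charK : [pchar K] =i pred0.
Implicit Types (f g h : {mpoly K[3]}) (a b c u v w l : 'rV[K]_3).

Lemma sum3 (V : nmodType) (F : 'I_3 -> V) : \sum_i F i = F ord0 + F o1 + F o2.
Proof. by rewrite !big_ord_recl big_ord0 addr0 addrA. Qed.

Lemma lev_iota (a : {mpoly K[2]}) N w : a \is N.-homog ->
  lev (iota a) e0 w = 'X^N * ((iota a).@[w 0])%:P.
Proof.
move=> ha; apply: (poly_eq_horner charK) => t; rewrite lev_horner !hornerE.
rewrite !iota_eval -[RHS](mmap_dhomog idfun _ t ha).
by apply: meval_eq => j; rewrite /e0 /bvec !mxE /= add0r.
Qed.

Lemma top_coef f d w : f \is d.+1.-homog -> f.@[e0 0] = 0 ->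
  (iota (toX f)`_d).@[w 0] = dder f e0 w.
Proof.
move=> hf fe; have [sf cf] := toX_homog hf.
rewrite -lev_coef1 -{2}[f]toXK (fromX_sum sf) /lev rmorph_sum.
rewrite big_ord_recr big_ord_recr /= (toX_lead hf) fe mpolyC0 rmorph0 mul0r rmorph0 addr0.
have X1 : levr e0 w 'X_ord0 = 1 + 'X * (w 0 ord0)%:P.
  rewrite -[levr _ _ _]/(lev _ _ _) -lin_delta lev_lin.
  rewrite (dotpC (delta_mx 0 ord0) e0) (dotpC (delta_mx 0 ord0) w) !dotp_delta.
  by rewrite /e0 /bvec mxE !eqxx.
have levi i : levr e0 w (iota (toX f)`_i * 'X_ord0 ^+ i) =
   'X^(d.+1 - i) * ((iota (toX f)`_i).@[w 0])%:P * (1 + 'X * (w 0 ord0)%:P) ^+ i.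
  rewrite rmorphM rmorphXn /= X1; congr (_ * _).
  exact: (lev_iota _ (cf i)).
rewrite coefD coef_sum big1 => [|i _]; last first.
  rewrite levi; have -> : (d.+1 - i = (d - i).-1.+2)%N by have := ltn_ord i; lia.
  by rewrite exprS exprS -!mulrA !coefXM.
rewrite add0r levi subSnn expr1 -mulrA coefXM /= coefCM -horner_coef0 horner_exp.
by rewrite !hornerE expr1n mulr1.
Qed.

Definition grad f u : 'rV[K]_3 := \row_i f^`M(i).@[u 0].

Lemma dder_grad f u w : dder f u w = dotp (grad f u) w.
Proof. by apply: eq_bigr => i _; rewrite mxE mulrC. Qed.

Definition frame (r0 r1 r2 : 'rV[K]_3) : 'M[K]_3 :=
  \matrix_(i, j) (if i == ord0 then r0 else if i == o1 then r1 else r2) 0 j.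

Lemma frameE r0 r1 r2 w :
  w *m frame r0 r1 r2 = w 0 ord0 *: r0 + w 0 o1 *: r1 + w 0 o2 *: r2.
Proof. by apply/rowP => j; rewrite mxE sum3 !mxE. Qed.

(** Coordinates with the point at [e0] and its tangent line at X_1 = 0, the normal form of the
    chart. *)
Lemma adapted_frame d f u : (0 < d)%N -> smooth_plane_curve d f -> u != 0 ->
  f.@[u 0] = 0 -> exists A, [/\ A \in unitmx, e0 *m A = u &
   forall w, dder f u (w *m A) = w 0 o1].
Proof.
move=> d0 sm u0 fu; have [_ hf _] := sm.
have [w0 hw0] := smooth_dder sm u0 fu.
have g0 : grad f u != 0.
  apply: contra hw0 => /eqP g0; rewrite dder_grad g0 /dotp big1 // => i _.
  by rewrite mxE mul0r.
have gu : dotp (grad f u) u = 0 by rewrite -dder_grad (dder_self _ hf) fu mulr0.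
have [r1 gr1] := dotp_surj g0; have [r2 gr2 cr] := kernel_vector gu u0.
exists (frame u r1 r2); have gw w : dder f u (w *m frame u r1 r2) = w 0 o1.
  by rewrite dder_grad frameE !dotpDr !dotpZr gu gr1 gr2 !mulr0 mulr1 add0r addr0.
split=> //; last by rewrite frameE /e0 /bvec !mxE !eqxx /= scale1r !scale0r !addr0.
rewrite unitmxE unitfE; apply/det0P => -[w wn0 wA].
have w1 : w 0 o1 = 0 by rewrite -gw wA dder_grad dotp0.
move: wA; rewrite frameE w1 scale0r addr0 => wA.
have w2 : w 0 o2 = 0.
  have : w 0 o2 *: grad f u = 0.
    rewrite -cr.
    have E : w 0 o2 *: r2 = - (w 0 ord0 *: u) by apply/eqP; rewrite -addr_eq0 addrC wA.
    have -> : w 0 o2 *: cross r2 u = cross (w 0 o2 *: r2) u.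
      apply/rowP => i; case: (crossE r2 u) (crossE (w 0 o2 *: r2) u) => h0 h1 h2 [h3 h4 h5].
      by move: i; apply: ord3_ind; rewrite mxE ?(h0, h1, h2) ?(h3, h4, h5) !mxE; ring.
    rewrite E; apply/rowP => i; case: (crossE (- (w 0 ord0 *: u)) u) => h0 h1 h2.
    by move: i; apply: ord3_ind; rewrite ?(h0, h1, h2) !mxE; ring.
  by move/eqP; rewrite scaler_eq0 (negPf g0) orbF => /eqP.
move: wA; rewrite w2 scale0r addr0 => /eqP; rewrite scaler_eq0 (negPf u0) orbF => /eqP w00.
case/negP: wn0; apply/eqP/rowP; apply: ord3_ind; by rewrite mxE.
Qed.

(** The pullback along [F] of the linear form with coefficients [a]; it allows minors to be taken in
    any basis of linear forms. *)
Definition lc a (F : 3.-tuple {mpoly K[3]}) : {mpoly K[3]} := \sum_i a 0 i *: tnth F i.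

Lemma lc_sum3 (x y z : K) a b c F :
  lc (x *: a + y *: b + z *: c) F = x *: lc a F + y *: lc b F + z *: lc c F.
Proof.
rewrite /lc !scaler_sumr -!big_split; apply: eq_bigr => i _ /=.
by rewrite !mxE !scalerDl !scalerA.
Qed.

Lemma lin_sum3 (x y z : K) a b c :
  lin (x *: a + y *: b + z *: c) = x *: lin a + y *: lin b + z *: lin c.
Proof.
rewrite /lin !scaler_sumr -!big_split; apply: eq_bigr => i _ /=.
by rewrite !mxE !scalerDl !scalerA.
Qed.

Lemma lc_delta i F : lc (delta_mx 0 i) F = tnth F i.
Proof.
rewrite /lc (bigD1 i) //= big1 ?addr0 => [|j ji]; rewrite !mxE ?eqxx ?scale1r //=.
by rewrite (negPf ji) scale0r.
Qed.

Lemma lc_eval a F v : (lc a F).@[v 0] = dotp a (\row_i (tnth F i).@[v 0]).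
Proof. by rewrite rmorph_sum; apply: eq_bigr => i _; rewrite /= mevalZ mxE. Qed.

Lemma dhomog_lc a F e : (forall i, tnth F i \is e.-homog) -> lc a F \is e.-homog.
Proof. by move=> hF; apply: rpred_sum => i _; rewrite rpredZ. Qed.

Definition hmx u l : 'M[K]_3 := 1%:M + l^T *m u.

Lemma hmxE u l v : v *m hmx u l = v + dotp l v *: u.
Proof.
rewrite mulmxDr mulmx1 mulmxA; congr (_ + _); apply/rowP => i.
rewrite !mxE big_ord1 mxE; congr (_ * _); apply: eq_bigr => j _; by rewrite mxE mulrC.
Qed.

Lemma lc_lint a (A : 'M[K]_3) : lc a (lint A) = lin (a *m A^T).
Proof.
apply: (mpoly_eq_vec charK) => v; rewrite lc_eval lin_eval.
rewrite -(lin_eval (a *m A^T)) -(lact_lin charK) lactE lin_eval; congr (dotp _ _).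
apply/rowP => i; rewrite !mxE tnth_mktuple rmorph_sum; apply: eq_bigr => j _.
by rewrite /= mevalZ mevalXU mulrC.
Qed.

Lemma lc_hmx a u l : lc a (lint (hmx u l)) = lin (a + dotp a u *: l).
Proof.
rewrite lc_lint; congr (lin _); rewrite /hmx raddfD /= trmx1 trmx_mul trmxK mulmxDr mulmx1 mulmxA.
congr (_ + _); apply/rowP => i; rewrite !mxE big_ord1 !mxE; congr (_ * _).
by apply: eq_bigr => j _; rewrite mxE.
Qed.

(** The form [la] is chosen before [F]: every map over the projection fixes the same axis la = 0 and
    differs only in the factor z by which it scales [u]. *)
Lemma gal_linear d f u : (3 < d)%N -> smooth_plane_curve d f -> u != 0 -> f.@[u 0] = 0 ->
  exists2 la, dotp la u = 1 & forall e (F : 3.-tuple {mpoly K[3]}),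
   (forall i, tnth F i \is e.-homog) -> zero_on f (f \mPo F) ->
   (forall a b, dotp a u = 0 -> dotp b u = 0 ->
      zero_on f (lc a F * lin b - lc b F * lin a)) ->
   (exists2 a, dotp a u = 0 & ~ zero_on f (lc a F)) ->
   exists2 z, z != 0 & forall a b,
     zero_on f (lc a F * lc b (lint (hmx u ((z - 1) *: la)))
               - lc b F * lc a (lint (hmx u ((z - 1) *: la)))).
Proof.
move=> d4 sm u0 fu; have [_ hf _] := sm.
have d0 : (0 < d)%N by apply: leq_trans d4.
have d1 : (1 < d)%N by apply: leq_trans d4.
have [A [uA eA DA]] := adapted_frame d0 sm u0 fu.
have smA := smooth_lact charK uA sm; have hfA := dhomog_lact A hf.
have feA : (lact A f).@[e0 0] = 0 by rewrite lactE eA.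
have dE : d = d.-1.+1 by rewrite prednK.
have [sfA cfA] := toX_homog hfA.
have size_fA : (size (toX (lact A f)) <= d)%N.
  apply/leq_sizeP => j; rewrite leq_eqVlt => /orP[/eqP <-|lt].
    by rewrite (toX_lead hfA) feA mpolyC0.
  by apply: nth_default; apply: leq_trans sfA lt.
have lead_fA : (toX (lact A f))`_d.-1 = 'X_ord0.
  apply: (@polyC_inj); rewrite -toX_iota -toX_lift; congr (toX _).
  apply: (mpoly_eq_vec charK) => w; have hfA' : lact A f \is (d.-1).+1.-homog by rewrite -dE.
  by rewrite mevalXU (top_coef w hfA' feA) (dder_lact charK) eA DA.
have [m hm mE] := chart_gal charK d4 smA size_fA lead_fA.
pose mi i : 'rV[K]_3 := (col i (invmx A))^T.
have miE i v : dotp (mi i) v = (v *m invmx A) 0 i.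
  by rewrite mxE; apply: eq_bigr => j _; rewrite !mxE mulrC.
have miu i : dotp (mi i) u = (i == ord0)%:R.
  by rewrite miE -eA mulmxK // /e0 /bvec mxE eqxx.
have mi_lin i : lact A (lin (mi i)) = 'X_i.
  apply: (mpoly_eq_vec charK) => v; rewrite lactE lin_eval miE mulmxK // mevalXU.
  by [].
have expand a : a = dotp a (row ord0 A) *: mi ord0 + dotp a (row o1 A) *: mi o1
    + dotp a (row o2 A) *: mi o2.
  apply/rowP => i; have := congr1 (fun M : 'M_3 => (a *m M^T) 0 i) (mulVmx uA).
  rewrite /= trmx1 mulmx1 trmx_mul mulmxA => <-.
  rewrite mxE sum3 !mxE; congr (_ + _ + _); congr (_ * _);
    by apply: eq_bigr => j _; rewrite !mxE.
have rowu : row ord0 A = u by rewrite -eA /e0 /bvec rowE.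
have [mu muE] : exists mu, lact (invmx A) (iota m) = lin mu.
  by apply: lin_homog; apply: dhomog_lact; apply: dhomog_iota.
have muu : dotp mu u = 0.
  rewrite -lin_eval -muE lactE -eA mulmxK // iota_eval (meval0_homog hm) // => j.
  by rewrite /e0 /bvec mxE.
(* The chart gives z x + (z - 1) m = x + (z - 1) (x + m), so x + m, in the original coordinates, is
   the equation of the axis. *)
exists (mi ord0 + mu); first by rewrite dotpC dotpDr !(dotpC u) miu muu eqxx addr0.
move=> e F hF fF Fab [a0 a0u nFa0].
pose F' : 3.-tuple {mpoly K[3]} := [tuple lact A (lc (mi i) F) | i < 3].
have hF' i : tnth F' i \is e.-homog.
  by rewrite tnth_mktuple; apply: dhomog_lact; apply: dhomog_lc.
have F'E v : (\row_i (tnth F' i).@[v 0]) *m A = \row_i (tnth F i).@[(v *m A) 0].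
  suff -> : \row_i (tnth F' i).@[v 0] = (\row_i (tnth F i).@[(v *m A) 0]) *m invmx A.
    by rewrite mulmxKV.
  by apply/rowP => i; rewrite mxE tnth_mktuple lactE lc_eval miE.
have fF' : zero_on (lact A f) (lact A f \mPo F').
  have -> : lact A f \mPo F' = lact A (f \mPo F).
    by apply: (mpoly_eq_vec charK) => v; rewrite comp_vec !lactE comp_vec F'E.
  exact: zero_on_lact.
have m1u : dotp (mi o1) u = 0 by rewrite miu.
have m2u : dotp (mi o2) u = 0 by rewrite miu.
have F'12 : zero_on (lact A f) (tnth F' o1 * 'X_o2 - tnth F' o2 * 'X_o1).
  by rewrite !tnth_mktuple -!mi_lin -!rmorphM -rmorphB; apply/zero_on_lact/Fab.
have pr := form_prime_smooth charK sm.
have nlin i : ~ zero_on f (lin (mi i)).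
  move/(zero_on_lact A); rewrite mi_lin -lin_delta.
  by apply: (zero_on_lin_false d1 hfA); apply: delta_neq0.
have nF1 : ~ zero_on f (lc (mi o1) F).
  move=> f1; have f2 : zero_on f (lc (mi o2) F).
    have h12 := Fab _ _ m1u m2u.
    have h : zero_on f (lc (mi o2) F * lin (mi o1)).
      apply: (proj1 (zero_on_subr h12)); exact: zero_onMr.
    by case: (pr _ _ _ (dhomog_lc _ hF) h) => // /nlin.
  apply: nFa0; rewrite (expand a0) rowu a0u lc_sum3 scale0r add0r.
  by apply: zero_onD; apply: zero_onZ.
have nF'1 : ~ zero_on (lact A f) (tnth F' o1) by rewrite tnth_mktuple zero_on_lactE.
have [z z0 zE] := mE e F' hF' fF' F'12 nF'1; exists z => //.
set G := lint (hmx u ((z - 1) *: (mi ord0 + mu))).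
have G0 : lc (mi ord0) G = z *: lin (mi ord0) + (z - 1) *: lin mu.
  rewrite lc_hmx miu eqxx scale1r scalerDr addrA -{1}[mi ord0]scale1r -scalerDl.
  rewrite [1 + _]addrC subrK.
  by have := lin_sum3 z (z - 1) 0 (mi ord0) mu 0; rewrite !scale0r !addr0.
have Gi i : i != ord0 -> lc (mi i) G = lin (mi i).
  by move=> i0; rewrite lc_hmx miu (negPf i0) scale0r addr0.
have E01 : zero_on f (lc (mi ord0) F * lc (mi o1) G - lc (mi o1) F * lc (mi ord0) G).
  rewrite G0 Gi // -(zero_on_lactE charK _ _ uA); move: zE.
  rewrite !tnth_mktuple rmorphB !rmorphM /= mi_lin rmorphD !lactZ mi_lin -muE lactVK //.
have E12 : zero_on f (lc (mi o1) F * lc (mi o2) G - lc (mi o2) F * lc (mi o1) G).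
  by rewrite !Gi //; apply: Fab.
have E02 : zero_on f (lc (mi ord0) F * lc (mi o2) G - lc (mi o2) F * lc (mi ord0) G).
  have h : zero_on f (lc (mi o1) G * (lc (mi ord0) F * lc (mi o2) G - lc (mi o2) F * lc (mi ord0) G)).
    rewrite (minor_identity _ (lc (mi o1) F)); apply: zero_onD; first exact: zero_onMl E01.
    exact: zero_onMl E12.
  move: h; rewrite {1}Gi // => h; case: (pr _ _ _ (dhomog_lin _) h) => // /nlin.
  by [].
move=> a b; rewrite (expand a) (expand b) !lc_sum3.
move: E01 E02 E12.
move: (dotp a _) (dotp a _) (dotp a _) (dotp b _) (dotp b _) (dotp b _) => x0 x1 x2 y0 y1 y2.
move: (lc _ F) (lc _ F) (lc _ F) (lc _ G) (lc _ G) (lc _ G) => F0 F1 F2 G0' G1 G2 E01 E02 E12.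
rewrite -!mul_mpolyC alt_expand.
by apply: zero_onD; [apply: zero_onD|]; apply: zero_onMl.
Qed.

End GaloisLinear.

(** * The group of a point as a set of homologies *)

Lemma minor_trans (T : comNzRingType) (gj fi hk fk hi fj gi gk : T) :
  gj * (fi * hk - fk * hi) =
  (fi * gj - fj * gi) * hk + ((gi * hk - gk * hi) * fj + (fj * gk - fk * gj) * hi).
Proof. ring. Qed.

Lemma span_minors (T : comNzRingType) (x0 x1 y0 y1 F0 F1 G0 G1 : T) :
  (x0 * F0 + x1 * F1) * (y0 * G0 + y1 * G1) - (y0 * F0 + y1 * F1) * (x0 * G0 + x1 * G1) =
  (F0 * G1 - F1 * G0) * (x0 * y1 - x1 * y0).
Proof. ring. Qed.

Lemma set_bij_card_eq (T U : Type) (A : set T) (B : set U) (F : T -> U) :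
  set_bij A B F -> card_eq A B.
Proof. by case/Pbij => g _; apply: pcard_eq. Qed.

Section RationalMaps.
Variable K : closedFieldType.
Hypothesis charK : [pchar K] =i pred0.
Implicit Types (f g h : {mpoly K[3]}) (a b c u v w l : 'rV[K]_3).

Lemma rat_eq_refl f m (F : m.-tuple {mpoly K[3]}) : rat_rep f F -> rat_eq f F F.
Proof. by move=> h; split=> // i j; rewrite mulrC subrr; apply: zero_on0. Qed.

Lemma rat_eq_sym f m (F G : m.-tuple {mpoly K[3]}) : rat_eq f F G -> rat_eq f G F.
Proof.
case=> hF hG h; split=> // i j.
by rewrite [_ * tnth F j]mulrC [_ * tnth F i]mulrC; apply: h.
Qed.

Lemma rat_eq_trans f m (F G H : m.-tuple {mpoly K[3]}) : form_prime f ->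
  rat_eq f F G -> rat_eq f G H -> rat_eq f F H.
Proof.
move=> pr [hF hG hFG] [_ hH hGH]; split=> // i k.
have [[e He] [j Gj]] := hG.
have [//|//] : zero_on f (tnth G j) \/
    zero_on f (tnth F i * tnth H k - tnth F k * tnth H i).
apply: (pr _ _ _ (He j)); rewrite (minor_trans _ _ _ _ _ (tnth F j) (tnth G i) (tnth G k)).
apply: zero_onD; first by apply/zero_onMr/hFG.
by apply: zero_onD; apply: zero_onMr; [apply: hGH|apply: hFG].
Qed.

(** With F_j nonzero on the curve, F_j G and G_j F agree modulo f, so F_j^d f(G) and G_j^d f(F)
    agree too, and F_j^d cancels. *)
Lemma rat_eq_zero_on_comp d f (F G : 3.-tuple {mpoly K[3]}) : smooth_plane_curve d f ->
  rat_eq f F G -> zero_on f (f \mPo F) -> zero_on f (f \mPo G).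
Proof.
move=> sm [[[e He] [j Fj]] _ h] fF; have pr := form_prime_smooth charK sm.
have [_ hf _] := sm.
have E h' (H : 3.-tuple {mpoly K[3]}) : f \mPo [tuple h' * tnth H i | i < 3] = h' ^+ d * (f \mPo H).
  by apply: comp_homog_scale hf _ => i; rewrite tnth_mktuple.
apply: (@form_prime_exp _ f (tnth F j) _ e d pr (He j) Fj); rewrite -E.
apply/(@zero_on_subr _ _ _ (f \mPo [tuple tnth G j * tnth F i | i < 3])).
  apply: zero_on_comp => i; rewrite !tnth_mktuple [tnth G j * _]mulrC.
  by apply: h.
by rewrite E; apply: zero_onMl.
Qed.

Lemma dual_frame u : u != 0 -> exists b m1 m2 w1 w2 : 'rV[K]_3,
  [/\ [/\ dotp b u = 1, dotp m1 u = 0 & dotp m2 u = 0],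
      [/\ dotp m1 w1 = 1, dotp m1 w2 = 0, dotp m2 w1 = 0 & dotp m2 w2 = 1]
    & forall v, v = dotp b v *: u + dotp m1 v *: w1 + dotp m2 v *: w2].
Proof.
case/unitmx_row => A uA eA; pose B := invmx A.
pose o1 := lift (ord0 : 'I_3) (ord0 : 'I_2) : 'I_3.
pose o2 := lift (ord0 : 'I_3) (lift (ord0 : 'I_2) (ord0 : 'I_1)) : 'I_3.
pose m i : 'rV[K]_3 := row i B^T; pose e i : 'rV[K]_3 := row i A.
have dE i v : dotp (m i) v = (v *m B) 0 i.
  by rewrite mxE; apply: eq_bigr => j _; rewrite !mxE mulrC.
have de i j : dotp (m i) (e j) = (i == j)%:R.
  by rewrite dE -row_mul mulmxV // row1 mxE eqxx.
have e0E : e ord0 = u.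
  by rewrite -eA /e rowE; congr (_ *m _); apply/rowP => i; rewrite /e0 /bvec !mxE.
exists (m ord0), (m o1), (m o2), (e o1), (e o2).
rewrite -e0E !de; split=> // v.
rewrite !dE -{1}(mulmxKV uA v) -/B; apply/rowP => j.
by rewrite mxE sum3 !mxE.
Qed.

Lemma form_span u b m1 m2 w1 w2 a : dotp a u = 0 ->
  (forall v, v = dotp b v *: u + dotp m1 v *: w1 + dotp m2 v *: w2) ->
  a = dotp a w1 *: m1 + dotp a w2 *: m2.
Proof.
move=> au h; apply/rowP => i; rewrite !mxE -!dotp_delta {1}[delta_mx 0 i]h.
by rewrite !dotpDr !dotpZr au mulr0 add0r [_ * dotp a w1]mulrC [_ * dotp a w2]mulrC.
Qed.

(* G[P] for P = <u>, seen as the homologies v |-> v + l(v) u preserving the curve. *)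
Definition deck f u : set 'rV[K]_3 :=
  [set l | 1 + dotp l u != 0 /\ zero_on f (lact (hmx u l) f)].

Definition point_of u (P : P2 K) := u != 0 /\ val P = <[u]>%VS.

Lemma P2_point (P : P2 K) : exists u, point_of u P.
Proof.
case: P => U /= dU; have : U != 0%VS by rewrite -dimv_eq0 (eqP dU).
rewrite -vpick0 => u0; exists (vpick U); split=> //=; apply/esym/eqP.
by rewrite eqEdim -memvE memv_pick dim_vline u0 (eqP dU).
Qed.

Lemma P2_mk u : u != 0 -> exists P : P2 K, point_of u P.
Proof.
move=> u0; have dU : \dim <[u]>%VS == 1%N by rewrite dim_vline u0.
by exists (exist _ <[u]>%VS dU).
Qed.

Lemma P2_mem u P v : point_of u P -> v \in val P <-> exists k, v = k *: u.
Proof. by case=> _ ->; split=> [/vlineP|h]; last exact/vlineP. Qed.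

Lemma on_curve_point d f u P : f \is d.-homog -> point_of u P ->
  on_curve f P <-> f.@[u 0] = 0.
Proof.
move=> hf uP; split=> [|fu v].
  by apply; apply/(P2_mem _ uP); exists 1; rewrite scale1r.
by move/(P2_mem _ uP) => [k ->]; rewrite (meval_vecZ _ _ hf) fu mulr0.
Qed.

Lemma hmx_unit u l : 1 + dotp l u != 0 -> hmx u l \in unitmx.
Proof.
move=> h; rewrite unitmxE unitfE; apply/det0P => -[v v0]; rewrite hmxE => /eqP.
rewrite addr_eq0 => /eqP vE; have : dotp l v * (1 + dotp l u) == 0.
  by rewrite mulrDr mulr1 -dotpZr {1}vE dotpNr addNr.
rewrite mulf_eq0 (negPf h) orbF => /eqP lv.
by move: v0; rewrite vE lv scale0r oppr0 eqxx.
Qed.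

Lemma lact_form_const d f (A : 'M[K]_3) : smooth_plane_curve d f -> A \in unitmx ->
  zero_on f (lact A f) -> exists2 c, c != 0 & lact A f = c *: f.
Proof.
move=> sm uA fA; have [f0 hf _] := sm.
have [q hq qE] := zero_on_homog hf (dhomog_lact A hf) fA.
rewrite subnn in hq; exists (q@_0%MM); last first.
  rewrite qE; suff {1}-> : q = (q@_0%MM)%:MP_[3] by rewrite mulrC mul_mpolyC.
  apply/mpolyP => m; rewrite mcoeffC; have [->|m0] := eqVneq m 0%MM; first by rewrite mulr1.
  by rewrite mulr0; apply: (dhomog_nemf_coeff hq); rewrite mdeg_eq0.
apply: contra f0 => /eqP q0; rewrite -(lact_eq0 charK _ uA) qE.
suff -> : q = 0 by rewrite mulr0.
apply/mpolyP => m; rewrite mcoeff0; have [->//|m0] := eqVneq m 0%MM.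
by apply: (dhomog_nemf_coeff hq); rewrite mdeg_eq0.
Qed.

Lemma rat_comp_lint (A B : 'M[K]_3) : rat_comp (lint A) (lint B) = lint (B *m A).
Proof.
apply: eq_from_tnth => i; rewrite tnth_mktuple -lact_comp.
rewrite -[X in tnth (lint (_ *m _)) X]/i.
have tE M : tnth (lint M) i = lact M 'X_i by rewrite lact_comp comp_mpolyXU -tnth_nth.
by rewrite !tE lact_mul.
Qed.

Lemma lint1 : lint 1%:M = rat_id K.
Proof.
apply: eq_from_tnth => i; have -> : tnth (lint 1%:M) i = lact 1%:M 'X_i :> {mpoly K[3]}.
  by rewrite lact_comp comp_mpolyXU -tnth_nth.
by rewrite lact1 // tnth_mktuple.
Qed.

Lemma rat_rep_lint d f (A : 'M[K]_3) : (1 < d)%N -> smooth_plane_curve d f ->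
  A \in unitmx -> rat_rep f (lint A).
Proof.
move=> d1 [_ hf _] uA; split; first by exists 1%N => i; apply: dhomog_lint.
exists ord0 => /(zero_on_lt hf (dhomog_lint A ord0) d1) /eqP.
have -> : tnth (lint A) ord0 = lact A 'X_ord0 by rewrite lact_comp comp_mpolyXU -tnth_nth.
by rewrite (lact_eq0 charK _ uA) -msupp_eq0 msuppX.
Qed.

(** The minors are quadratic and d > 2, so they vanish identically. The minor of a form killing [u]
    and a form equal to 1 at [u] then isolates l - l'. *)
Lemma lint_minors_inj d f u l l' : (2 < d)%N -> smooth_plane_curve d f -> u != 0 ->
  (forall a b, zero_on f (lc a (lint (hmx u l)) * lc b (lint (hmx u l'))
                          - lc b (lint (hmx u l)) * lc a (lint (hmx u l')))) -> l = l'.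
Proof.
move=> d2 [_ hf _] /dual_frame[b [m1 [m2 [w1 [w2 [[bu mu _] [mw _ _ _] _]]]]]] h.
have m0 : m1 != 0 by apply/eqP => m0; move/eqP: mw; rewrite m0 dotpC dotp0 eq_sym oner_eq0.
have := h m1 b; rewrite !(lc_hmx charK) mu bu !scale0r !scale1r !addr0 => z.
have {z} : lin m1 * lin (b + l') - lin (b + l) * lin m1 = 0.
  have hh (x y : 'rV[K]_3) : lin x * lin y \is 2.-homog by have := dhomogM (dhomog_lin x) (dhomog_lin y).
  exact: zero_on_lt hf (rpredB (hh _ _) (hh _ _)) d2 z.
rewrite [X in _ - X]mulrC -mulrBr => /eqP; rewrite mulf_eq0 (negPf (lin_neq0 m0)) /= => /eqP e.
apply/rowP => i; have := congr1 (mcoeff U_(i)%MM) e.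
rewrite mcoeffB !mcoeff_lin mcoeff0 !mxE opprD addrACA subrr add0r => /eqP.
by rewrite subr_eq0 => /eqP.
Qed.

Lemma rat_eq_lc f (F G : 3.-tuple {mpoly K[3]}) a b :
  (forall i j, zero_on f (tnth F i * tnth G j - tnth F j * tnth G i)) ->
  zero_on f (lc a F * lc b G - lc b F * lc a G).
Proof.
move=> h; rewrite /lc !sum3 -!mul_mpolyC alt_expand.
by apply: zero_onD; [apply: zero_onD|]; apply: zero_onMl; apply: h.
Qed.

Lemma bir_lint d f u l : (1 < d)%N -> smooth_plane_curve d f -> deck f u l ->
  birational_self f (lint (hmx u l)).
Proof.
move=> d1 sm [/hmx_unit uA fA]; set A := hmx u l in uA fA *.
have rs B : B \in unitmx -> zero_on f (lact B f) -> rat_self f (lint B).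
  by move=> uB fB; split; [apply: rat_rep_lint sm _|rewrite -lact_comp].
split; first exact: rs; exists (lint (invmx A)).
have rid : rat_rep f (rat_id K) by rewrite -lint1; apply: rat_rep_lint sm _; rewrite ?unitmx1.
rewrite !rat_comp_lint mulmxV // mulVmx // lint1; split; try exact: rat_eq_refl.
apply: rs; first by rewrite unitmx_inv.
have [c c0 fE] := lact_form_const sm uA fA; exists (c^-1)%:MP.
by rewrite -[lact _ f](scalerK c0) -lactZ // -fE lactK // mulrC mul_mpolyC.
Qed.
End RationalMaps.

Lemma cramer2 (F : fieldType) (x0 x1 y0 y1 s t : F) : x0 * y1 - x1 * y0 != 0 ->
  exists x y, x * x0 + y * x1 = s /\ x * y0 + y * y1 = t.
Proof.
move=> D; exists ((s * y1 - t * x1) / (x0 * y1 - x1 * y0)).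
by exists ((t * x0 - s * y0) / (x0 * y1 - x1 * y0)); split; field.
Qed.

Section DeckGroup.
Variable K : closedFieldType.
Hypothesis charK : [pchar K] =i pred0.
Implicit Types (f g h : {mpoly K[3]}) (a b c u v w l : 'rV[K]_3).

Lemma ord2_ind (Q : 'I_2 -> Prop) : Q ord0 -> Q ord_max -> forall i, Q i.
Proof.
by move=> h0 h1 [[|[|//]] lt]; [move: h0|move: h1]; congr Q; apply: val_inj.
Qed.

(** If the determinant of the two forms on [w1], [w2] were zero, they would have a common zero other
    than the point. *)
Lemma projection_lin P u (L : 2.-tuple {mpoly K[3]}) : point_of u P ->
  projection_from P L -> exists l : 'I_2 -> 'rV[K]_3,
  [/\ forall i, tnth L i = lin (l i), forall i, dotp (l i) u = 0
    & forall a, dotp a u = 0 -> exists x y, a = x *: l ord0 + y *: l ord_max].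
Proof.
move=> uP [hL hP]; have /fin_all_exists[l lE] := fun i => lin_homog (hL i).
have lu i : dotp (l i) u = 0.
  rewrite -lin_eval -lE; have [h _] := hP u; apply: h.
  by apply/(P2_mem _ uP); exists 1; rewrite scale1r.
exists l; split=> // a au; have [u0 _] := uP.
have [b [m1 [m2 [w1 [w2 [[bu mu1 mu2] [m11 m12 m21 m22] fr]]]]]] := dual_frame u0.
have sp c (cu : dotp c u = 0) := form_span cu fr.
set x0 := dotp (l ord0) w1; set y0 := dotp (l ord0) w2.
set x1 := dotp (l ord_max) w1; set y1 := dotp (l ord_max) w2.
have key p q : x0 * p + y0 * q = 0 -> x1 * p + y1 * q = 0 -> p = 0 /\ q = 0.
  move=> h0 h1; have [k kE] : exists k, p *: w1 + q *: w2 = k *: u.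
    apply/(P2_mem _ uP)/hP; apply: ord2_ind; rewrite lE lin_eval dotpDr !dotpZr.
      by rewrite [p * _]mulrC [q * _]mulrC.
    by rewrite [p * _]mulrC [q * _]mulrC.
  have e1 := congr1 (dotp m1) kE; have e2 := congr1 (dotp m2) kE.
  move: e1 e2; rewrite !dotpDr !dotpZr m11 m12 m21 m22 mu1 mu2.
  by rewrite !mulr0 !mulr1 addr0 add0r.
have D : x0 * y1 - x1 * y0 != 0.
  apply/eqP => D; have [] := key y0 (- x0); first by ring.
    by apply/eqP; rewrite -oppr_eq0; apply/eqP; rewrite -D; ring.
  move=> y0_0 /eqP; rewrite oppr_eq0 => /eqP x0_0.
  have [||y1_0 /eqP] := key y1 (- x1); [by rewrite -D; ring|by ring|].
  rewrite oppr_eq0 => /eqP x1_0.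
  have [||/eqP] := key 1 0; try by rewrite !(x0_0, x1_0, mul0r, mulr0, addr0).
  by rewrite oner_eq0.
have [x [y [ex ey]]] := cramer2 (dotp a w1) (dotp a w2) D.
exists x, y; rewrite (sp a au) (sp _ (lu ord0)) (sp _ (lu ord_max)).
rewrite -ex -ey -/x0 -/x1 -/y0 -/y1 !scalerDr !scalerA !scalerDl.
by rewrite addrACA.
Qed.

(** A homology is sent to the class of all tuples representing it. [gal_linear] makes this onto, and
    [lint_minors_inj] makes it injective. *)
Lemma gal_deck d f u P : (3 < d)%N -> smooth_plane_curve d f -> point_of u P ->
  f.@[u 0] = 0 -> card_eq (gal f P) (deck f u).
Proof.
move=> d3 sm uP fu; have [u0 _] := uP; have d1 : (1 < d)%N by apply: leq_trans d3.
have d2 : (2 < d)%N by apply: leq_trans d3.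
have pr := form_prime_smooth charK sm; have [f0 hf _] := sm.
rewrite card_eq_sym.
pose tau l := [set G | rat_eq f (lint (hmx u l)) G]%classic.
have rr l : deck f u l -> rat_rep f (lint (hmx u l)).
  by case=> /hmx_unit uA _; apply: rat_rep_lint sm uA.
apply: (@set_bij_card_eq _ _ _ _ tau); split.
- move=> l hl; split; first by exists (lint (hmx u l)) => //; apply: bir_lint sm hl.
  have [b [m1 [m2 [w1 [w2 [[bu mu1 mu2] [m11 m12 m21 m22] fr]]]]]] := dual_frame u0.
  exists (lint (hmx u l)), [tuple lin m1; lin m2]; split.
  + exact/rat_eq_refl/rr.
  + split; first by apply: ord2_ind; apply: dhomog_lin.
    move=> v; split=> [/(P2_mem _ uP)[k ->]|h].
      by apply: ord2_ind; rewrite (tnth_nth 0) /= lin_eval dotpZr ?mu1 ?mu2 mulr0.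
    have := h ord0; have := h ord_max; rewrite !(tnth_nth 0) /= !lin_eval => h1 h2.
    by apply/(P2_mem _ uP); exists (dotp b v); rewrite {1}[v]fr h1 h2 !scale0r !addr0.
  have -> : rat_comp [tuple lin m1; lin m2] (lint (hmx u l)) = [tuple lin m1; lin m2].
    have e m : dotp m u = 0 -> lin m \mPo lint (hmx u l) = lin m.
      move=> mu; rewrite -lact_comp lact_lin // /hmx raddfD /= trmx1 trmx_mul trmxK.
      rewrite mulmxDr mulmx1 mulmxA.
      suff -> : m *m u^T = 0 by rewrite mul0mx addr0.
      apply/rowP => i; rewrite !mxE -[RHS]mu; apply: eq_bigr => j _.
      by rewrite !mxE (ord1 i).
    apply: eq_from_tnth; apply: ord2_ind; rewrite tnth_mktuple !(tnth_nth 0) /=; exact: e.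
  apply: rat_eq_refl; split; first by exists 1%N; apply: ord2_ind; apply: dhomog_lin.
  exists ord0 => /(zero_on_lt hf (dhomog_lin m1) d1) /eqP; apply/negP/lin_neq0.
  by apply/eqP => m0; move/eqP: m11; rewrite m0 dotpC dotp0 eq_sym oner_eq0.
- move=> l l' /set_mem hl /set_mem hl' e.
  apply: (lint_minors_inj charK d2 sm u0) => a b; apply: rat_eq_lc.
  have [_ _ //] : rat_eq f (lint (hmx u l)) (lint (hmx u l')).
  by rewrite -[rat_eq _ _ _]/(tau l _) e; apply/rat_eq_refl/rr.
move=> _ [[F0 [[_ fF0] _] <-] [F [L [/= F0F prL LF]]]].
have fF := rat_eq_zero_on_comp charK sm F0F fF0.
have [l [lE lu lsp]] := projection_lin uP prL.
have [_ [[e he] _] _] := F0F.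
have LFE i : tnth (rat_comp L F) i = lc (l i) F.
  rewrite tnth_mktuple lE /lin /lc rmorph_sum; apply: eq_bigr => j _.
  by rewrite /= comp_mpolyZ comp_mpolyXU -tnth_nth.
have [[_ [i0 Li0]] _ mLF] := LF.
have [la lau] := gal_linear charK d3 sm u0 fu.
move/(_ e F he fF) => []; last 1 first.
- move=> z z0 hz; pose k := (z - 1) *: la.
  have Fk i j : zero_on f (tnth F i * tnth (lint (hmx u k)) j
       - tnth F j * tnth (lint (hmx u k)) i).
    by rewrite -!lc_delta; apply: hz.
  have ku : 1 + dotp k u != 0 by rewrite dotpC dotpZr dotpC lau mulr1 addrC subrK.
  have FkE : rat_eq f F (lint (hmx u k)).
    split=> //; first by case: F0F.
    by apply: rat_rep_lint sm _ => //; apply: hmx_unit.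
  have dk : deck f u k.
    by split=> //; rewrite lact_comp; apply: (rat_eq_zero_on_comp charK sm FkE fF).
  exists k => //; apply/seteqP; split=> G /= hG.
    by apply: (rat_eq_trans pr F0F); exact: (rat_eq_trans pr FkE hG).
  apply: (rat_eq_trans pr (rat_eq_sym FkE)).
  by exact: (rat_eq_trans pr (rat_eq_sym F0F) hG).
- move=> a b /lsp[x [y ->]] /lsp[x' [y' ->]].
  have lc2 (p q : K) G : lc (p *: l ord0 + q *: l ord_max) G
     = p%:MP * lc (l ord0) G + q%:MP * lc (l ord_max) G.
    by rewrite -[p *: _ + _]addr0 -(scale0r 0) lc_sum3 scale0r addr0 !mul_mpolyC.
  have lin2 (p q : K) : lin (p *: l ord0 + q *: l ord_max)
     = p%:MP * lin (l ord0) + q%:MP * lin (l ord_max).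
    by rewrite -[p *: _ + _]addr0 -(scale0r 0) lin_sum3 scale0r addr0 !mul_mpolyC.
  rewrite !lc2 !lin2 span_minors; apply: zero_onMr.
  by have := mLF ord0 ord_max; rewrite !LFE !lE.
by exists (l i0) => //; rewrite -LFE.
Qed.

End DeckGroup.

(** Multiplication by an element z permutes [s], so comparing the products of all elements gives
    z^(size s) = 1. Thus [s] consists of all roots of unity of that order. *)
Lemma mul_closed_primitive_root (F : fieldType) (s : seq F) : uniq s -> (0 < size s)%N ->
  (forall x, x \in s -> x != 0) -> (forall x y, x \in s -> y \in s -> x * y \in s) ->
  exists2 z, z \in s & (size s).-primitive_root z.
Proof.
move=> us s0 nz cl; have /hasP[z zs zp] : has (size s).-primitive_root s.
  apply: has_prim_root => //; apply/allP => z zs; apply/unity_rootP.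
  have z0 := nz z zs; have pe : perm_eq [seq z * x | x <- s] s.
    have um : uniq [seq z * x | x <- s] by rewrite map_inj_uniq //; apply: mulfI.
    apply: uniq_perm => //.
    have sub : {subset [seq z * x | x <- s] <= s}.
      by move=> _ /mapP[x xs ->]; apply: cl.
    by have [] := uniq_min_size um sub; rewrite ?size_map.
  have p0 : \prod_(x <- s) x != 0.
    by rewrite prodf_seq_neq0; apply/allP => x /nz xn; apply/implyP.
  apply: (mulIf p0); rewrite mul1r -{2}(perm_big _ pe) big_map big_split /=.
  by rewrite big_const_seq count_predT iter_mulr_1.
by exists z.
Qed.

(** * Quasi-Galois points and homologies of finite order *)

Section Stars.
Variable K : closedFieldType.
Hypothesis charK : [pchar K] =i pred0.
Implicit Types (f g h : {mpoly K[3]}) (a b c u v w l : 'rV[K]_3).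

Lemma dotp_trmx a (A : 'M[K]_3) v : dotp (a *m A^T) v = dotp a (v *m A).
Proof. by rewrite -!lin_eval -lact_lin // lactE. Qed.

Lemma deck_axis d f u : (3 < d)%N -> smooth_plane_curve d f -> u != 0 -> f.@[u 0] = 0 ->
  exists2 la, dotp la u = 1 & forall l, deck f u l -> l = dotp l u *: la.
Proof.
move=> d3 sm u0 fu; have [la lau h] := gal_linear charK d3 sm u0 fu.
have d2 : (2 < d)%N by apply: leq_trans d3.
exists la => // l [lu fl]; have [] := h 1%N (lint (hmx u l)).
- exact: dhomog_lint.
- by rewrite -lact_comp.
- move=> a b au bu; rewrite !(lc_hmx charK) au bu !scale0r !addr0 mulrC subrr.
  exact: zero_on0.
- have [b [m1 [m2 [w1 [w2 [[bu mu1 mu2] [m11 m12 m21 m22] fr]]]]]] := dual_frame u0.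
  have [_ hf _] := sm; exists m1; rewrite ?mu1 // (lc_hmx charK) mu1 scale0r addr0.
  have d1 : (1 < d)%N by apply: leq_trans d3.
  move/(zero_on_lt hf (dhomog_lin m1) d1)/eqP; apply/negP/lin_neq0.
  by apply/eqP => m0; move/eqP: m11; rewrite m0 dotpC dotp0 eq_sym oner_eq0.
move=> z z0 hz; have lE := lint_minors_inj charK d2 sm u0 hz.
by rewrite lE [dotp (_ *: _) _]dotpC dotpZr dotpC lau mulr1.
Qed.

Definition sig u la (z : K) := hmx u ((z - 1) *: la).

Lemma sigE u la z v : v *m sig u la z = v + ((z - 1) * dotp la v) *: u.
Proof. by rewrite hmxE [dotp (_ *: _) _]dotpC dotpZr dotpC. Qed.

Lemma sigM u la z y : dotp la u = 1 -> sig u la z *m sig u la y = sig u la (z * y).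
Proof.
move=> lau; apply/row_matrixP => i; rewrite !rowE mulmxA !sigE.
rewrite dotpDr dotpZr lau mulr1 -addrA -scalerDl; congr (_ + _ *: _); ring.
Qed.

(** What is retained of a quasi-Galois point <u>: a homology of order n, with axis la = 0, that
    fixes the form [f] itself and not merely the curve. *)
Definition star f n u la := [/\ u != 0, f.@[u 0] = 0, dotp la u = 1, (1 < n)%N
  & exists2 z, n.-primitive_root z & lact (sig u la z) f = f].

(** Invariance of the curve gives invariance of [f] up to a scalar. The scalar is 1 because the axis
    has a point off the curve, and the homology fixes it. *)
Lemma sig_fix d f u la z : (1 < d)%N -> smooth_plane_curve d f -> dotp la u = 1 ->
  z != 0 -> zero_on f (lact (sig u la z) f) -> lact (sig u la z) f = f.
Proof.
move=> d1 sm lau z0 fz; have uA : sig u la z \in unitmx.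
  by apply: hmx_unit; rewrite dotpC dotpZr dotpC lau mulr1 addrC subrK.
have [c c0 fE] := lact_form_const charK sm uA fz.
have la0 : la != 0 by apply/eqP => la0; move/eqP: lau; rewrite la0 dotpC dotp0 eq_sym oner_eq0.
have [B lB fB] := line_nonroot charK d1 sm la0.
have := lactE (sig u la z) f B; rewrite fE mevalZ sigE lB mulr0 scale0r addr0.
by rewrite -[RHS]mul1r => /(mulIf fB) ->; rewrite scale1r.
Qed.

(** With a common axis, a homology is determined by the factor 1 + l(u) by which it scales [u].
    These n factors are closed under multiplication, so one of them is a primitive n-th root of
    unity. *)
Lemma star_of_quasi_galois d f n u P : (3 < d)%N -> smooth_plane_curve d f ->
  quasi_galois_points f n P -> point_of u P -> exists la, star f n u la.
Proof.
move=> d3 sm [fP qP gP] uP; have [u0 _] := uP; have [_ hf _] := sm.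
have fu : f.@[u 0] = 0 by apply/(on_curve_point hf uP).
have d1 : (1 < d)%N by apply: leq_trans d3.
have n1 : (1 < n)%N.
  have : card_le (`I_2)%classic (`I_n)%classic by rewrite -(card_le_eqr gP); exact: qP.
  by rewrite card_le_II.
have [la lau ax] := deck_axis d3 sm u0 fu; exists la; split=> //.
have dn : card_eq (deck f u) (`I_n)%classic.
  by rewrite -(card_eql (gal_deck charK d3 sm uP fu)); exact: gP.
have : finite_set (deck f u) by apply/finite_setP; exists n.
case/finite_fsetP => X XE; have cX : #|` X| = n by apply/card_eq_fsetP; rewrite -XE.
have inX l : (l \in X) = `[< deck f u l >].
  by apply/idP/asboolP => h; [move: XE => /(congr1 (@^~ l)) /= -> | move: h; rewrite XE].
pose s := [seq 1 + dotp l u | l <- X].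
have deckz z : 1 + dotp ((z - 1) *: la) u = z.
  by rewrite dotpC dotpZr dotpC lau mulr1 addrC subrK.
have sP z : reflect (z != 0 /\ zero_on f (lact (sig u la z) f)) (z \in s).
  apply: (iffP mapP) => [[l]|[z0 fz]].
    rewrite inX => /asboolP dl ->; have [l0 fl] := dl.
    split; first exact: l0.
    by rewrite /sig [1 + _]addrC addrK -(ax l dl).
  exists ((z - 1) *: la); rewrite ?deckz // inX; apply/asboolP.
  by split; rewrite ?deckz.
have ss : size s = n by rewrite size_map -cX.
have us : uniq s.
  rewrite map_inj_in_uniq ?fset_uniq // => l l' ; rewrite !inX => /asboolP dl /asboolP dl'.
  by move/addrI => e; rewrite (ax l dl) (ax l' dl') e.
have [|||z /sP[z0 fz] zp] := mul_closed_primitive_root us.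
- by rewrite ss; apply: leq_trans n1.
- by move=> x /sP[].
- move=> x y /sP[x0 fx] /sP[y0 fy]; apply/sP; split; first by rewrite mulf_neq0.
  rewrite -(sigM _ _ lau) -(lact_mul charK (sig u la x) (sig u la y) f).
  by rewrite (congr1 (lact (sig u la x)) (sig_fix d1 sm lau y0 fy)).
exists z; first by rewrite -ss.
exact: sig_fix sm lau z0 fz.
Qed.

Lemma deck_conj f u l (g : 'M[K]_3) : g \in unitmx -> lact g f = f ->
  deck f u l -> deck f (u *m g) (l *m (invmx g)^T).
Proof.
move=> ug fg [lu fl]; split; first by rewrite dotp_trmx mulmxK.
have -> : hmx (u *m g) (l *m (invmx g)^T) = invmx g *m hmx u l *m g.
  apply/row_matrixP => i; rewrite !rowE !mulmxA !hmxE dotp_trmx mulmxDl -scalemxAl.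
  by rewrite mulmxKV.
have fg' : lact (invmx g) f = f by rewrite -[in LHS]fg (lactK charK ug).
suff -> : lact (invmx g *m hmx u l *m g) f = lact (invmx g) (lact (hmx u l) f).
  by rewrite -{1}fg'; apply: zero_on_lact.
pose M := invmx g *m hmx u l.
apply: etrans (esym (lact_mul charK M g f)) _.
apply: etrans (congr1 (lact M) fg) (esym (lact_mul charK (invmx g) (hmx u l) f)).
Qed.

Lemma quasi_galois_conj d f n u P P' (g : 'M[K]_3) : (3 < d)%N -> smooth_plane_curve d f ->
  g \in unitmx -> lact g f = f -> point_of u P -> point_of (u *m g) P' ->
  quasi_galois_points f n P -> quasi_galois_points f n P'.
Proof.
move=> d3 sm ug fg uP uP' [fP qP gP]; have [_ hf _] := sm.
have fu : f.@[u 0] = 0 by apply/(on_curve_point hf uP).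
have fu' : f.@[(u *m g) 0] = 0 by rewrite -lactE // fg.
have fg' : lact (invmx g) f = f by rewrite -[in LHS]fg (lactK charK ug).
have ug' : invmx g \in unitmx by rewrite unitmx_inv.
have DD : card_eq (deck f u) (deck f (u *m g)).
  apply: (@set_bij_card_eq _ _ _ _ (fun l => l *m (invmx g)^T)); split.
  - by move=> l; apply: deck_conj.
  - move=> l l' _ _ /(congr1 (mulmx^~ g^T)) /=.
    by rewrite -!mulmxA -!trmx_mul mulmxV // trmx1 !mulmx1.
  move=> l hl; exists (l *m g^T); last by rewrite -mulmxA -trmx_mul mulVmx // trmx1 mulmx1.
  by have := deck_conj ug' fg' hl; rewrite (mulmxK ug u) (invmxK g); apply.
have GG : card_eq (gal f P) (gal f P').
  rewrite (card_eql (gal_deck charK d3 sm uP fu)) (card_eql DD).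
  by rewrite card_eq_sym; apply: gal_deck sm uP' fu'.
split; first exact/(on_curve_point hf uP').
  by rewrite /quasi_galois -(card_le_eqr GG); exact: qP.
by rewrite -(card_eql GG); exact: gP.
Qed.

End Stars.

(** For a symmetric matrix M, det(x, y, z)^2 det M is the determinant of the Gram matrix of x, y, z
    with respect to M. *)
Lemma hess_identity (T : comNzRingType) (a b c d e g x0 x1 x2 y0 y1 y2 z0 z1 z2 X0 X1 X2 Y0 Y1 Y2 Z0 Z1 Z2: T) :
  a * x0 + b * x1 + c * x2 = X0 -> b * x0 + d * x1 + e * x2 = X1 -> c * x0 + e * x1 + g * x2 = X2 ->
  a * y0 + b * y1 + c * y2 = Y0 -> b * y0 + d * y1 + e * y2 = Y1 -> c * y0 + e * y1 + g * y2 = Y2 ->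
  a * z0 + b * z1 + c * z2 = Z0 -> b * z0 + d * z1 + e * z2 = Z1 -> c * z0 + e * z1 + g * z2 = Z2 ->
  let p := x0 * X0 + x1 * X1 + x2 * X2 in
  let q := y0 * X0 + y1 * X1 + y2 * X2 in
  let r := z0 * X0 + z1 * X1 + z2 * X2 in
  let s := y0 * Y0 + y1 * Y1 + y2 * Y2 in
  let v := z0 * Y0 + z1 * Y1 + z2 * Y2 in
  let w := z0 * Z0 + z1 * Z1 + z2 * Z2 in
  (x0 * (y1 * z2 - y2 * z1) + x1 * (y2 * z0 - y0 * z2) + x2 * (y0 * z1 - y1 * z0)) ^+ 2 *
  (a * (d * g - e ^+ 2) - b * (b * g - c * e) + c * (b * e - c * d)) =
  p * (s * w - v ^+ 2) - q * (q * w - r * v) + r * (q * v - r * s).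
Proof. move=> <- <- <- <- <- <- <- <- <- /=. ring. Qed.

Lemma hess_combine (T : comNzRingType) (F F' s w v r : T) d e :
  F *+ d *+ e * (s * w - v ^+ 2) - F' *+ e * (F' *+ e * w - r * v)
    + r * (F' *+ e * v - r * s) =
  ((s * w - v ^+ 2) *+ d *+ e) * F + ((r * v *+ 2 - F' *+ e * w) *+ e) * F' - r ^+ 2 * s.
Proof.
have nE n : exists D, forall x : T, x *+ n = x * D.
  by exists n%:R => x; rewrite mulr_natr.
have [[D hD] [E hE]] := (nE d, nE e); rewrite !hD !hE mulr2n; ring.
Qed.

Lemma hess_cancel (T : comNzRingType) (x y q' a b r V V' U j : T) :
  U * (x * (x * y)) * q' = a * (U * (x * (x * y))) + b * (V * (x * y)) - r ^+ 2 * ((V' * x + V * j) * y) ->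
  r ^+ 2 * (V' * x + V * j) * y = x * ((a * U - q' * U) * x + b * V) * y.
Proof.
move=> E; apply/eqP; rewrite -subr_eq0; apply/eqP.
by rewrite -(subrr (U * (x * (x * y)) * q')) {2}E; ring.
Qed.

(** * The Hessian along a line and on the curve *)

Section Hessian.
Variable K : closedFieldType.
Hypothesis charK : [pchar K] =i pred0.
Implicit Types (f g h p : {mpoly K[3]}) (a b c u v w A B N : 'rV[K]_3).

Local Notation o0 := (ord0 : 'I_3).

Definition hess f : {mpoly K[3]} :=
  f^`M(o0)^`M(o0) * (f^`M(o1)^`M(o1) * f^`M(o2)^`M(o2) - f^`M(o1)^`M(o2) ^+ 2)
  - f^`M(o0)^`M(o1) * (f^`M(o0)^`M(o1) * f^`M(o2)^`M(o2) - f^`M(o0)^`M(o2) * f^`M(o1)^`M(o2))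
  + f^`M(o0)^`M(o2) * (f^`M(o0)^`M(o1) * f^`M(o1)^`M(o2) - f^`M(o0)^`M(o2) * f^`M(o1)^`M(o1)).

Lemma dhomog_hess d f : f \is d.-homog -> hess f \is (d.-2 + (d.-2 + d.-2)).-homog.
Proof.
move=> hf; have h i j : f^`M(i)^`M(j) \is d.-2.-homog by do 2! apply: dhomog_mderiv.
have h2 i j k l : f^`M(i)^`M(j) * f^`M(k)^`M(l) \is (d.-2 + d.-2).-homog by apply: dhomogM.
rewrite /hess expr2; apply: rpredD; first apply: rpredB; apply: dhomogM => //; exact: rpredB.
Qed.

Lemma lev_var A B i : lev 'X_i A B = line A B i.
Proof. by rewrite levE mmapX mmap1U. Qed.

Lemma lev_deriv p A B : (lev p A B)^`() = \sum_i (B 0 i)%:P * lev p^`M(i) A B.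
Proof.
rewrite levE deriv_mmap; apply: eq_bigr => i _; rewrite levE; congr (_ * _).
by rewrite /line derivD derivM !derivC derivX mulr0 mul1r addr0 add0r.
Qed.

Lemma lev_euler d p A B : p \is d.-homog ->
  \sum_i line A B i * lev p^`M(i) A B = lev p A B *+ d.
Proof.
move/euler_dhomog/(congr1 (levr A B)); rewrite rmorph_sum scaler_nat rmorphMn => <-.
by apply: eq_bigr => i _; rewrite -lev_var -levM.
Qed.

(* The determinant, in the basis A + tB, B, N, of the second derivative of f at A + tB; Euler's
   relation expresses its entries by f along the line. *)
Lemma hess_line d f A B N : f \is d.-homog -> exists a b r : {poly K},
  (dotp (cross A B) N ^+ 2)%:P * lev (hess f) A B =
     a * lev f A B + b * (lev f A B)^`() - r ^+ 2 * (lev f A B)^`()^`()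
  /\ r`_0 = d.-1%:R * dder f A N.
Proof.
move=> hf; pose G i := lev f^`M(i) A B; pose M i j := lev f^`M(i)^`M(j) A B.
have MC i j : M i j = M j i by rewrite /M mderiv_comm.
have hX i : M i o0 * line A B o0 + M i o1 * line A B o1 + M i o2 * line A B o2 = G i *+ d.-1.
  rewrite -(lev_euler A B (dhomog_mderiv i hf)) sum3.
  by rewrite !(mulrC (M i _)).
have hY i : M i o0 * (B 0 o0)%:P + M i o1 * (B 0 o1)%:P + M i o2 * (B 0 o2)%:P = (G i)^`().
  by rewrite lev_deriv sum3 !(mulrC (M i _)).
have hZ i : M i o0 * (N 0 o0)%:P + M i o1 * (N 0 o1)%:P + M i o2 * (N 0 o2)%:P =
   M i o0 * (N 0 o0)%:P + M i o1 * (N 0 o1)%:P + M i o2 * (N 0 o2)%:P by [].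
have := hX o1; have := hX o2; have := hY o1; have := hY o2; have := hZ o1; have := hZ o2.
rewrite !(MC o1 o0) !(MC o2 o0) !(MC o2 o1) => z2 z1 y2 y1 x2 x1.
have := hess_identity (hX o0) x1 x2 (hY o0) y1 y2 (hZ o0) z1 z2.
move: {hX hY hZ x1 x2 y1 y2 z1 z2}(M o0 o0 * _ + _ + _) => Z0.
move: (M o0 o1 * _ + _ + _) => Z1; move: (M o0 o2 * _ + _ + _) => Z2.
move=> /=; set r := (N 0 o0)%:P * (G o0 *+ _) + _ + _.
set v := (N 0 o0)%:P * _ + _ + _; set w := (N 0 o0)%:P * _ + _ + _.
have -> : line A B o0 * (G o0 *+ d.-1) + line A B o1 * (G o1 *+ d.-1)
    + line A B o2 * (G o2 *+ d.-1) = lev f A B *+ d *+ d.-1.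
  by rewrite -(lev_euler A B hf) sum3 !mulrnAr -!mulrnDl.
have F1 : (lev f A B)^`() = (B 0 o0)%:P * G o0 + (B 0 o1)%:P * G o1 + (B 0 o2)%:P * G o2.
  by rewrite lev_deriv sum3.
have -> : (B 0 o0)%:P * (G o0 *+ d.-1) + (B 0 o1)%:P * (G o1 *+ d.-1)
    + (B 0 o2)%:P * (G o2 *+ d.-1) = (lev f A B)^`() *+ d.-1.
  by rewrite F1 !mulrnAr -!mulrnDl.
have -> : (B 0 o0)%:P * (G o0)^`() + (B 0 o1)%:P * (G o1)^`() + (B 0 o2)%:P * (G o2)^`()
   = (lev f A B)^`()^`().
  by rewrite F1 !derivD !derivM !derivC !mul0r !add0r.
have -> : line A B o0 * ((B 0 o1)%:P * (N 0 o2)%:P - (B 0 o2)%:P * (N 0 o1)%:P) +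
   line A B o1 * ((B 0 o2)%:P * (N 0 o0)%:P - (B 0 o0)%:P * (N 0 o2)%:P) +
   line A B o2 * ((B 0 o0)%:P * (N 0 o1)%:P - (B 0 o1)%:P * (N 0 o0)%:P)
   = (dotp (cross A B) N)%:P.
  rewrite dotp3; case: (crossE A B) => -> -> ->; rewrite /line.
  by rewrite !(polyCD, polyCN, polyCM); ring.
have -> : M o0 o0 * (M o1 o1 * M o2 o2 - M o1 o2 ^+ 2) - M o0 o1 * (M o0 o1 * M o2 o2 - M o0 o2 * M o1 o2)
   + M o0 o2 * (M o0 o1 * M o1 o2 - M o0 o2 * M o1 o1) = lev (hess f) A B.
  by rewrite /hess !expr2 !(levB, levD, levM).
set F := lev f A B; set F' := F^`(); set F'' := F'^`() => E.
exists ((F'' * v - w ^+ 2) *+ d *+ d.-1), ((r * w *+ 2 - F' *+ d.-1 * v) *+ d.-1), r.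
split; last first.
  rewrite /r !coefD !coefCM !coefMn !lev_coef0 /dder sum3 !mulrnAr -!mulrnDl.
  by rewrite mulr_natl.
rewrite rmorphXn /= E; apply: hess_combine.
Qed.

Lemma deriv_Xn_mul (q : {poly K}) k :
  (q * 'X^(k.+1))^`() = (q^`() * 'X + q *+ k.+1) * 'X^k.
Proof. by rewrite derivM derivXn exprS mulrDl mulrA mulrnAr mulrnAl. Qed.

Lemma dvdXn_deriv (p : {poly K}) k : 'X^(k.+1) %| p -> 'X^k %| p^`().
Proof.
case/dvdpP => q pE; apply/dvdpP; exists (q^`() * 'X + q *+ k.+1).
by rewrite pE deriv_Xn_mul.
Qed.

(** By [hess_line] the Hessian on the line is a combination of F, F' and F'', where F is the
    restriction of [f]; two derivatives cost two orders. *)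
Lemma hess_contact d f A B k : f \is d.-homog -> cross A B != 0 ->
  'X^(k.+2) %| lev f A B -> 'X^k %| lev (hess f) A B.
Proof.
move=> hf AB0 hk; have [N ABN] := dotp_surj AB0.
have [a [b [r [E _]]]] := hess_line A B N hf; move: E; rewrite ABN expr1n polyC1 mul1r => ->.
have h1 := dvdXn_deriv hk; have h2 := dvdXn_deriv h1.
have w (i j : nat) (p : {poly K}) : (i <= j)%N -> 'X^j %| p -> 'X^i %| p.
  by move=> ij; apply: dvdp_trans; apply: dvdp_exp2l.
apply: dvdp_sub; last by apply: dvdp_mull.
apply: dvdp_add; apply: dvdp_mull; [apply: w hk|apply: w h1] => //; lia.
Qed.

Lemma point_exists d f : (0 < d)%N -> f \is d.-homog -> exists2 u : 'rV[K]_3, u != 0 & f.@[u 0] = 0.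
Proof.
move=> d0 hf; case: (@line_root _ f d (delta_mx 0 o0) (delta_mx 0 o1) hf d0) => [h|[c h]].
  by exists (delta_mx 0 o1) => //; apply: delta_neq0.
exists (delta_mx 0 o0 + c *: delta_mx 0 o1 : 'rV[K]_3) => //.
by apply/eqP => /rowP/(_ o0)/eqP; rewrite !mxE !eqxx /= mulr0 addr0 oner_eq0.
Qed.

Lemma lev_smooth_neq0 d f A B : (1 < d)%N -> smooth_plane_curve d f ->
  cross A B != 0 -> lev f A B != 0.
Proof.
move=> d1 sm AB0; have [_ hf _] := sm.
apply/eqP => /(lev_eq0_dvd charK hf AB0) [g fE].
have [C lC fC] := line_nonroot charK d1 sm AB0.
by move: fC; rewrite fE mevalM lin_eval lC mul0r eqxx.
Qed.

(** On the tangent line at a point [A], let F, the restriction of [f], have order j + 2. If [f]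
    divided the Hessian, [hess_line] would put r^2 F'' in the ideal generated by F and F', hence in
    order at least j + 1. But F'' has order exactly j in characteristic 0, and r is nonzero at
    [A]. *)
Lemma hess_not_zero_on d f : (1 < d)%N -> smooth_plane_curve d f -> ~ zero_on f (hess f).
Proof.
move=> d1 sm [q Hq]; have [f0 hf _] := sm.
have [A A0 fA] := point_exists (ltnW d1) hf.
have [N' fN'] := smooth_dder sm A0 fA.
have [N fN] : exists N, dder f A N = 1.
  by exists ((dder f A N')^-1 *: N'); rewrite dderZ mulVf.
have gA : dotp (grad f A) A = 0 by rewrite -dder_grad (dder_self _ hf) fA mulr0.
have [B' gB' cB'] := kernel_vector gA A0; pose B := - B'.
have gB : dotp (grad f A) B = 0 by rewrite dotpNr gB' oppr0.
have cB : cross A B = grad f A.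
  rewrite -cB'; apply/rowP; case: (crossE A B) => h0 h1 h2; case: (crossE B' A) => k0 k1 k2.
  by apply: ord3_ind; rewrite ?(h0, h1, h2) ?(k0, k1, k2) !mxE; ring.
have AB0 : cross A B != 0.
  by rewrite cB; apply/eqP => g0; move/eqP: fN; rewrite dder_grad g0 dotpC dotp0 eq_sym oner_eq0.
have F0 : lev f A B != 0 by apply: lev_smooth_neq0 sm AB0.
have [k [U]] := multiplicity_XsubC (lev f A B) 0; rewrite F0 /= polyC0 subr0 => U0 FE.
have {U0} : U`_0 != 0 by move: U0; rewrite /root horner_coef0.
case: k FE => [|[|j]] FE U0.
- by case/negP: U0; rewrite -[U]mulr1 -(expr0 'X) -FE lev_coef0 fA.
- have := lev_coef1 f A B; rewrite FE expr1 coefMX /= dder_grad gB => /eqP.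
  by rewrite (negPf U0).
have [a [b [r [E r0]]]] := hess_line A B N hf.
move: E r0; rewrite cB -dder_grad fN expr1n polyC1 mul1r mulr1 Hq levM.
move: (lev q A B) => q'; rewrite FE !deriv_Xn_mul => E r0.
set V := U^`() * 'X + U *+ j.+2 in E.
have {E} E : r ^+ 2 * (V^`() * 'X + V *+ j.+1) = 'X * ((a * U - q' * U) * 'X + b * V).
  apply: (mulIf (monic_neq0 (monicXn K j))).
  rewrite -[V *+ _]mulr_natr; apply: hess_cancel; rewrite -!exprS mulr_natr.
  exact: E.
have := congr1 (fun p : {poly K} => p`_0) E; rewrite coefXM /= coef0M coefD coefMX /= add0r.
rewrite coefMn /V coefD coefMX /= add0r coefMn expr2 coef0M r0 => /eqP.
rewrite -(mulr_natr _ j.+1) -(mulr_natr _ j.+2) !mulf_eq0 (negPf U0).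
have d' : (0 < d.-1)%N by case: (d) d1 => [|[]].
by rewrite !(negPf (pchar0_natr_neq0 charK (ltn0Sn _))) (negPf (pchar0_natr_neq0 charK d')).
Qed.
End Hessian.

(** * Contacts at a centre and along its axis, and the weighted count *)

Section StarGeometry.
Variable K : closedFieldType.
Hypothesis charK : [pchar K] =i pred0.
Implicit Types (f g h p : {mpoly K[3]}) (a b c u v w A B l la : 'rV[K]_3).

Lemma cross_prop u v : v != 0 -> cross u v = 0 -> exists c : K, u = c *: v.
Proof.
move=> v0 e; have [h0 h1 h2] := crossE u v; move: h0 h1 h2; rewrite e !mxE.
move=> /esym/subr0_eq h0 /esym/subr0_eq h1 /esym/subr0_eq h2.
have /existsP[i vi] : [exists i, v 0 i != 0].
  rewrite -negb_forall; apply: contra v0 => /forallP h.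
  by apply/eqP/rowP => i; rewrite mxE; apply/eqP.
exists (u 0 i / v 0 i); apply/rowP => j; rewrite mxE; apply: (mulIf vi).
rewrite mulrAC divfK //; move: i j {vi}.
by apply: ord3_ind; apply: ord3_ind; rewrite ?(h0, h1, h2).
Qed.

Lemma lev_scaler p A (z : K) B j : (lev p A (z *: B))`_j = z ^+ j * (lev p A B)`_j.
Proof.
have -> : lev p A (z *: B) = lev p A B \Po (z *: 'X).
  apply: (poly_eq_horner charK) => t; rewrite horner_comp !lev_horner !hornerE.
  by rewrite scalerA mulrC.
rewrite comp_polyE; under eq_bigr => i _ do rewrite exprZn scalerA.
rewrite -(poly_def _ (fun i => (lev p A B)`_i * z ^+ i)) coef_poly [RHS]mulrC.
by case: ltnP => // h; rewrite nth_default ?mul0r.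
Qed.

Lemma lev_scale p d (z : K) A B : p \is d.-homog ->
  lev p (z *: A) (z *: B) = z ^+ d *: lev p A B.
Proof.
move=> hp; apply: (poly_eq_horner charK) => t; rewrite hornerZ !lev_horner.
by rewrite -(meval_vecZ _ _ hp) scalerDr !scalerA mulrC.
Qed.

Lemma lev_homog_eval p d A B (s t : K) : p \is d.-homog ->
  p.@[(s *: A + t *: B) 0] = \sum_(j < d.+1) (lev p A B)`_j * t ^+ j * s ^+ (d - j).
Proof.
move=> hp; have [sz cd] := size_coef_lev A B hp; have [->|s0] := eqVneq s 0.
  rewrite scale0r add0r (meval_vecZ _ _ hp) big_ord_recr /= subnn mulr1 cd mulrC.
  rewrite big1 ?add0r // => i _; rewrite expr0n subn_eq0 leqNgt ltn_ord mulr0 //.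
have -> : s *: A + t *: B = s *: (A + (t / s) *: B) by rewrite scalerDr scalerA mulrC divfK.
rewrite (meval_vecZ _ _ hp) -lev_horner (horner_coef_wide _ sz) mulr_sumr.
apply: eq_bigr => i _; have le : (i <= d)%N by rewrite -ltnS.
rewrite expr_div_n mulrCA -mulrA; congr (_ * _).
by rewrite -{1}(subnK le) exprD mulrCA mulfK ?expf_neq0.
Qed.

Lemma lev_shear p d A B (a0 : K) (b0 : K) : p \is d.-homog -> lev p A (a0 *: A + b0 *: B)
  = \sum_(j < d.+1) ((lev p A B)`_j * b0 ^+ j) *: ('X^j * (1 + a0 *: 'X) ^+ (d - j)).
Proof.
move=> hp; apply: (poly_eq_horner charK) => t; rewrite lev_horner horner_sum.
have -> : A + t *: (a0 *: A + b0 *: B) = (1 + a0 * t) *: A + (b0 * t) *: B.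
  by rewrite scalerDr !scalerA scalerDl scale1r addrA [t * a0]mulrC [t * b0]mulrC.
rewrite (lev_homog_eval _ _ _ _ hp); apply: eq_bigr => j _.
by rewrite !hornerE exprMn !mulrA.
Qed.

(** The same line from the same point [A], with another second point. In degree k + 1 a new term
    with factor d - k appears; [star_axes_disjoint] needs it to be nonzero. *)
Lemma lev_shear_low p d A B (a0 b0 : K) k : p \is d.-homog -> (k <= d)%N ->
  (forall j, (j < k)%N -> (lev p A B)`_j = 0) ->
  (lev p A (a0 *: A + b0 *: B))`_k = (lev p A B)`_k * b0 ^+ k /\
  ((k < d)%N -> (lev p A (a0 *: A + b0 *: B))`_k.+1 = (lev p A B)`_k.+1 * b0 ^+ k.+1
    + (lev p A B)`_k * b0 ^+ k * (a0 *+ (d - k))).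
Proof.
move=> hp kd low; rewrite (lev_shear _ _ _ _ hp).
have cj (i j : nat) : ('X^i * (1 + a0 *: 'X) ^+ (d - i) : {poly K})`_j =
    if (j < i)%N then 0 else ((1 + a0 *: 'X) ^+ (d - i) : {poly K})`_(j - i).
  by rewrite coefXnM.
have c0 e : ((1 + a0 *: 'X : {poly K}) ^+ e)`_0 = 1.
  by rewrite -horner_coef0 !hornerE ?mulr0 ?addr0 expr1n.
have c1 e : ((1 + a0 *: 'X : {poly K}) ^+ e)`_1 = a0 *+ e.
  elim: e => [|e IH]; first by rewrite expr0 coef1.
  rewrite exprS mulrDl mul1r coefD IH -scalerAl coefZ coefXM /= c0 mulr1.
  by rewrite mulrS addrC.
rewrite coef_sum; split=> [|lt].
  rewrite (bigD1 (Ordinal (kd : (k < d.+1)%N))) //= coefZ cj ltnn subnn c0 mulr1 big1 ?addr0 //.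
  move=> j jk; rewrite coefZ cj; case: ltnP; rewrite ?mulr0 // => jlk.
  by rewrite low ?mul0r // ltn_neqAle jlk andbT; apply: contra jk => /eqP e; apply/eqP/val_inj.
rewrite coef_sum (bigD1 (Ordinal (lt : (k.+1 < d.+1)%N))) //= coefZ cj ltnn subnn c0 mulr1.
congr (_ + _); rewrite (bigD1 (Ordinal (kd : (k < d.+1)%N))) //=; last first.
  by apply/eqP => /(congr1 val) /= e; move: (ltnn k); rewrite {2}e ltnS leqnn.
rewrite coefZ cj ltnNge leqnSn /= subSnn c1 big1 ?addr0 // => j /andP[jk1 jk].
rewrite coefZ cj; case: ltnP; rewrite ?mulr0 // => jlk.
rewrite low ?mul0r // ltn_neqAle -ltnS [(j < _)%N]ltn_neqAle jlk andbT; apply/andP; split.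
  by apply: contra jk => /eqP e; apply/eqP/val_inj.
by apply: contra jk1 => /eqP e; apply/eqP/val_inj.
Qed.

(** The homology fixes [v] and scales [u] by z, so the coefficient of degree j equals z^j times
    itself. *)
Lemma star_coef_axis f n u la v j : star f n u la -> dotp la v = 0 ->
  ~~ (n %| j)%N -> (lev f v u)`_j = 0.
Proof.
case=> _ _ lau _ [z zp fz] lv nj.
have := lev_lact charK (sig u la z) f v u; rewrite fz !sigE lv lau mulr0 scale0r addr0 mulr1.
rewrite -{2}[u]scale1r -scalerDl addrC subrK => /(congr1 (fun q : {poly K} => q`_j)).
rewrite lev_scaler => /eqP; rewrite -subr_eq0 -{1}[_`_j]mul1r -mulrBl mulf_eq0.
by rewrite subr_eq0 eq_sym -(prim_order_dvd zp) (negPf nj) => /eqP.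
Qed.

Lemma star_tangent d f n u la : smooth_plane_curve d f -> star f n u la ->
  exists2 v, dotp la v = 0 & dder f u v != 0.
Proof.
move=> sm [u0 fu lau _ _]; have [w hw] := smooth_dder sm u0 fu; have [_ hf _] := sm.
exists (w - dotp la w *: u); first by rewrite dotpDr dotpNr dotpZr lau mulr1 subrr.
by rewrite dderD -scaleNr dderZ (dder_self _ hf) fu !mulr0 addr0.
Qed.

(** The homology scales [u] and fixes [v], so a nonzero coefficient of degree j forces z^d = z^j. By
    smoothness some direction on the axis has a nonzero coefficient of degree 1, hence z^d = z. *)
Lemma star_coef_center d f n u la v j : smooth_plane_curve d f -> star f n u la ->
  dotp la v = 0 -> (lev f u v)`_j != 0 -> j = 1 %[mod n].
Proof.
move=> sm st lv; have [_ _ lau _ [z zp fz]] := st; have [_ hf _] := sm.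
have key w k : dotp la w = 0 -> (lev f u w)`_k != 0 -> z ^+ d = z ^+ k.
  move=> lw h; have := lev_lact charK (sig u la z) f u w.
  rewrite fz !sigE lw lau mulr0 scale0r addr0 mulr1.
  rewrite -{2}[u]scale1r -scalerDl addrC subrK => E.
  have := congr1 (fun q : {poly K} => q`_k) (lev_scale z u w hf).
  by rewrite lev_scaler coefZ -E => /(mulIf h).
have [w lw fw] := star_tangent sm st.
move=> /(key _ _ lv) e; have := key w 1%N lw; rewrite lev_coef1 => /(_ fw).
by rewrite e => /eqP; rewrite (eq_prim_root_expr zp) => /eqP.
Qed.

Lemma cross_neq0 u v : v != 0 -> (forall c : K, u <> c *: v) -> cross u v != 0.
Proof. by move=> v0 h; apply/eqP => /(cross_prop v0)[c]; apply: h. Qed.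

Lemma dotp_neq0l la u : dotp la u != 0 -> la != 0.
Proof. by apply: contra => /eqP ->; rewrite dotpC dotp0. Qed.

Lemma cross_transversal la u v : dotp la u != 0 -> dotp la v = 0 -> v != 0 ->
  cross u v != 0.
Proof.
move=> lu lv v0; apply: cross_neq0 => // c e; move: lu.
by rewrite e dotpZr lv mulr0 eqxx.
Qed.

Lemma crossC u v : cross v u = - cross u v.
Proof.
apply/rowP; case: (crossE u v) => h0 h1 h2; case: (crossE v u) => k0 k1 k2.
by apply: ord3_ind; rewrite [in RHS]mxE ?(h0, h1, h2) ?(k0, k1, k2); ring.
Qed.

Lemma cross_scale u (x : K) : cross (x *: u) u = 0.
Proof.
apply/rowP; case: (crossE (x *: u) u) => h0 h1 h2.
by apply: ord3_ind; rewrite [in RHS]mxE ?(h0, h1, h2) !mxE; ring.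
Qed.

Lemma cross_indep u v (x y : K) : cross u v != 0 -> x *: u + y *: v = 0 -> x = 0 /\ y = 0.
Proof.
move=> uv e; have x0 : x = 0.
  apply/eqP; apply: contraNT uv => x0; have -> : u = (- (x^-1 * y)) *: v.
    by apply: (scalerI x0); rewrite scalerA mulrN mulVKf // scaleNr; apply/eqP; rewrite -addr_eq0 e.
  by rewrite cross_scale.
split=> //; apply/eqP; move/eqP: e; rewrite x0 scale0r add0r scaler_eq0.
by case/orP => // /eqP v0; move: uv; rewrite v0 -{1}(scale0r u) crossC cross_scale oppr0 eqxx.
Qed.

Lemma dvdXn_coef (p : {poly K}) k : (forall j, (j < k)%N -> p`_j = 0) -> 'X^k %| p.
Proof.
move=> h; rewrite -(poly_take_drop k p); have -> : take_poly k p = 0.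
  by apply/polyP => j; rewrite coef_take_poly coef0; case: ifP => // /h.
by rewrite add0r dvdp_mulIr.
Qed.

Lemma horner_lev_deriv p A B (c : K) : (lev p A B)^`().[c] = dder p (A + c *: B) B.
Proof.
rewrite lev_deriv horner_sum; apply: eq_bigr => i _.
by rewrite hornerM hornerC lev_horner.
Qed.

(** On the tangent line only exponents congruent to 1 modulo n occur, and 1 itself does not, so the
    least possible one is n + 1. *)
Lemma star_flex d f n u la : smooth_plane_curve d f -> star f n u la ->
  exists w, [/\ dotp la w = 0, cross u w != 0 & 'X^(n.+1) %| lev f u w].
Proof.
move=> sm st; have [u0 fu lau n1 _] := st; have [_ hf _] := sm.
have lu : dotp la u != 0 by rewrite lau oner_neq0.
have [v lv fv] := star_tangent sm st.
have gu : dotp (grad f u) u = 0 by rewrite -dder_grad (dder_self _ hf) fu mulr0.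
(* The point where the tangent at [u] meets the axis. *)
pose w := cross (grad f u) la; have lw : dotp la w = 0 by rewrite dotpC dotp_crossr.
have gw : dotp (grad f u) w = 0 by rewrite dotpC dotp_crossl.
have w0 : w != 0.
  apply: cross_neq0; first exact: dotp_neq0l lu.
  move=> c e; have : c = 0 by move: gu; rewrite e dotpC dotpZr dotpC lau mulr1.
  by move=> c0; move: fv; rewrite dder_grad e c0 scale0r dotpC dotp0 eqxx.
exists w; split=> //; first exact: cross_transversal lw w0.
apply/dvdXn_coef => j; rewrite ltnS => jn; apply/eqP/contraT => nz.
have jlt : (j < n)%N.
  rewrite ltn_neqAle jn andbT; apply/eqP => jE.
  by have := star_coef_center sm st lw nz; rewrite jE modnn modn_small.
have := star_coef_center sm st lw nz; rewrite !modn_small // => j1; move: nz; rewrite j1 lev_coef1 dder_grad gw eqxx //.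
Qed.

(** A double root of [f] on the axis would be a singular point: the derivative vanishes along the
    axis by multiplicity, and in the direction of [u] because n does not divide 1. *)
Lemma star_axis_points d f n u la : (1 < d)%N -> smooth_plane_curve d f -> star f n u la ->
  exists V : 'I_d -> 'rV[K]_3,
  [/\ forall k, dotp la (V k) = 0, forall k, f.@[V k 0] = 0, forall k, V k != 0
    & forall i j, i != j -> cross (V i) (V j) != 0].
Proof.
move=> d1 sm st; have [u0 fu lau n1 _] := st; have [_ hf _] := sm.
have lu : dotp la u != 0 by rewrite lau oner_neq0.
have [B lB fB] := line_nonroot charK d1 sm (dotp_neq0l lu).
have B0 : B != 0.
  by apply: contra fB => /eqP ->; rewrite (meval_vec0 hf) // ltnW.
have [A lA AB] := kernel_vector lB B0.
have AB0 : cross A B != 0 by rewrite AB; apply: dotp_neq0l lu.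
pose F := lev f A B; have sF : size F = d.+1 by apply: size_lev.
have F0 : F != 0 by rewrite -size_poly_gt0 sF.
have Vn (c : K) : A + c *: B != 0.
  apply/eqP => e; have [] := cross_indep (x := 1) (y := c) AB0; first by rewrite scale1r.
  by move/eqP; rewrite oner_eq0.
have F0' : lead_coef F != 0 by rewrite lead_coef_eq0.
have [s sE] := closed_field_poly_normal F.
have us : uniq s.
  rewrite -separable_prod_XsubC -(eqp_separable (eqp_scale _ F0')) -sE unlock.
  apply: Pdiv.ClosedField.root_coprimep => c; rewrite /root lev_horner => /eqP fc.
  rewrite horner_lev_deriv; set v := A + c *: B in fc *.
  have lv : dotp la v = 0 by rewrite dotpDr dotpZr lA lB mulr0 addr0.
  have [w hw] := smooth_dder sm (Vn c) fc; apply: contra hw => /eqP vB.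
  have fvu : dder f v u = 0.
    by rewrite -lev_coef1 (star_coef_axis st lv) // dvdn1; apply/eqP => n1E; rewrite n1E in n1.
  have lw : dotp (cross A B) (w - dotp la w *: u) = 0.
    by rewrite AB dotpDr dotpNr dotpZr lau mulr1 subrr.
  have [x [y wE]] := cross_span AB0 lw.
  have -> : w = x *: v + (y - x * c) *: B + dotp la w *: u.
    apply/eqP; rewrite -subr_eq wE /v scalerDr scalerA scalerBl -addrA.
    by rewrite [X in _ == _ + X]addrC subrK.
  by rewrite !dderD !dderZ vB fvu (dder_self _ hf) fc !mulr0 !addr0.
have ss : size s = d.
  apply: eq_add_S; rewrite -sF sE size_scale ?lead_coef_eq0 // size_prod_XsubC //.
have rs (c : K) : c \in s -> f.@[(A + c *: B) 0] = 0.
  move=> cs; rewrite -lev_horner -/F sE hornerZ; apply/eqP; rewrite mulf_eq0; apply/orP; right.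
  by rewrite -/(root _ c) root_prod_XsubC.
exists (fun k : 'I_d => A + nth 0 s k *: B); split=> [k|k|k|k l kl] //.
- by rewrite dotpDr dotpZr lA lB mulr0 addr0.
- by apply: rs; rewrite mem_nth // ss.
apply: cross_neq0 => // c; set x := nth 0 s k; set y := nth 0 s l => e.
have [] := cross_indep (x := 1 - c) (y := x - c * y) AB0.
  apply/eqP; rewrite !scalerBl scale1r addrACA -opprD -scalerA -scalerDr subr_eq0.
  exact/eqP.
move=> /subr0_eq <-; rewrite mul1r => /subr0_eq/eqP; rewrite nth_uniq ?ss //.
by rewrite (inj_eq val_inj) (negPf kl).
Qed.

Lemma poly_low_coef (p : {poly K}) : p != 0 ->
  exists k, p`_k != 0 /\ forall j, (j < k)%N -> p`_j = 0.
Proof.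
move=> p0; have ex : exists k, p`_k != 0.
  by exists (size p).-1; rewrite -lead_coefE lead_coef_eq0.
case: (ex_minnP ex) => k pk low; exists k; split=> // j jk.
by apply/eqP/contraT => /low; rewrite leqNgt jk.
Qed.

Lemma coef_lev_le d f A B k : f \is d.-homog -> (lev f A B)`_k != 0 -> (k <= d)%N.
Proof.
move=> hf nz; have [sz _] := size_coef_lev A B hf.
by rewrite -ltnS; apply: leq_trans sz; rewrite ltnNge; apply: contra nz => /leq_sizeP -> //.
Qed.

(* On the line through the two centres, the intersection number with the curve at [u] would be
   1 modulo n and 0 modulo n'. *)
Lemma star_center_off_axis d f m n n' u u' la la' : (1 < d)%N -> smooth_plane_curve d f ->
  (1 < m)%N -> (m %| n)%N -> (m %| n')%N -> star f n u la -> star f n' u' la' ->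
  (forall c : K, u' <> c *: u) -> dotp la' u != 0.
Proof.
move=> d1 sm m1 mn mn' st st' uu'; apply/eqP => lu; have [_ hf _] := sm.
have [u0 fu lau n1 _] := st.
pose v := u' - dotp la u' *: u.
have lv : dotp la v = 0 by rewrite dotpDr dotpNr dotpZr lau mulr1 subrr.
have v0 : v != 0 by apply/eqP => /subr0_eq; apply: uu'.
have uv : cross u v != 0 by apply: cross_transversal lv v0; rewrite lau oner_neq0.
have [k [nz low]] := poly_low_coef (lev_smooth_neq0 charK d1 sm uv).
have k1 := star_coef_center sm st lv nz.
have [ck _] := lev_shear_low (dotp la u') 1 hf (coef_lev_le hf nz) low.
move: ck; rewrite expr1n mulr1 scale1r addrC subrK => ck.
have n'k : (n' %| k)%N.
  by apply: contraT => h; move: nz; rewrite -ck (star_coef_axis st' lu h) eqxx.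
have : (m %| 1)%N.
  move: (dvdn_trans mn' n'k); rewrite (divn_eq k n) k1 (modn_small n1) dvdn_addr //.
  by rewrite dvdn_mull.
by rewrite dvdn1 => /eqP me; rewrite me in m1.
Qed.

(* The tangent line at a common point [v] of the curve and of both axes would pass through both
   centres; the two lowest coefficients of [f] along it have consecutive degrees, both
   divisible by n'. *)
Lemma star_axes_disjoint d f n n' u u' la la' v : (1 < d)%N -> smooth_plane_curve d f ->
  star f n u la -> star f n' u' la' -> (forall c : K, u' <> c *: u) ->
  v != 0 -> f.@[v 0] = 0 -> dotp la v = 0 -> dotp la' v <> 0.
Proof.
move=> d1 sm st st' uu' v0 fv lv lv'; have [_ hf _] := sm.
have [u0 fu lau n1 _] := st; have [_ _ lau' n1' _] := st'.
have nd1 k : (1 < k)%N -> ~~ (k %| 1)%N by case: k => [|[]].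
have gv : dotp (grad f v) v = 0 by rewrite -dder_grad (dder_self _ hf) fv mulr0.
have gu : dotp (grad f v) u = 0.
  by rewrite -dder_grad -lev_coef1 (star_coef_axis st lv) ?nd1.
have gu' : dotp (grad f v) u' = 0.
  by rewrite -dder_grad -lev_coef1 (star_coef_axis st' lv') ?nd1.
have [A gA Av] := kernel_vector gv v0.
have Av0 : cross A v != 0.
  have [w] := smooth_dder sm v0 fv; rewrite dder_grad -Av.
  by apply: contra => /eqP ->; rewrite dotpC dotp0.
move: gu gu'; rewrite -Av => /(cross_span Av0)[x [y uE]] /(cross_span Av0)[x' [y' uE']].
have x0 : x != 0.
  apply/eqP => x0; move/eqP: lau; rewrite uE x0 scale0r add0r dotpZr lv mulr0.
  by rewrite eq_sym oner_eq0.
pose a0 := x' / x; pose b0 := y' - a0 * y.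
have u'E : u' = b0 *: v + a0 *: u.
  by rewrite uE scalerDr !scalerA divfK // scalerBl [x' *: A + _]addrC addrA subrK addrC.
have a_neq0 : a0 != 0.
  apply/eqP => e; move/eqP: lau'; rewrite u'E e scale0r addr0 dotpZr lv' mulr0.
  by rewrite eq_sym oner_eq0.
have b_neq0 : b0 != 0.
  by apply/eqP => e; apply: (uu' a0); rewrite {1}u'E e scale0r add0r.
have vu : cross v u != 0.
  rewrite crossC oppr_eq0; apply: cross_transversal lv v0; by rewrite lau oner_neq0.
have [k [nz low]] := poly_low_coef (lev_smooth_neq0 charK d1 sm vu).
have kd := coef_lev_le hf nz.
have kd' : (k < d)%N.
  rewrite ltn_neqAle kd andbT; apply/eqP => e; have [_ cd] := size_coef_lev v u hf.
  by move: nz; rewrite e cd fu eqxx.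
have [ck ck1] := lev_shear_low b0 a0 hf kd low.
move/(_ kd'): ck1; rewrite -u'E in ck *.
have nk : (n %| k)%N.
  by apply: contraT => h; move: nz; rewrite (star_coef_axis st lv h) eqxx.
have -> : (lev f v u)`_k.+1 = 0.
  apply: (star_coef_axis st lv); rewrite -addn1 dvdn_addr // nd1 //.
rewrite mul0r add0r => ck1.
have pw : (lev f v u)`_k * a0 ^+ k != 0 by rewrite mulf_neq0 ?expf_neq0.
have n'k : (n' %| k)%N.
  by apply: contraT => h; move: pw; rewrite -ck (star_coef_axis st' lv' h) eqxx.
have : ~~ (n' %| k.+1)%N by rewrite -addn1 dvdn_addr // nd1.
move/(star_coef_axis st' lv'); rewrite ck1 => /eqP.
rewrite mulf_eq0 (negPf pw) /= -mulr_natr mulf_eq0 (negPf b_neq0) /=.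
by rewrite (negPf (pchar0_natr_neq0 charK _)) // subn_gt0.
Qed.

Lemma star_axis_contact f n u la v : star f n u la -> dotp la v = 0 -> f.@[v 0] = 0 ->
  'X^n %| lev f v u.
Proof.
move=> st lv fv; apply: dvdXn_coef => -[_|j jn]; first by rewrite lev_coef0.
apply: (star_coef_axis st lv); apply/negP => h.
by have := dvdn_leq (ltn0Sn j) h; rewrite leqNgt jn.
Qed.

Lemma star_sum d f m (T : finType) (n : T -> nat) (u la : T -> 'rV[K]_3) :
  (2 < d)%N -> smooth_plane_curve d f -> (1 < m)%N -> (forall t, m %| n t)%N ->
  (forall t, star f (n t) (u t) (la t)) ->
  (forall s t, s != t -> forall c : K, u s <> c *: u t) ->
  (\sum_t (n t - 1 + d * (n t - 2)) <= 3 * d * (d - 2))%N.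
Proof.
move=> d2 sm m1 mn st un; have d1 : (1 < d)%N by apply: leq_trans d2.
have [_ hf _] := sm.
have /fin_all_exists[w wP] := fun t => star_flex sm (st t).
have /fin_all_exists[V VP] := fun t => star_axis_points d1 sm (st t).
pose Q (i : T + T * 'I_d) := match i with inl t => u t | inr (t, k) => V t k end.
pose R (i : T + T * 'I_d) := match i with inl t => w t | inr (t, k) => u t end.
pose e (i : T + T * 'I_d) := match i with inl t => (n t - 1)%N | inr (t, k) => (n t - 2)%N end.
have n1 t : (1 < n t)%N by case: (st t).
have lu t : dotp (la t) (u t) != 0 by case: (st t) => _ _ -> _ _; apply: oner_neq0.
have off s t : dotp (la t) (u s) != 0.
  have [->//|ts] := eqVneq s t.
  by apply: (star_center_off_axis d1 sm m1 (mn s) (mn t) (st s) (st t)); apply: un; rewrite eq_sym.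
(* The contact exceeds the weight by two, the loss of [hess_contact]: n + 1 = (n - 1) + 2 at a
   centre, n = (n - 2) + 2 on an axis. *)
have ct i : cross (Q i) (R i) != 0 /\ 'X^((e i).+2) %| lev f (Q i) (R i).
  case: i => [t|[t k]] /=.
    have [lw uw hw] := wP t; split=> //; apply: dvdp_trans hw; apply: dvdp_exp2l.
    by have := n1 t; lia.
  have [lV fV V0 _] := VP t; split.
    by rewrite crossC oppr_eq0; apply: (cross_transversal (lu t)).
  by have := star_axis_contact (st t) (lV k) (fV k); rewrite -[in X in X -> _](subnK (n1 t)) addn2.
have dist i j : i != j -> cross (Q i) (Q j) != 0.
  case: i j => [t|[t k]] [s|[s l]] /= ij.
  - apply: cross_neq0; first by case: (st s).
    by apply: un; apply: contra ij => /eqP ->.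
  - by have [lV _ V0 _] := VP s; apply: (cross_transversal (off t s)).
  - by have [lV _ V0 _] := VP t; rewrite crossC oppr_eq0; apply: (cross_transversal (off s t)).
  have [lV fV V0 VV] := VP t; have [lV' _ V0' _] := VP s.
  have [ts|ts] := eqVneq t s.
    by subst s; apply: VV; apply: contra ij => /eqP ->.
  apply: cross_neq0 => // c e0.
  apply: (star_axes_disjoint d1 sm (st t) (st s) (un _ _ _) (V0 k) (fV k) (lV k)).
    by rewrite eq_sym.
  by rewrite e0 dotpZr lV' mulr0.
have : (\sum_i e i <= d * (d.-2 + (d.-2 + d.-2)))%N.
  apply: (@bezout_count _ charK d f (hess f) _ _ Q R e sm _ (dhomog_hess hf)) => //.
  - exact: ltnW.
  - by case: (d) d2 => [|[|[]]].
  - exact: hess_not_zero_on sm.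
  - by move=> i; case: (ct i).
  - move=> i; have [_ h] := ct i; apply: dvdp_trans h; apply: dvdp_exp2l; lia.
  by move=> i; have [c h] := ct i; apply: hess_contact hf c h.
rewrite big_sumType /=.
have -> : (\sum_p e (inr p) = \sum_t \sum_(k < d) (n t - 2))%N.
  by rewrite pair_bigA; apply: eq_bigr => -[].
under [X in (_ + X)%N]eq_bigr => t _ do rewrite sum_nat_const card_ord.
rewrite -big_split /= => h; apply: leq_trans h _.
rewrite -subn2; lia.
Qed.

End StarGeometry.

(** * Orbits of the homologies on the set of centres *)

Section Counting.
Variable K : closedFieldType.
Hypothesis charK : [pchar K] =i pred0.
Variables (d m N : nat) (f : {mpoly K[3]}).
Hypotheses (d1 : (1 < d)%N) (sm : smooth_plane_curve d f) (m1 : (1 < m)%N).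
Implicit Types (u v w L la : 'rV[K]_3).

(** Distinct indices give distinct points of the plane, not merely distinct vectors. *)
Definition separated (A : Type) (g : A -> 'rV[K]_3) :=
  forall a b (c : K), g a = c *: g b -> a = b.

Variable S : set 'rV[K]_3.
Hypothesis S_star : forall v, S v -> exists n la, [/\ (N <= n)%N, (m %| n)%N & star f n v la].
Hypothesis S_mul : forall v (g : 'M[K]_3), g \in unitmx -> lact g f = f -> S v -> S (v *m g).

Lemma S_neq0 v : S v -> v != 0.
Proof. by move/S_star => [n [la [_ _ []]]]. Qed.

Lemma S_orbit v : S v -> exists la (z : K), [/\ forall i j : 'I_N, z ^+ i = z ^+ j -> i = j,
  forall w, S w -> (forall c : K, v <> c *: w) -> dotp la w != 0
  & forall w k, S w -> S (w + ((z ^+ k - 1) * dotp la w) *: v)].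
Proof.
move=> Sv; have [n [la [Nn mn st]]] := S_star Sv; have [v0 fv lav n1 [z zp fz]] := st.
have z0 : z != 0.
  apply/eqP => z0; have /eqP := prim_expr_order zp; rewrite z0 expr0n eqn0Ngt (ltnW n1) /=.
  by rewrite eq_sym oner_eq0.
exists la, z; split=> [i j /eqP|w Sw vw|w k Sw].
- rewrite (eq_prim_root_expr zp) !modn_small; first by move/eqP/val_inj.
    exact: leq_trans (ltn_ord j) Nn.
  exact: leq_trans (ltn_ord i) Nn.
- have [n' [la' [_ mn' st']]] := S_star Sw.
  exact: (star_center_off_axis charK d1 sm m1 mn' mn st' st).
elim: k => [|k IH]; first by rewrite expr0 subrr mul0r scale0r addr0.
have uA : sig v la z \in unitmx.
  by apply: hmx_unit; rewrite dotpC dotpZr dotpC lav mulr1 addrC subrK.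
have := S_mul uA fz IH; rewrite sigE dotpDr dotpZr lav mulr1 -addrA -scalerDl.
congr (S (_ + _ *: _)); rewrite exprS; ring.
Qed.

(** [None] is the centre [v1] and [Some k] runs through N points of the orbit of [v2] under its
    group, all on the line through [v1] and [v2]. *)
Lemma S_line v1 v2 : S v1 -> S v2 -> cross v2 v1 != 0 ->
  exists g : option 'I_N -> 'rV[K]_3, [/\ forall a, S (g a), separated g
   & forall a, dotp (cross v2 v1) (g a) = 0].
Proof.
move=> S1 S2 v12; have [la [z [zN off orb]]] := S_orbit S1.
have l2 : dotp la v2 != 0.
  apply: off => // c e; move: v12; rewrite crossC e cross_scale oppr0 eqxx //.
pose x k := (z ^+ k - 1) * dotp la v2.
exists (fun a : option 'I_N => if a is Some k then v2 + x k *: v1 else v1); split.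
- by case=> [k|//]; apply: orb.
- case=> [i|] [j|] c // e.
  + have [] := cross_indep (x := 1 - c) (y := x i - c * x j) v12.
      rewrite !scalerBl scale1r addrACA -opprD -(scalerA c (x j)) -scalerDr.
      by apply/eqP; rewrite subr_eq0 e.
    move=> /subr0_eq <-; rewrite mul1r => /subr0_eq/(mulIf l2)/(addIr (-1)) h.
    by rewrite (zN _ _ h).
  + have [|/eqP] := cross_indep (x := 1) (y := x i - c) v12; last by rewrite oner_eq0.
    by rewrite scale1r scalerBl addrA e subrr.
  + have [|/eqP c0 /eqP] := cross_indep (x := - c) (y := 1 - c * x j) v12.
      by rewrite scalerBl scale1r scaleNr -(scalerA c (x j)) addrCA -opprD -scalerDr -e subrr.
    by move: c0; rewrite oppr_eq0 => /eqP ->; rewrite mul0r subr0 oner_eq0.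
case=> [k|]; last exact: dotp_crossr.
by rewrite dotpDr dotpZr dotp_crossl dotp_crossr mulr0 addr0.
Qed.

Lemma cone_unique L v u w (x y c : K) : dotp L v != 0 -> dotp L u = 0 -> dotp L w = 0 ->
  u + x *: v = c *: (w + y *: v) -> u = c *: w /\ x = c * y.
Proof.
move=> Lv Lu Lw e; have xy : x = c * y.
  apply: (mulIf Lv); have := congr1 (dotp L) e.
  by rewrite dotpZr !dotpDr !dotpZr Lu Lw !add0r mulrA.
by split=> //; move: e; rewrite scalerDr scalerA xy => /addIr.
Qed.

(** The N + 1 points of the line through [v1], [v2] lie on distinct lines through [v3]. On each of
    these lines the group of [v3] produces N centres, and [v3] itself is one more. *)
Lemma S_plane v1 v2 v3 : S v1 -> S v2 -> S v3 -> dotp (cross v2 v1) v3 != 0 ->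
  exists g : option (option 'I_N * 'I_N) -> 'rV[K]_3, (forall a, S (g a)) /\ separated g.
Proof.
move=> S1 S2 S3 L3; set L := cross v2 v1 in L3.
have L0 : cross v2 v1 != 0 by apply: dotp_neq0l L3.
have [q [Sq sq lq]] := S_line S1 S2 L0; rewrite -/L in lq.
have [la [z [zN off orb]]] := S_orbit S3.
have l0 a : dotp la (q a) != 0.
  by apply: off => // c e; move: L3; rewrite e dotpZr lq mulr0 eqxx.
pose x (p : option 'I_N * 'I_N) := (z ^+ p.2 - 1) * dotp la (q p.1).
exists (fun a => if a is Some p then q p.1 + x p *: v3 else v3); split.
  by case=> [p|//]; apply: orb.
have q0 a : q a != 0 := S_neq0 (Sq a).
have cu u w x y c := @cone_unique L v3 u w x y c L3; have L_0 : dotp L 0 = 0 := dotp0 L.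
case=> [p|] [p'|] c // e.
- have [qq xx] := cu _ _ _ _ _ (lq _) (lq _) e; have pp := sq _ _ _ qq.
  have c1 : c = 1.
    move/eqP: qq; rewrite pp -{1}[q _]scale1r -subr_eq0 -scalerBl scaler_eq0 (negPf (q0 _)) orbF.
    by rewrite subr_eq0 => /eqP.
  move: xx; rewrite c1 mul1r /x pp => /(mulIf (l0 _))/(addIr (-1))/zN.
  by case: p p' pp {e qq} => a k [b l] /= -> ->.
- have [] := cu (q p.1) 0 (x p) 1 c (lq _) L_0; first by rewrite add0r scale1r.
  by rewrite scaler0 => q00; move: (q0 p.1); rewrite q00 eqxx.
have [|/esym/eqP + c1] := cu 0 (q p'.1) 1 (x p') c L_0 (lq _); first by rewrite add0r scale1r.
rewrite scaler_eq0 (negPf (q0 _)) orbF => /eqP c0.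
by move/eqP: c1; rewrite c0 mul0r oner_eq0.
Qed.

Lemma collinear_card (T : finType) (p : T -> 'rV[K]_3) L : L != 0 -> separated p ->
  (forall t, p t != 0) -> (forall t, dotp L (p t) = 0) -> (forall t, f.@[p t 0] = 0) -> (#|T| <= d)%N.
Proof.
move=> L0 sp p0 Lp fp; have [_ hf _] := sm.
have [B LB fB] := line_nonroot charK d1 sm L0.
have B0 : B != 0 by apply: contra fB => /eqP ->; rewrite (meval_vec0 hf) // ltnW.
have [A LA AB] := kernel_vector LB B0; have AB0 : cross A B != 0 by rewrite AB.
have /fin_all_exists[x] : forall t, exists xy : K * K, p t = xy.1 *: A + xy.2 *: B.
  by move=> t; have [|a [b e]] := cross_span AB0 (v := p t); [rewrite AB|exists (a, b)].
move=> pE.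
have x0 t : (x t).1 != 0.
  apply: contra fB => /eqP e; have := fp t; rewrite pE e scale0r add0r (meval_vecZ _ _ hf).
  move/eqP; rewrite mulf_eq0 expf_eq0 => /orP[/andP[_ /eqP e']|//].
  by move: (p0 t); rewrite pE e e' !scale0r addr0 eqxx.
pose r t := (x t).2 / (x t).1.
have pr t : p t = (x t).1 *: (A + r t *: B).
  by rewrite pE scalerDr scalerA mulrC divfK.
have rI : injective r.
  move=> s t e; apply: (sp s t ((x s).1 / (x t).1)).
  by rewrite !pr scalerA divfK // e.
have F0 := lev_smooth_neq0 charK d1 sm AB0; have [sF _] := size_coef_lev A B hf.
have rr : all (root (lev f A B)) (codom r).
  apply/allP => _ /codomP[t ->]; rewrite /root lev_horner.
  have := fp t; rewrite pr (meval_vecZ _ _ hf) => /eqP.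
  by rewrite mulf_eq0 expf_eq0 (negPf (x0 t)) andbF.
have := max_poly_roots F0 rr; rewrite map_inj_uniq ?enum_uniq // size_codom => /(_ isT) lt.
by rewrite -ltnS; apply: leq_trans lt sF.
Qed.

Variables (T : finType) (p : T -> 'rV[K]_3).
Hypotheses (p_S : forall t, S (p t)) (p_sep : separated p).
Hypothesis p_all : forall v, S v -> exists t (c : K), v = c *: p t.

Lemma S_card (A : finType) (g : A -> 'rV[K]_3) :
  (forall a, S (g a)) -> separated g -> (#|A| <= #|T|)%N.
Proof.
move=> Sg sg; have /fin_all_exists[h hP] := fun a => p_all (Sg a).
apply: (@leq_card _ _ h) => a b e; have [[c gc] [c' gc']] := (hP a, hP b).
have c'0 : c' != 0.
  by apply/eqP => c'0; move: (S_neq0 (Sg b)); rewrite gc' c'0 scale0r eqxx.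
by apply: (sg a b (c / c')); rewrite gc gc' scalerA divfK // e.
Qed.

Lemma p_cross t t' : t != t' -> cross (p t) (p t') != 0.
Proof.
move=> tt; apply: cross_neq0; first exact: S_neq0.
by move=> c /p_sep e; rewrite e eqxx in tt.
Qed.

Lemma line_count : (1 < #|T|)%N -> (N < #|T|)%N.
Proof.
move=> /card_gt1P[t1 [t2 [_ _ t12]]].
have [g [Sg sg _]] := S_line (p_S t2) (p_S t1) (p_cross t12).
by have := S_card Sg sg; rewrite card_option card_ord.
Qed.

Lemma plane_count : (d < #|T|)%N -> (N.+1 * N < #|T|)%N.
Proof.
move=> dT; have /card_gt1P[t1 [t2 [_ _ t12]]] := ltn_trans d1 dT.
have [t3 L3] : exists t3, dotp (cross (p t1) (p t2)) (p t3) != 0.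
  apply: contrapT => h; move: dT; rewrite ltnNge => /negP; apply.
  apply: (collinear_card (p_cross t12) p_sep) => t; first exact: S_neq0.
    by apply: contrapT => /eqP ht; apply: h; exists t.
  by have [n [la [_ _ []]]] := S_star (p_S t).
have [g [Sg sg]] := S_plane (p_S t2) (p_S t1) (p_S t3) L3.
by have := S_card Sg sg; rewrite card_option card_prod card_option !card_ord.
Qed.

End Counting.

(** * Finiteness of the set of points of given order *)

Section Points.
Variable K : closedFieldType.
Hypothesis charK : [pchar K] =i pred0.
Variables (d : nat) (f : {mpoly K[3]}).
Hypotheses (d3 : (3 < d)%N) (sm : smooth_plane_curve d f).

Lemma point_inj (u v : 'rV[K]_3) P Q (c : K) : point_of u P -> point_of v Q ->
  u = c *: v -> P = Q.
Proof.
move=> [u0 uP] [v0 vQ] uE; apply: val_inj; rewrite uP vQ; apply/eqP.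
by rewrite eqEdim !dim_vline u0 v0 -memvE uE memvZ ?memv_line.
Qed.

Lemma point_eq (u v : 'rV[K]_3) P : point_of u P -> point_of v P -> exists c, u = c *: v.
Proof. by move=> [u0 uP] vP; apply/(P2_mem _ vP); rewrite uP memv_line. Qed.

Lemma quasi_galois_order n n' P : quasi_galois_points f n P ->
  quasi_galois_points f n' P -> n = n'.
Proof.
move=> [_ _ h] [_ _ h']; apply/card_eq_II.
by rewrite -(card_eql h) h'.
Qed.

(** Each star adds at least n - 1 >= 1 to the sum in [star_sum], so more than 3 d (d - 2) points are
    impossible. *)
Lemma finite_quasi_galois m n : (1 < m)%N -> (m %| n)%N ->
  finite_set (quasi_galois_points f n).
Proof.
move=> m1 mn; apply: contrapT => /(@infinite_set_fset _ _ (3 * d * (d - 2)).+1)[B Bn cB].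
have Bq (t : B) : quasi_galois_points f n (val t) by apply: Bn; apply: valP.
have /fin_all_exists[u uP] := fun t : B => P2_point (val t).
have /fin_all_exists[la st] := fun t : B => star_of_quasi_galois charK d3 sm (Bq t) (uP t).
have := star_sum charK (ltnW d3) sm m1 (fun=> mn) st.
move=> h; have {h} := h _; rewrite sum_nat_const -cardfE => h.
have /fset0Pn[x xB] : B != fset0 by rewrite -cardfs_gt0; apply: leq_trans cB.
have [_ _ _ n1 _] := st [` xB]%fset.
have {h} h : (#|` B| * (n - 1 + d * (n - 2)) <= 3 * d * (d - 2))%N.
  by apply: h => s t st' c /(point_inj (uP s) (uP t))/val_inj e; rewrite e eqxx in st'.
suff : (#|` B| <= 3 * d * (d - 2))%N by rewrite leqNgt cB.
by apply: leq_trans h; rewrite leq_pmulr // addn_gt0 subn_gt0 n1.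
Qed.

End Points.

End Lemmas.

Theorem theorem4p6 (K : closedFieldType) (charK : [pchar K]%R =i pred0)
    (d : nat) (d_ge4 : 4 <= d)
    (f : {mpoly K[3]}) (smooth_f : smooth_plane_curve d f)
    (r : nat) (ns : 'I_r.+1 -> nat)
    (ns_gt0 : forall i : 'I_r.+1, 0 < ns i)
    (ns_incr : forall i j : 'I_r.+1, i < j -> ns i < ns j)
    (m : nat) (m_ge2 : 2 <= m) (m_dvd : forall i : 'I_r.+1, m %| ns i) :
  let n := ns ord0 in
  [/\ forall i : 'I_r.+1, finite_set (quasi_galois_points f (ns i)),
      \sum_(i < r.+1) delta f (ns i) * (ns i - 1 + d * (ns i - 2))
        <= 3 * d * (d - 2),
      (n + 1) * (n - 1 + d * (n - 2)) > 3 * d * (d - 2) ->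
        \sum_(i < r.+1) delta f (ns i) <= 1
    & (n ^ 2 + n + 1) * (n - 1 + d * (n - 2)) > 3 * d * (d - 2) ->
        \sum_(i < r.+1) delta f (ns i) <= d].
Proof.
move=> n; pose QG i := quasi_galois_points f (ns i).
have fin i : finite_set (QG i) by apply: (finite_quasi_galois charK d_ge4 smooth_f m_ge2).
pose X i := fset_set (QG i).
have inX i P : (P \in X i) <-> QG i P by rewrite in_fset_set // inE.
pose T : finType := {i : 'I_r.+1 & X i}.
have TQ (t : T) : QG (tag t) (val (tagged t)) by apply/inX/valP.
have /fin_all_exists[p pP] := fun t : T => P2_point (val (tagged t)).
have /fin_all_exists[la st] := fun t : T =>
  star_of_quasi_galois charK d_ge4 smooth_f (TQ t) (pP t).
have ns_inj : injective ns.
  move=> i j e; apply/val_inj; case: (ltngtP i j) => // /ns_incr; by rewrite e ltnn.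
(* A point has one order and the n_i are distinct, so no point is counted for two indices. *)
have sep : separated p.
  move=> [i P] [j Q] c /(point_inj (pP _) (pP _)) /= PQ.
  have ij : i = j.
    have QP := TQ (Tagged (fun i => X i) P); have QQ := TQ (Tagged (fun i => X i) Q).
    by apply: ns_inj; apply: (quasi_galois_order QP); rewrite /= PQ.
  by subst j; congr existT; apply: val_inj.
have sumT (F : nat -> nat) : \sum_(t : T) F (ns (tag t)) = \sum_i delta f (ns i) * F (ns i).
  rewrite -(@sig_big_dep _ _ _ _ (fun i => X i) xpredT (fun _ => xpredT)
    (fun i _ => F (ns i))) /=.
  by apply: eq_bigr => i _; rewrite sum_nat_const -cardfE.
have cT : #|T| = \sum_i delta f (ns i).
  by rewrite -sum1_card (sumT (fun=> 1)); apply: eq_bigr => i _; rewrite muln1.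
have tot : \sum_i delta f (ns i) * (ns i - 1 + d * (ns i - 2)) <= 3 * d * (d - 2).
  rewrite -(sumT (fun k => k - 1 + d * (k - 2))).
  apply: (star_sum charK (ltnW d_ge4) smooth_f m_ge2 _ st) => [t|s t stn c e]; first exact: m_dvd.
  by move: stn; rewrite (sep _ _ _ e) eqxx.
have n_min i : n <= ns i.
  by have [->//|i0] := eqVneq i ord0; apply/ltnW/ns_incr; rewrite lt0n.
have bound : #|T| * (n - 1 + d * (n - 2)) <= 3 * d * (d - 2).
  apply: leq_trans tot; rewrite cT big_distrl; apply: leq_sum => i _.
  by rewrite leq_mul2l leq_add ?orbT ?leq_sub2r // leq_mul2l leq_sub2r ?orbT.
(* All nonzero vectors over the counted points; conjugation preserves the order of the group, so
   linear automorphisms of [f] preserve this set. *)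
pose S : set 'rV[K]_3 := fun v => exists i P, point_of v P /\ QG i P.
have S_star v : S v -> exists k l, [/\ (n <= k)%N, (m %| k)%N & star f k v l].
  case=> i [P [vP Pi]]; have [l sl] := star_of_quasi_galois charK d_ge4 smooth_f Pi vP.
  by exists (ns i), l.
have S_mul v (g : 'M[K]_3) : g \in unitmx -> lact g f = f -> S v -> S (v *m g)%R.
  move=> ug fg [i [P [vP Pi]]]; have vg : (v *m g != 0)%R.
    have [v0 _] := vP; apply: contra v0 => /eqP e.
    by rewrite -(mulmxK ug v) e mul0mx.
  have [P' vP'] := P2_mk vg; exists i, P'; split=> //.
  exact: (quasi_galois_conj charK d_ge4 smooth_f ug fg vP vP' Pi).
have p_S t : S (p t) by exists (tag t), (val (tagged t)).
have p_all v : S v -> exists t (c : K), v = (c *: p t)%R.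
  case=> i [P [vP /inX Pi]]; pose t : T := Tagged (fun i => X i) [` Pi]%fset.
  by exists t; apply: point_eq vP (pP t).
have d1 : 1 < d by apply: leq_trans d_ge4.
have absurd k : 3 * d * (d - 2) < k * (n - 1 + d * (n - 2)) -> k <= #|T| -> False.
  move=> h kT; have := leq_trans h (leq_trans (leq_mul kT (leqnn _)) bound).
  by rewrite ltnn.
(* One point too many yields at least n + 1 of them in (2), or n^2 + n + 1 in (3). Each contributes
   at least as much as a point of the least order n, against the bound of (1). *)
split=> // h; rewrite -cT leqNgt; apply/negP => lt; apply: (absurd _ h).
  rewrite addn1.
  exact: (line_count charK d1 smooth_f m_ge2 S_star S_mul p_S sep p_all lt).
rewrite addn1 -mulnn addnC -mulSn.
exact: (plane_count charK d1 smooth_f m_ge2 S_star S_mul p_S sep p_all lt).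
Qed.
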